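(* Let $z_0\in I$, $z_0>0$, be sufficiently small (depending on $w,S,b,h$). Let $\gamma$ be a unit speed geodesic of $(M,g_\varepsilon)$ starting at the waist $\{z=0\}$ upwards, at an angle of impact $\varphi\in(0,\frac\pi2)$, and ending in $\{z=z_0\}$. Then, as $\varepsilon\to0$, its total angular length satisfies $$\mathrm{length}_Y(\gamma)=\frac{1}{\varepsilon^{k-1}}\left[\mathcal{C}_\varphi\cos\varphi+R\right],$$ where the remainder $R$ depends on $\gamma$ and satisfies $$R=\begin{cases}\mathcal{O}(\varepsilon)&\text{if }k>2,\\ \mathcal{O}(\varepsilon\log\varepsilon)&\text{if }k=2,\end{cases}$$ the estimates being uniform for $\varphi$ in any compact subset of $(0,\pi/2]$. Here $$\mathcal{C}_\varphi=\int_0^\infty\frac{dZ}{f(Z)^k\sqrt{f(Z)^{2k}-\cos^2\varphi}} ,$$ and if $f-1$ vanishes to finite order $2\ell$ at $Z=0$, then for some constant $C>0$, as $\varphi\to0$, $$\mathcal{C}_\varphi\sim\begin{cases}C\,\varphi^{-\frac{\ell-1}{\ell}}&\text{if }\ell>1,\\ C\log(\varphi^{-1})&\text{if }\ell=1,\end{cases}$$ where $\sim$ means that the quotient tends to $1$.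
   Context: **Scaling function.** $k\ge2$ is an integer. $w=w(\varepsilon,z)$, $\varepsilon\ge0$, $z\in\mathbb{R}$, is continuous, is smooth and positive for $(\varepsilon,z)\ne(0,0)$, vanishes at $(0,0)$, and satisfies $\mathrm{sgn}(\partial_z w)=\mathrm{sgn}(z)$, $w(\varepsilon,0)=\varepsilon$, $w(0,z)=|z|$ and $w(\lambda\varepsilon,\lambda z)=\lambda w(\varepsilon,z)$ for $\lambda>0$. Put $f(Z)=w(1,Z)$, so $w=\varepsilon f(z/\varepsilon)$. **Metric.** $Y$ is a smooth compact manifold (without boundary) of dimension $n-1$, $I$ is an open interval containing $0$, $M=I\times Y$ with points $(z,y)$. For $\varepsilon\in(0,1)$, $$g_\varepsilon=(1-w^\kappa S)\,dz^2+2w^{2k}\,dz\cdot b+w^{2k}h,$$ where $\kappa\ge k$ is an integer and $S,b,h$ are a function, a one-form and a Riemannian metric on $Y$ depending on the parameters $(\varepsilon,z)$. Regularity: $S,b,h$ are smooth on the blow-up, i.e. when written in terms of $(r,\phi,y)$ with $\varepsilon=r\cos\phi$, $z=r\sin\phi$, they are (extend) smooth down to $r=0$, for $\phi\in[-\frac\pi2,\frac\pi2]$, with $h$ remaining a metric; $\partial_z h$ is bounded; and, in the coordinates $(E,z)$ with $E=\varepsilon/z$ (for $z\ge0$), $\partial_E S=0$ at $E=z=0$, and similarly in the coordinates $(E_-,z)$, $E_-=-\varepsilon/z$, for $z\le0$. It is assumed throughout that $I$ and the range of $\varepsilon$ are small enough that $g_\varepsilon$ is a Riemannian metric for $\varepsilon>0$.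 **Geodesics.** $\gamma(t)=(z(t),y(t))$ is a unit speed geodesic with $z(0)=0$ moving upwards ($\dot z(0)\geq 0$). The angle of impact $\varphi\in[0,\frac\pi2]$ is the angle (with respect to $g_\varepsilon$) between $\dot\gamma(0)$ and the waist $\{z=0\}$. The angular length of $\gamma$ up to height $z_0$ is $\mathrm{length}_Y(\gamma)=\int_0^T|\dot y(t)|\,dt$, where $z(T)=z_0$ and $|\cdot|$ is the norm with respect to $h$ at $\gamma(t)$ (and parameter $\varepsilon$). *)

(* Defs.v *)
From HB Require Import structures.
From mathcomp Require Import all_boot all_order all_algebra.
From mathcomp Require Import all_classical all_reals all_analysis.

Set Implicit Arguments.
Unset Strict Implicit.
Unset Printing Implicit Defensive.

Import Order.TTheory GRing.Theory Num.Theory.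
Import numFieldNormedType.Exports.

Local Open Scope classical_set_scope.
Local Open Scope ring_scope.

(* Meaningful for open [U]: iterated directional derivatives up to order [n]
   exist and are continuous on [U]. *)
Fixpoint Cn_on (R : realType) (V W : normedModType R) (n : nat) (U : set V)
    (f : V -> W) : Prop :=
  (forall x, U x -> {for x, continuous f}) /\
  match n with
  | 0 => True
  | m.+1 => forall v : V, (forall x, U x -> derivable f x v) /\
                          Cn_on m U ('D_v f)
  end.

Definition smooth_open (R : realType) (V W : normedModType R) (U : set V)
    (f : V -> W) : Prop := forall n, Cn_on n U f.

(* Smoothness on an arbitrary subset, in particular up to boundary and corners:
   [f] is locally the restriction of a smooth function on an open set. *)
Definition smooth_on (R : realType) (V W : normedModType R) (A : set V)
    (f : V -> W) : Prop :=
  forall x, A x -> exists (U : set V) (F : V -> W),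
    [/\ open U, U x, smooth_open U F & forall y, A y -> U y -> F y = f y].

Record chart (R : realType) (d : nat) (Y : topologicalType) := Chart {
  cdom : set Y;
  ccod : set 'rV[R]_d;
  coord : Y -> 'rV[R]_d;
  param : 'rV[R]_d -> Y;
  cdom_open : open cdom;
  ccod_open : open ccod;
  coordP : forall y, cdom y -> ccod (coord y) /\ param (coord y) = y;
  paramP : forall x, ccod x -> cdom (param x) /\ coord (param x) = x;
  coord_cont : forall y, cdom y -> {for y, continuous coord};
  param_cont : forall x, ccod x -> {for x, continuous param} }.

Definition transition (R : realType) (d : nat) (Y : topologicalType)
  (a a' : chart R d Y) : 'rV[R]_d -> 'rV[R]_d := fun x => coord a' (param a x).

(* Second countability follows from compactness. *)
Record closedManifold (R : realType) (d : nat) := ClosedManifold {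
  carrier :> topologicalType;
  chart_index : Type;
  atlas : chart_index -> chart R d carrier;
  chart_at : carrier -> chart_index;
  chart_atP : forall y, cdom (atlas (chart_at y)) y;
  transition_smooth : forall i j : chart_index,
    smooth_open [set x | ccod (atlas i) x /\ cdom (atlas j) (param (atlas i) x)]
                (transition (atlas i) (atlas j));
  carrier_hausdorff : hausdorff_space carrier;
  carrier_compact : compact [set: carrier] }.

(* Derivative of the change of coordinates from chart [i] to chart [j] at [y];
   tangent vectors are row vectors, [v] in chart [i] being [v *m jac i j y] in
   chart [j]. *)
Definition jac (R : realType) (d : nat) (Y : closedManifold R d)
    (i j : chart_index Y) (y : Y) : 'M[R]_d :=
  jacobian (transition (atlas i) (atlas j)) (coord (atlas i) y).

Definition bilin (R : realType) (n : nat) (G : 'M[R]_n) (u v : 'rV[R]_n) : R :=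
  (u *m G *m v^T) 0 0.

Definition gnorm (R : realType) (n : nat) (G : 'M[R]_n) (u : 'rV[R]_n) : R :=
  Num.sqrt (bilin G u u).

Definition posdef (R : realType) (n : nat) (G : 'M[R]_n) : Prop :=
  G^T = G /\ forall u : 'rV[R]_n, u != 0 -> 0 < bilin G u u.

(* Tensor fields are given by their components in each chart: [beta i y] and
   [h i y] only matter for [y] in the domain of chart [i]. *)
Definition is_one_form (R : realType) (d : nat) (Y : closedManifold R d)
    (beta : chart_index Y -> Y -> 'rV[R]_d) : Prop :=
  forall i j y, cdom (atlas i) y -> cdom (atlas j) y ->
    beta i y = beta j y *m (jac i j y)^T.

Definition is_metric (R : realType) (d : nat) (Y : closedManifold R d)
    (h : chart_index Y -> Y -> 'M[R]_d) : Prop :=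
  (forall i j y, cdom (atlas i) y -> cdom (atlas j) y ->
     h i y = jac i j y *m h j y *m (jac i j y)^T) /\
  (forall i y, cdom (atlas i) y -> posdef (h i y)).

(* A function, a one-form and a metric on [Y] depending on two real parameters:
   either (eps, z), or the polar coordinates (r, phi) of the blow-up. *)
Record coeffs (R : realType) (d : nat) (Y : closedManifold R d) := Coeffs {
  cS : R -> R -> Y -> R;
  cb : chart_index Y -> R -> R -> Y -> 'rV[R]_d;
  ch : chart_index Y -> R -> R -> Y -> 'M[R]_d }.

Definition coeffs_on (R : realType) (d : nat) (Y : closedManifold R d)
    (P : set (R * R)) (D : coeffs Y) : Prop :=
  forall p, P p ->
    is_one_form (fun i => cb D i p.1 p.2) /\
    is_metric (fun i => ch D i p.1 p.2).

Definition coeffs_smooth_on (R : realType) (d : nat) (Y : closedManifold R d)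
    (P : set (R * R)) (D : coeffs Y) : Prop :=
  forall i : chart_index Y,
    let A : set (R * R * 'rV[R]_d) := P `*` ccod (atlas i) in
    [/\ smooth_on A (fun q => cS D q.1.1 q.1.2 (param (atlas i) q.2)),
        smooth_on A (fun q => cb D i q.1.1 q.1.2 (param (atlas i) q.2)) &
        smooth_on A (fun q => ch D i q.1.1 q.1.2 (param (atlas i) q.2))].

Definition param_domain (R : realType) (e1 : R) (I : set R) : set (R * R) :=
  [set p | 0 < p.1 < e1 /\ I p.2].

Definition blowup_domain (R : realType) (e1 : R) (I : set R) : set (R * R) :=
  [set p | [/\ 0 <= p.1, - (pi / 2) <= p.2 <= pi / 2,
               p.1 * cos p.2 < e1 & I (p.1 * sin p.2)]].

(* The polar coordinates (r, phi) of the point with E = eps / z, z >= 0, and of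
   the point with E = - eps / z, z <= 0. *)
Definition polar_up (R : realType) (E z : R) : R * R :=
  (z * Num.sqrt (1 + E ^+ 2), pi / 2 - atan E).
Definition polar_down (R : realType) (E z : R) : R * R :=
  (- z * Num.sqrt (1 + E ^+ 2), atan E - pi / 2).

(* The (one-sided) derivative of [F] with respect to E vanishes at E = z = 0 in
   the coordinates (E, z) given by [polar]. *)
Definition dE_vanishes (R : realType) (polar : R -> R -> R * R)
    (F : R -> R -> R) : Prop :=
  let G E := F (polar E 0).1 (polar E 0).2 in
  (G E - G 0) / E @[E --> 0^'+] --> (0 : R).

Definition regular_coeffs (R : realType) (d : nat) (Y : closedManifold R d)
    (e1 : R) (I : set R) (D : coeffs Y) : Prop :=
  [/\ coeffs_on (param_domain e1 I) D,
      (exists B : coeffs Y,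
        [/\ coeffs_on (blowup_domain e1 I) B,
            coeffs_smooth_on (blowup_domain e1 I) B,
            (forall r phi y, blowup_domain e1 I (r, phi) ->
               0 < r * cos phi ->
               [/\ cS B r phi y = cS D (r * cos phi) (r * sin phi) y,
                   (forall i, cdom (atlas i) y ->
                      cb B i r phi y = cb D i (r * cos phi) (r * sin phi) y) &
                   (forall i, cdom (atlas i) y ->
                      ch B i r phi y = ch D i (r * cos phi) (r * sin phi) y)]),
            (forall y, dE_vanishes (@polar_up R) (fun r phi => cS B r phi y)) &
            (forall y,
               dE_vanishes (@polar_down R) (fun r phi => cS B r phi y))]) &
      (* bounded z-derivative of a tensor: in each chart, on compact sets *)
      (forall (i : chart_index Y) (K : set 'rV[R]_d),
         compact K -> K `<=` ccod (atlas i) ->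
         exists C : R, forall e z x, param_domain e1 I (e, z) -> K x ->
           `|derive1 (fun s : R => ch D i e s (param (atlas i) x)) z| <= C)].

Definition scaling_function (R : realType) (w : R -> R -> R) : Prop :=
  let wu (p : R * R) := w p.1 p.2 in
  let half : set (R * R) := [set p | 0 <= p.1] in
  [/\ {within half, continuous wu},
      smooth_on (half `\ (0, 0)) wu,
      (forall e z, 0 <= e -> (e, z) <> (0, 0) ->
         0 < w e z /\ Num.sg (derive1 (w e) z) = Num.sg z),
      (forall e, 0 <= e -> w e 0 = e) /\ (forall z, w 0 z = `|z|) &
      (forall l e z, 0 < l -> 0 <= e -> w (l * e) (l * z) = l * w e z)].

(* Matrix of (1 - w^kappa S) dz^2 + 2 w^(2k) dz.b + w^(2k) h at (z, y) in the
   coordinates (z, coord y), where dz.b is the symmetric product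
   (dz (x) b + b (x) dz) / 2. *)
Definition gmat (R : realType) (d : nat) (Y : closedManifold R d)
    (k kappa : nat) (w : R -> R -> R) (D : coeffs Y) (e : R)
    (i : chart_index Y) (z : R) (y : Y) : 'M[R]_(1 + d) :=
  let W := w e z ^+ (2 * k) in
  block_mx (1 - w e z ^+ kappa * cS D e z y)%:M (W *: cb D i e z y)
           (W *: (cb D i e z y)^T)              (W *: ch D i e z y).

Definition gcoord (R : realType) (d : nat) (Y : closedManifold R d)
    (k kappa : nat) (w : R -> R -> R) (D : coeffs Y) (e : R)
    (i : chart_index Y) (p : 'rV[R]_(1 + d)) : 'M[R]_(1 + d) :=
  gmat k kappa w D e i (lsubmx p 0 0) (param (atlas i) (rsubmx p)).

Definition christoffel (R : realType) (n : nat) (G : 'rV[R]_n -> 'M[R]_n)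
    (p : 'rV[R]_n) (i j l : 'I_n) : R :=
  let dG (c a b : 'I_n) : R := 'D_(delta_mx 0 c) (fun q => G q a b : R) p in
  2^-1 * \sum_(m < n) invmx (G p) i m * (dG j m l + dG l m j - dG m j l).

Definition curve_in (R : realType) (d : nat) (Y : closedManifold R d)
    (i : chart_index Y) (z : R -> R) (y : R -> Y) : R -> 'rV[R]_(1 + d) :=
  fun t => row_mx (z t)%:M (coord (atlas i) (y t)).

Definition velocity (R : realType) (d : nat) (Y : closedManifold R d)
    (i : chart_index Y) (z : R -> R) (y : R -> Y) (t : R) : 'rV[R]_(1 + d) :=
  derive1 (curve_in i z y) t.

(* Unit speed geodesic on [0, T]: the equations hold on a slightly larger open
   interval, to which every geodesic of the boundaryless manifold extends. *)
Definition unit_speed_geodesic (R : realType) (d : nat)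
    (Y : closedManifold R d) (k kappa : nat) (w : R -> R -> R) (D : coeffs Y)
    (I : set R) (e T : R) (z : R -> R) (y : R -> Y) : Prop :=
  exists2 del : R, 0 < del & forall t, - del < t < T + del ->
    [/\ I (z t), {for t, continuous y} &
        forall i : chart_index Y, cdom (atlas i) (y t) ->
          let c := curve_in i z y in
          let G := gcoord k kappa w D e i in
          [/\ derivable c t 1,
              derivable (derive1 c) t 1,
              (forall j : 'I_(1 + d),
                 derive1 (derive1 c) t 0 j +
                 \sum_(a < 1 + d) \sum_(b < 1 + d)
                   christoffel G (c t) j a b * derive1 c t 0 a * derive1 c t 0 b = 0) &
              gnorm (G (c t)) (derive1 c t) = 1]].

(* [phi] is the angle between [v] and the hyperplane of vectors with vanishing
   first component, i.e. between [v] and its orthogonal projection [u] to that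
   hyperplane (pi / 2 if [u = 0]). *)
Definition is_angle_with_waist (R : realType) (d : nat) (G : 'M[R]_(1 + d))
    (v : 'rV[R]_(1 + d)) (phi : R) : Prop :=
  0 <= phi <= pi / 2 /\
  exists u' : 'rV[R]_d, let u : 'rV[R]_(1 + d) := row_mx 0 u' in
    (forall x' : 'rV[R]_d, bilin G (v - u) (row_mx 0 x') = 0) /\
    gnorm G u = gnorm G v * cos phi.

Definition impact_angle (R : realType) (d : nat) (Y : closedManifold R d)
    (k kappa : nat) (w : R -> R -> R) (D : coeffs Y) (e : R)
    (z : R -> R) (y : R -> Y) (phi : R) : Prop :=
  let i := chart_at (y 0) in
  is_angle_with_waist (gmat k kappa w D e i (z 0) (y 0)) (velocity i z y 0) phi.

Definition angular_speed (R : realType) (d : nat) (Y : closedManifold R d)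
    (D : coeffs Y) (e : R) (z : R -> R) (y : R -> Y) (t : R) : R :=
  let i := chart_at (y t) in
  gnorm (ch D i e (z t) (y t)) (derive1 (fun s : R => coord (atlas i) (y s)) t).

Definition length_Y (R : realType) (d : nat) (Y : closedManifold R d)
    (D : coeffs Y) (e T : R) (z : R -> R) (y : R -> Y) : R :=
  \int[lebesgue_measure]_(t in `[0, T]) angular_speed D e z y t.

Definition Cconst (R : realType) (k : nat) (f : R -> R) (phi : R) : R :=
  \int[lebesgue_measure]_(Z in `[0, +oo[)
    (f Z ^+ k * Num.sqrt (f Z ^+ (2 * k) - cos phi ^+ 2))^-1.

Definition vanishes_to_order (R : realType) (m : nat) (g : R -> R) (x : R)
    : Prop :=
  (forall j, (j < m)%N -> derive1n j g x = 0) /\ derive1n m g x <> 0.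

(* Main.v *)
Require Import Defs.
From HB Require Import structures.
From mathcomp Require Import all_boot all_order all_algebra.
From mathcomp Require Import all_classical all_reals all_analysis.
From mathcomp Require Import perm measurable_realfun.
From mathcomp Require Import ring lra.
Import Order.TTheory GRing.Theory Num.Theory.
Import numFieldNormedType.Exports.
Local Open Scope classical_set_scope.
Local Open Scope ring_scope.

(** Write [w] for [w e z] and [z'] for the derivative of the height along a
    geodesic.  Completing the square in the directions of [Y] brings the metric
    to the form [A z'^2 + w^(2k) |u|^2], where [u = y' + z' b h^-1] is the
    projection of the velocity to the level sets of [z], the norm is that of
    [h], and [A = 1 - w^kappa S - w^(2k) |b|^2].  The momentum conjugate to the
    coordinates of [Y] is [w^(2k) h u]; its square [N = w^(4k) |u|^2] with
    respect to [h^-1] does not depend on the chart, and unit speed reads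
    [A z'^2 + N / w^(2k) = 1].

    On a surface of revolution [N] would be conserved, which is Clairaut's
    relation.  Here Hamilton's equation ([geodesic_momentum],
    [derive_momentum_square]) shows that only the derivatives of [S], [b], [h]
    along [Y] and that of [h] along [z] change [N], and that
    [|N'| <= K |z'| (N + w^k sqrt N)] ([angular_square_rate]).  The constant is
    uniform down to [e = 0] ([chart_bounds_uniform]): the derivative along [z] is
    bounded by hypothesis, and the other quantities by compactness, since the
    coefficients are smooth on the blow-up down to radius 0.  Gronwall's
    inequality in the variable [z] ([gronwall_sqrt]) turns this into
    [sqrt N = e^k cos phi + O (z w^k)], where [e^k cos phi] is the value at the
    waist ([impact_angular_square], [momentum_drift]).

    For small heights the drift is too small for [z'] to vanish
    ([speed_positive]), so the geodesic is a graph over [[0, z0]] and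
    [|y'| = sqrt N / w^(2k) + O (z')].  With [sqrt N] replaced by [e^k cos phi]
    and [z'] expressed by unit speed, [|y'|] becomes
    [e^-k cos phi F (z / e) z'], where [F] is the integrand of the constant
    [C_phi], up to an error [O ((e + z)^(1 - k) z')] ([length_integrand]).
    Integrating over [z], the main term gives [e^(1 - k) cos phi C_phi] except
    for a tail of relative size [e], and the error gives [O (e^(2 - k))] if
    [k > 2] and [O (|ln e|)] if [k = 2] ([crossing_length]).

    For the second part, [f^(2k) - cos^2 phi] behaves near [Z = 0] like
    [phi^2 + b Z^(2l)] with [b > 0].  Up to a factor close to 1 and a bounded
    error, [C_phi] is therefore the integral of [(phi^2 + b Z^(2l))^(-1/2)] over
    a short interval [[0, delta]] ([Cconst_model]).  The substitution [Z = s x]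
    with [s^l = phi] changes it to [s / phi] times the integral of
    [(1 + b x^(2l))^(-1/2)] over [[0, delta / s]].  For [l > 1] that integral
    converges as [s] tends to 0, and [s / phi = phi^(- (l - 1) / l)]; for
    [l = 1] it grows like [ln (1 / phi) / sqrt b]. *)

Set Implicit Arguments.
Unset Strict Implicit.
Unset Printing Implicit Defensive.

Local Notation gnorm := Defs.gnorm.
Local Notation coord := Defs.coord.
Local Notation mu := lebesgue_measure.

(** * Derivatives and smoothness *)

(** Differentiability is stated through a differential picked by choice; any
    continuous linear map with the right first-order expansion will do for it. *)
Lemma differentiable_expansion (R : realType) (V W : normedModType R)
    (f : V -> W) (df : {linear V -> W}) (x : V) :
  continuous df ->
  (forall eps : R, 0 < eps ->
     \forall h \near (0 : V), `|f (h + x) - f x - df h| <= eps * `|h|) ->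
  differentiable f x.
Proof.
move=> cdf fE.
apply/diffP => /=.
apply: (@getPex _ (fun (df : {linear V -> W}) => continuous df /\
  forall y, f y = f (lim (nbhs x)) + df (y - lim (nbhs x))
                  +o_(y \near x) (y - lim (nbhs x)))).
exists df; split => //.
have H : f = (fun y => f x + df (y - x)) +o_x (fun y => y - x).
  apply/eqaddoP => eps eps0.
  rewrite [\forall x \near _, _ <= _](near_shift 0)/=.
  apply: filterS (fE _ eps0) => h /=.
  by rewrite !fctE subr0 addrK opprD addrA.
by move=> y; rewrite lim_id// {1}H.
Qed.

(** The mean value theorem on a segment, arranged to compare the increment of [F]
    with a fixed slope [dl]. *)
Lemma mvt_line (R : realType) (V : normedModType R) (F : V -> R) (p e : V)
    (tau dl eta : R) (B : set V) :
  (forall s : R, 0 <= s <= 1 -> B (p + (s * tau) *: e)) ->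
  (forall x, B x -> derivable F x e) ->
  (forall x, B x -> `|'D_e F x - dl| <= eta) ->
  `|F (p + tau *: e) - F p - tau * dl| <= eta * `|tau|.
Proof.
move=> Bp dF FB.
have eta0 : 0 <= eta by apply: le_trans (FB _ (Bp 0 _)); rewrite ?lexx ?ler01.
pose g (s : R) := F (p + (s * tau) *: e).
have dg (s : R) : 0 <= s <= 1 ->
    is_derive s 1 g (tau * 'D_e F (p + (s * tau) *: e)).
  move=> s01.
  have H : is_derive (s * tau) 1 (fun a : R => F (p + a *: e))
      ('D_e F (p + (s * tau) *: e)).
    have := dF _ (Bp _ s01) => /derivableP [d1 d2].
    have E : (fun h : R => h^-1 *: (F (p + (h *: (1:R) + s * tau) *: e) - F (p + (s * tau) *: e)))
       = (fun h : R => h^-1 *: (F (h *: e + (p + (s * tau) *: e)) - F (p + (s * tau) *: e))).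
      apply/funext => h; congr (_ *: (F _ - _)).
      by rewrite [h *: 1]mulr1 scalerDl addrCA.
    apply: DeriveDef.
      rewrite /derivable; move: d1; rewrite /derivable.
      by rewrite E.
    by rewrite /derive E.
  have K : is_derive s (1:R) (fun s : R => s * tau) tau.
    have := @is_deriveM R _ (@id R) (cst tau) s 1 1 0 _ _.
    by rewrite /= scaler0 add0r [tau *: 1]mulr1; apply.
  have := @is_derive1_comp R (fun a : R => F (p + a *: e)) (fun s => s * tau) s _ _ H K.
  by rewrite mulrC.
have [] := @MVT_segment R g (fun s => tau * 'D_e F (p + (s * tau) *: e)) 0 1 ler01.
- by move=> s /[!in_itv]/= /andP[s0 s1]; apply: dg; rewrite !ltW.
- apply: derivable_within_continuous => s /[!in_itv]/= s01.
  by case: (dg s s01).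
move=> s /[!in_itv]/= s01; rewrite /g mul1r mul0r scale0r addr0 subr0 mulr1 => ->.
rewrite -mulrBr normrM mulrC ler_wpM2r//.
exact: FB (Bp _ s01).
Qed.

(** The increment is split into increments along one direction each.  The mean
    value theorem turns these into directional derivatives at nearby points, and
    their continuity at [q] makes the total error small compared with [h]. *)
Lemma increment_telescope (R : realType) (V : normedModType R) (F : V -> R)
    (U : set V) (q : V) (L : seq (V * (V -> R))) :
  open U -> U q ->
  (forall x, List.In x L ->
     [/\ forall y, U y -> derivable F y x.1, {for q, continuous ('D_(x.1) F)} &
         exists2 k : R, 0 < k & forall h, `|x.2 h| <= k * `|h|]) ->
  forall p : V -> V, p h @[h --> (0 : V)] --> q ->
  forall eps : R, 0 < eps -> \forall h \near (0 : V),
    `|F (p h + \sum_(x <- L) x.2 h *: x.1) - F (p h)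
      - \sum_(x <- L) x.2 h * 'D_(x.1) F q| <= eps * `|h|.
Proof.
move=> oU Uq; elim: L => [_ p _ eps eps0|[v a] L IH HL p pq eps eps0].
  near=> h; rewrite !big_nil addr0 !subrr normr0 mulr_ge0// ltW//.
have [dF cD [k k0 ak]] := HL (v, a) (or_introl erefl).
have a0 : a h @[h --> (0 : V)] --> (0 : R).
  apply/cvgrPdist_le => e e0; near=> h.
  rewrite sub0r normrN (le_trans (ak h))// -ler_pdivlMl//.
  near: h; apply: nbhs0_le.
  by rewrite mulr_gt0// invr_gt0.
have a0v : a h *: v @[h --> (0 : V)] --> (0 : V).
  suff : a h *: v @[h --> (0 : V)] --> (0 : R) *: v by rewrite scale0r.
  exact: cvgZr_tmp.
have pav : p h + a h *: v @[h --> (0 : V)] --> q.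
  suff : p h + a h *: v @[h --> (0 : V)] --> q + 0 by rewrite addr0.
  exact: cvgD.
have /IH := pav; move=> /(_ (fun x xL => HL x (or_intror xL)) (eps / 2)).
move=> /(_ (divr_gt0 eps0 (ltr0n _ 2))) IHe.
pose eta := eps / 2 / k.
have eta0 : 0 < eta by rewrite !divr_gt0.
have : \forall y \near q, U y /\ `|'D_v F y - 'D_v F q| <= eta.
  near=> y; split; first by near: y; exact: open_nbhs_nbhs.
  rewrite distrC; near: y; move/cvgrPdist_le: cD; exact.
move=> /nbhs_ballP[del /= del0 ball_q].
near=> h.
rewrite !big_cons/= addrA.
set A := \sum_(x <- L) x.2 h *: x.1; set B := \sum_(x <- L) _.
rewrite (_ : _ - _ - _ = (F (p h + a h *: v) - F (p h) - a h * 'D_v F q) +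
   (F (p h + a h *: v + A) - F (p h + a h *: v) - B)); last by ring.
rewrite (le_trans (ler_normD _ _))// [eps]splitr mulrDl lerD//; last first.
  by rewrite {}/A {}/B; near: h; exact: IHe.
have qp : `|q - p h| < del / 2.
  by near: h; move/cvgrPdist_lt : pq; apply; rewrite divr_gt0.
have av : `|a h *: v| < del / 2.
  by near: h; apply: (cvgr0_norm_lt _ a0v); rewrite divr_gt0.
have Bq (s : R) : 0 <= s <= 1 -> ball q del (p h + (s * a h) *: v).
  move=> /andP[s0 s1]; rewrite -ball_normE/= opprD addrA.
  rewrite (le_lt_trans (ler_normB _ _))//.
  rewrite [del]splitr ltrD//.
  rewrite normrZ normrM (ger0_norm s0) -mulrA.
  apply: (le_lt_trans _ av).
  by rewrite normrZ ler_piMl// mulr_ge0.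
apply: (le_trans (@mvt_line R V F (p h) v (a h) ('D_v F q) eta (ball q del) Bq _ _)).
- by move=> x /ball_q[Ux _]; exact: dF.
- by move=> x /ball_q[].
- apply: (@le_trans _ _ (eta * (k * `|h|))).
    by apply: ler_wpM2l; [exact: ltW|exact: ak].
  by rewrite /eta mulrA divfK ?gt_eqF.
Unshelve. all: by end_near. Qed.

(** [Cn_on] speaks of directional derivatives only.  If finitely many directions
    [x.1] with coordinates [x.2] span the space, continuity of the derivatives
    along them is enough for the existence of a differential. *)
Lemma C1_differentiable (R : realType) (V : normedModType R) (F : V -> R)
    (U : set V) (q : V) (L : seq (V * (V -> R))) :
  (forall h, \sum_(x <- L) x.2 h *: x.1 = h) ->
  (forall x, List.In x L -> linear x.2 /\ continuous x.2) ->
  open U -> U q -> Cn_on 1 U F -> differentiable F q.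
Proof.
move=> Lid Lc oU Uq [cF CF].
pose df h := \sum_(x <- L) x.2 h * 'D_(x.1) F q.
have df_lin : linear df.
  rewrite /df => c u v; elim: L {Lid df} Lc => [_|x L IH Lc].
    by rewrite !big_nil scaler0 addr0.
  rewrite !big_cons IH; last by move=> y yL; apply: Lc; right.
  have [/(_ c u v) -> _] := Lc x (or_introl erefl).
  by rewrite -![_ *: _]/(_ * _); ring.
pose dfM := GRing.isLinear.Build _ _ _ _ df df_lin.
pose dfL : {linear V -> R} := HB.pack df dfM.
apply: (@differentiable_expansion _ _ _ F dfL).
  rewrite -[dfL : V -> R]/df /df => h.
  elim: L {Lid df df_lin dfM dfL} Lc => [_|x L IH Lc].
    under eq_fun do rewrite big_nil; exact: cst_continuous.
  under eq_fun do rewrite big_cons; apply: cvgD.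
    by apply: cvgMr_tmp; apply: (Lc _ _).2; left.
  by apply: IH => y yL; apply: Lc; right.
move=> eps eps0.
have := @increment_telescope R V F U q L oU Uq _ (cst q) (cvg_cst _) eps eps0.
have HL : forall x, List.In x L ->
     [/\ forall y, U y -> derivable F y x.1, {for q, continuous ('D_(x.1) F)} &
         exists2 k : R, 0 < k & forall h, `|x.2 h| <= k * `|h|].
  move=> y yL; split.
  - exact: (CF y.1).1.
  - exact: (CF y.1).2.1.
  - have [ylin yc] := Lc _ yL.
    pose yM := GRing.isLinear.Build _ _ _ _ y.2 ylin.
    pose yl : {linear V -> R} := HB.pack y.2 yM.
    by have := @linear_lipschitz _ _ _ yl yc.
move=> /(_ HL (nbhs_filter _)); apply: filterS => h /=.
by rewrite Lid [h + q]addrC.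
Qed.

Lemma C1_differentiable_param (R : realType) (d : nat)
    (F : R * R * 'rV[R]_d -> R) (U : set (R * R * 'rV[R]_d)) q :
  open U -> U q -> Cn_on 1 U F -> differentiable F q.
Proof.
pose V : normedModType R := (R * R * 'rV[R]_d)%type.
pose L : seq (V * (V -> R)) :=
  ((1, 0, 0), fun h : V => h.1.1) :: ((0, 1, 0), fun h : V => h.1.2) ::
  map (fun j : 'I_d => ((0, 0, delta_mx 0 j) : V, fun h : V => h.2 0 j))
    (enum 'I_d).
apply: (@C1_differentiable _ _ _ _ _ L).
- move=> [[a b] v]; rewrite !big_cons big_map big_enum/=.
  have -> : \sum_(j < d) v 0 j *: ((0, 0, delta_mx 0 j) : V) = (0, 0, v).
    transitivity ((0, 0, \sum_(j < d) v 0 j *: delta_mx 0 j) : V).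
      elim/big_rec2: _ => //= i y1 y2 _ ->.
      by congr (_, _, _); rewrite /= ?[_ *: 0]mulr0 ?addr0.
    by rewrite -row_sum_delta.
  congr (_, _, _); rewrite /= ?scaler0 ?add0r//.
    by rewrite ?[_ *: 0]mulr0 ?addr0 ?[_ *: 1]mulr1.
  by rewrite ?[_ *: 0]mulr0 ?addr0 ?add0r ?[_ *: 1]mulr1.
- move=> x /= [<-|[<-|/List.in_map_iff[j [<- _]]]]/=; split => //=.
  + by move=> h; apply: (@continuous_comp _ _ _ fst fst); [exact: cvg_fst|exact: cvg_fst].
  + by move=> h; apply: (@continuous_comp _ _ _ fst snd); [exact: cvg_fst|exact: cvg_snd].
  + by move=> c u v /=; rewrite !mxE.
  + by move=> h; apply: (@continuous_comp _ _ _ snd (fun x : 'rV[R]_d => x 0 j)); [exact: cvg_snd|exact: coord_continuous].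
Qed.

Lemma Cn_on1_entry (R : realType) (V : normedModType R) m n
    (F : V -> 'M[R]_(m, n)) (U : set V) i j :
  open U -> Cn_on 1 U F -> Cn_on 1 U (fun x => F x i j).
Proof.
move=> oU [cF CF]; split.
  move=> x Ux; apply: (@continuous_comp _ _ _ F (fun M : 'M[R]_(m, n) => M i j)).
    exact: cF.
  exact: coord_continuous.
move=> v; have [dF [cDF _]] := CF v; split.
  by move=> x Ux; have /derivable_mxP := dF x Ux; exact.
split=> // x Ux.
have DE y : U y -> 'D_v (fun x => F x i j) y = 'D_v F y i j.
  by move=> /dF dFy; rewrite derive_mx// mxE.
rewrite /prop_for /continuous_at DE//.
have : 'D_v F y i j @[y --> x] --> 'D_v F x i j.
  apply: (@continuous_comp _ _ _ ('D_v F) (fun M : 'M[R]_(m, n) => M i j)).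
    exact: cDF.
  exact: coord_continuous.
apply: cvg_trans; apply: near_eq_cvg.
near=> y; rewrite DE//; near: y; exact: open_nbhs_nbhs.
Unshelve. all: by end_near. Qed.

Lemma is_derive_mxP (R : realType) (V : normedModType R) m n
    (M : V -> 'M[R]_(m, n)) t v (dM : 'M[R]_(m, n)) :
  is_derive t v M dM <->
  forall i j, is_derive t v (fun x => M x i j) (dM i j).
Proof.
split=> [[dMt <-] i j|H].
  by apply: DeriveDef; [move/derivable_mxP: dMt; exact|rewrite derive_mx// mxE].
have dMt : derivable M t v by apply/derivable_mxP => i j; case: (H i j).
apply: DeriveDef => //; rewrite derive_mx//; apply/matrixP => i j.
by rewrite mxE; case: (H i j).
Qed.

Lemma is_derive_sum_fin (R : realType) (V W : normedModType R) (I : Type)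
    (s : seq I) (F : I -> V -> W) (dF : I -> W) t v :
  (forall i, is_derive t v (F i) (dF i)) ->
  is_derive t v (fun x => \sum_(i <- s) F i x) (\sum_(i <- s) dF i).
Proof.
move=> H; elim: s => [|i s IH].
  rewrite big_nil (_ : (fun _ => _) = cst 0); first exact: is_derive_cst.
  by apply/funext => x; rewrite big_nil.
rewrite big_cons (_ : (fun _ => _) = F i + (fun x => \sum_(i <- s) F i x)).
  exact: is_deriveD.
by apply/funext => x; rewrite big_cons.
Qed.

Lemma is_derive_mulmx (R : realType) m n p
    (A : R -> 'M[R]_(m, n)) (B : R -> 'M[R]_(n, p)) (t : R) dA dB :
  is_derive t 1 A dA -> is_derive t 1 B dB ->
  is_derive t 1 (fun x => A x *m B x) (dA *m B t + A t *m dB).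
Proof.
move=> /is_derive_mxP hA /is_derive_mxP hB; apply/is_derive_mxP => i j.
rewrite (_ : (fun _ => _) = fun x => \sum_k (A x i k * B x k j)); last first.
  by apply/funext => x; rewrite mxE.
rewrite !mxE -big_split/=; apply: is_derive_sum_fin => k.
apply: (@is_derive_eq _ _ _ ((fun x => A x i k) * (fun x => B x k j)) _ _ _ _
  (is_deriveM (hA i k) (hB k j))).
by rewrite -![_ *: _]/(_ * _); ring.
Qed.

Lemma is_derive_trmx (R : realType) (V : normedModType R) m n
    (A : V -> 'M[R]_(m, n)) t v dA :
  is_derive t v A dA -> is_derive t v (fun x => (A x)^T) dA^T.
Proof.
move=> /is_derive_mxP hA; apply/is_derive_mxP => i j.
rewrite (_ : (fun _ => _) = fun x => A x j i); first by rewrite mxE.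
by apply/funext => x; rewrite mxE.
Qed.

Lemma derivable_prod_fin (R : realType) (I : Type) (s : seq I)
    (F : I -> R -> R) (t : R) :
  (forall i, derivable (F i) t 1) ->
  derivable (fun x => \prod_(i <- s) F i x) t 1.
Proof.
move=> H; elim: s => [|i s IH].
  rewrite (_ : (fun _ => _) = cst 1); first exact: derivable_cst.
  by apply/funext => x; rewrite big_nil.
rewrite (_ : (fun _ => _) = F i * (fun x => \prod_(i <- s) F i x)).
  exact: derivableM.
by apply/funext => x; rewrite big_cons.
Qed.

Lemma derivable_det (R : realType) n (A : R -> 'M[R]_n) (t : R) :
  derivable A t 1 -> derivable (fun x => \det (A x)) t 1.
Proof.
move=> /derivable_mxP hA.
have := @is_derive_sum_fin R R R _ (index_enum _)
  (fun (s : {perm 'I_n}) x => (-1) ^+ s * \prod_i A x i (s i))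
  (fun s => 'D_1 (fun x => (-1) ^+ s * \prod_i A x i (s i)) t) t 1.
case=> // s; apply: derivableP; apply: derivableM; first exact: derivable_cst.
exact: derivable_prod_fin.
Qed.

(** Cramer's rule reduces the inverse to determinants, which are polynomials in
    the entries. *)
Lemma derivable_invmx (R : realType) n (A : R -> 'M[R]_n) (t : R) :
  A t \in unitmx -> derivable A t 1 -> derivable (fun x => invmx (A x)) t 1.
Proof.
move=> uA dA.
have dd := derivable_det dA.
have d0 : \det (A t) != 0 by rewrite -unitfE -unitmxE.
apply: (@near_eq_derivable _ _ _ (fun x => (\det (A x))^-1 *: \adj (A x))).
  have : \forall x \near t, \det (A x) != 0.
    have /derivable1_diffP/differentiable_continuous := dd.
    by move=> /cvgr_neq0; apply.
  apply: filterS => x dx.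
  by rewrite /invmx unitmxE unitfE dx.
apply/derivable_mxP => i j.
rewrite (_ : (fun _ => _) = (fun x => (\det (A x))^-1) *
   (fun x => (-1) ^+ (j + i) * \det (row' j (col' i (A x))))); last first.
  by apply/funext => x; rewrite !mxE.
apply: derivableM; first exact: derivableV.
apply: derivableM; first exact: derivable_cst.
apply: derivable_det; apply/derivable_mxP => a b.
move/derivable_mxP : dA => dA.
rewrite (_ : (fun _ => _) = (fun x => A x (lift j a) (lift i b)))//.
by apply/funext => x; rewrite !mxE.
Qed.

(** The value of the derivative comes from differentiating [A^-1 A = 1]. *)
Lemma is_derive_invmx (R : realType) n (A : R -> 'M[R]_n) (t : R) dA :
  A t \in unitmx -> is_derive t 1 A dA ->
  is_derive t 1 (fun x => invmx (A x)) (- (invmx (A t) *m dA *m invmx (A t))).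
Proof.
move=> uA hA; have [dAt _] := hA.
have hI := derivableP (derivable_invmx uA dAt).
apply: (is_derive_eq hI).
set J := 'D_1 _ t in hI *.
have H := is_derive_mulmx hI hA.
have H1 : is_derive t 1 (fun x => invmx (A x) *m A x) (0 : 'M[R]_n).
  apply: (@near_eq_is_derive _ _ _ (cst (1%:M : 'M[R]_n))).
  have : \forall x \near t, \det (A x) != 0.
    have /derivable1_diffP/differentiable_continuous := derivable_det dAt.
    by move=> /cvgr_neq0; apply; rewrite -unitfE -unitmxE.
  by apply: filterS => x dx; rewrite mulVmx// unitmxE unitfE.
have : J *m A t + invmx (A t) *m dA = 0.
  by case: H => _ <-; case: H1.
move=> /eqP; rewrite addr_eq0 => /eqP E.
by rewrite -[J](mulmxK uA) E mulNmx.
Qed.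

(** * From local to uniform bounds *)

(** Finitely many of the neighbourhoods cover [Q], and the largest of their
    constants serves everywhere because [P] is monotone in the constant. *)
Lemma compact_uniform_bound (R : realType) (T : topologicalType) (Q : set T)
    (P : R -> T -> Prop) :
  compact Q -> (forall C C' q, C <= C' -> P C q -> P C' q) ->
  (forall q, Q q -> exists C, \forall q' \near q, Q q' -> P C q') ->
  exists2 C, 0 < C & forall q, Q q -> P C q.
Proof.
move=> /compact_near_coveringP/near_covering_withinP cQ mono loc.
have := cQ R (+oo : set_system R) P _.
move=> /(_ _) [] => [q Qq|M [Mr MP]].
  have [C HC] := loc q Qq.
  exists ([set q' | Q q' -> P C q'], [set x | C <= x]) => /=.
    by split => //; apply: nbhs_pinfty_ge; exact: num_real.
  by move=> [q' x]/= [PC Cx] Qq'; apply: mono Cx _; exact: PC.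
exists (Num.max 1 (M + 1)); first by rewrite lt_max ltr01.
by apply: MP; rewrite lt_max ltrDl ltr01 orbT.
Qed.

Lemma near_norm_le (R : realType) (T : topologicalType) (W : normedModType R)
    (f : T -> W) (x : T) : {for x, continuous f} ->
  \forall y \near x, `|f y| <= `|f x| + 1.
Proof.
move=> /cvgrPdist_le/(_ _ ltr01); apply: filterS => y fxy.
rewrite -[f y](subKr (f x)) (le_trans (ler_normB _ _))//.
by rewrite lerD2l.
Qed.

(** Near [q0] the function extends smoothly across the boundary of [P].  Only
    directions tangent to the open set [O] are differentiated, so the derivatives
    of the extension and of the function agree. *)
Lemma smooth_on_local_bound (R : realType) (d : nat) (W : normedModType R)
    (P : set (R * R)) (O : set 'rV[R]_d) (f : R * R * 'rV[R]_d -> W) q0 :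
  open O -> smooth_on (P `*` O) f -> (P `*` O) q0 ->
  exists C : R, \forall q \near q0, (P `*` O) q ->
    `|f q| <= C /\
    forall j, derivable (fun x => f (q.1, x)) q.2 (delta_mx 0 j) /\
              `|'D_(delta_mx 0 j) (fun x => f (q.1, x)) q.2| <= C.
Proof.
move=> oO sf Aq0; have [U [F [oU Uq0 sF Ff]]] := sf q0 Aq0.
pose e j : R * R * 'rV[R]_d := (0, delta_mx 0 j).
pose C := \sum_(j < d) (`|'D_(e j) F q0| + 1) + (`|F q0| + 1).
have C1 : `|F q0| + 1 <= C by rewrite lerDr sumr_ge0.
have C2 j : `|'D_(e j) F q0| + 1 <= C.
  rewrite /C (bigD1 j)//= -addrA lerDl addr_ge0 ?sumr_ge0//.
exists C; near=> q => Aq.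
have Uq : U q by near: q; exact: open_nbhs_nbhs.
split.
  rewrite -Ff//; apply: le_trans C1; near: q; apply: (@near_norm_le R (R * R * 'rV[R]_d)%type W F q0).
  exact: (sF 0%N).1.
move=> j; have [dF _] := (sF 1%N).2 (e j).
have E : (fun h : R => h^-1 *: (F (q.1, h *: delta_mx 0 j + q.2) - F (q.1, q.2))) =
         (fun h => h^-1 *: (F (h *: e j + q) - F q)).
  apply/funext => h; rewrite -surjective_pairing; congr (_ *: (F _ - _)).
  rewrite /e; case: (q) => [[a b] x] /=.
  by congr (_, _, _); rewrite /= ?[_ *: 0]mulr0 ?add0r.
have near_eq : \forall x \near q.2, F (q.1, x) = f (q.1, x).
  have UO : \forall x \near q.2, U (q.1, x).
    have : (q.1, x) @[x --> q.2] --> q.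
      have := @cvg_pair _ _ _ (nbhs q.2) (nbhs q.1) (nbhs q.2) _ _ _ (fun=> q.1) id (cvg_cst _) cvg_id.
      by move=> H B; rewrite {1}(surjective_pairing q); exact: H.
    by apply; apply: open_nbhs_nbhs.
  have OO : \forall x \near q.2, O x by apply: open_nbhs_nbhs; split => //; case: Aq.
  near=> x; apply: Ff; last by near: x.
  by split => /=; [case: Aq|near: x].
have D1 : derivable (fun x => F (q.1, x)) q.2 (delta_mx 0 j).
  rewrite /derivable E; exact: dF.
split; first exact: near_eq_derivable D1.
rewrite -(near_eq_derive _ near_eq) /derive E.
apply: le_trans (C2 j); move: j {dF E D1}; near: q; apply: filter_forall => j.
by apply: (@near_norm_le R (R * R * 'rV[R]_d)%type W _ q0); exact: ((sF 1%N).2 (e j)).2.1.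
Unshelve. all: by end_near. Qed.

(** * Positive definite forms *)

Lemma cvg_bigsum (R : realType) (T I : Type) (F : set_system T) {FF : Filter F}
    (s : seq I) (f : I -> T -> R) (l : I -> R) :
  (forall i, f i x @[x --> F] --> l i) ->
  \sum_(i <- s) f i x @[x --> F] --> \sum_(i <- s) l i.
Proof.
move=> fl; elim: s => [|i s IH].
  by rewrite big_nil; under eq_fun do rewrite big_nil; exact: cvg_cst.
by rewrite big_cons; under eq_fun do rewrite big_cons; exact: cvgD.
Qed.

Section Bilin.
Context {R : realType} {n : nat}.
Implicit Types (G : 'M[R]_n) (u v x : 'rV[R]_n) (a : R).

Lemma bilinE G u v : bilin G u v = \sum_i \sum_j u 0 i * G i j * v 0 j.
Proof.
rewrite /bilin mxE exchange_big/=; apply: eq_bigr => j _.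
by rewrite !mxE mulr_suml.
Qed.

Lemma bilinDl G u v x : bilin G (u + v) x = bilin G u x + bilin G v x.
Proof. by rewrite /bilin !mulmxDl mxE. Qed.

Lemma bilinDr G u v x : bilin G x (u + v) = bilin G x u + bilin G x v.
Proof. by rewrite /bilin raddfD/= mulmxDr mxE. Qed.

Lemma bilinZl G a u x : bilin G (a *: u) x = a * bilin G u x.
Proof. by rewrite /bilin -!scalemxAl mxE. Qed.

Lemma bilinZr G a u x : bilin G x (a *: u) = a * bilin G x u.
Proof. by rewrite /bilin linearZ/= -!scalemxAr mxE. Qed.

Lemma bilinNl G u x : bilin G (- u) x = - bilin G u x.
Proof. by rewrite -scaleN1r bilinZl mulN1r. Qed.

Lemma bilinNr G u x : bilin G x (- u) = - bilin G x u.
Proof. by rewrite -scaleN1r bilinZr mulN1r. Qed.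

Lemma bilinC G u v : G^T = G -> bilin G u v = bilin G v u.
Proof.
move=> Gs; rewrite /bilin.
have -> : u *m G *m v^T = (v *m G *m u^T)^T by rewrite !trmx_mul trmxK Gs mulmxA.
by rewrite mxE.
Qed.

Lemma norm_entry m p (M : 'M[R]_(m, p)) i j : `|M i j| <= `|M|.
Proof.
rewrite [leRHS]/Num.Def.normr/= mx_normrE.
exact: (le_bigmax _ (fun ij : 'I_m * 'I_p => `|M ij.1 ij.2|) (i, j)).
Qed.

Lemma bilin_bound G u v :
  `|bilin G u v| <= (n ^ 2)%:R * `|G| * `|u| * `|v|.
Proof.
rewrite bilinE (le_trans (ler_norm_sum _ _ _))//.
rewrite (@le_trans _ _ (\sum_(i < n) \sum_(j < n) `|G| * `|u| * `|v|))//.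
  apply: ler_sum => i _; rewrite (le_trans (ler_norm_sum _ _ _))//.
  apply: ler_sum => j _; rewrite !normrM ler_pM ?norm_entry ?mulr_ge0//.
  by rewrite mulrC ler_pM ?norm_entry.
by rewrite !sumr_const card_ord -!mulrnA -mulnn -!mulrA mulr_natl lexx.
Qed.

Lemma posdef_ge0 G u : posdef G -> 0 <= bilin G u u.
Proof.
move=> [_ Gp]; have [->|/Gp/ltW//] := eqVneq u 0.
by rewrite /bilin !mul0mx mxE.
Qed.

Lemma posdef_unit G : posdef G -> G \in unitmx.
Proof.
move=> [_ Gp]; rewrite unitmxE unitfE; apply/det0P => -[v v0 vG].
by have := Gp v v0; rewrite /bilin vG mul0mx mxE ltxx.
Qed.

(** Positivity at the component of [u] orthogonal to [v]. *)
Lemma posdef_cauchy G u v : posdef G ->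
  bilin G u v ^+ 2 <= bilin G u u * bilin G v v.
Proof.
move=> Gp; have [Gs Gpos] := Gp.
have [->|v0] := eqVneq v 0.
  by rewrite /bilin trmx0 !mulmx0 mxE expr0n mulr0.
have vv := Gpos v v0.
have := posdef_ge0 (u - (bilin G u v / bilin G v v) *: v) Gp.
rewrite bilinDl !bilinDr !bilinNl !bilinNr !bilinZl !bilinZr (bilinC v u Gs).
set a := bilin G u u; set b := bilin G u v; set c := bilin G v v.
have c0 : c != 0 by rewrite gt_eqF.
rewrite (_ : _ + _ = a - b ^+ 2 / c); last by field.
by rewrite subr_ge0 ler_pdivrMr.
Qed.

Lemma gnorm_ge0 G u : 0 <= gnorm G u.
Proof. exact: sqrtr_ge0. Qed.

Lemma sqr_gnorm G u : posdef G -> gnorm G u ^+ 2 = bilin G u u.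
Proof. by move=> Gp; rewrite sqr_sqrtr// posdef_ge0. Qed.

Lemma gnorm_triangle G u v : posdef G -> gnorm G (u + v) <= gnorm G u + gnorm G v.
Proof.
move=> Gp; rewrite -(@ler_pXn2r _ 2)// ?nnegrE ?addr_ge0 ?gnorm_ge0//.
rewrite sqrrD !sqr_gnorm// bilinDl !bilinDr (bilinC v u Gp.1).
have : bilin G u v <= gnorm G u * gnorm G v.
  rewrite (le_trans (ler_norm _))// -(@ler_pXn2r _ 2)// ?nnegrE ?mulr_ge0 ?gnorm_ge0//.
  by rewrite real_normK ?num_real// exprMn !sqr_gnorm// posdef_cauchy.
lra.
Qed.

Lemma gnormZ G a u : gnorm G (a *: u) = `|a| * gnorm G u.
Proof.
by rewrite /Defs.gnorm bilinZl bilinZr mulrA -expr2 sqrtrM ?sqr_ge0// sqrtr_sqr.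
Qed.

Lemma gnormB_dist G u v : posdef G ->
  `|gnorm G (u - v) - gnorm G u| <= gnorm G v.
Proof.
move=> Gp; have H1 := gnorm_triangle u (- v) Gp.
have H2 := gnorm_triangle (u - v) v Gp; rewrite subrK in H2.
have E : gnorm G (- v) = gnorm G v by rewrite -scaleN1r gnormZ normrN1 mul1r.
rewrite E in H1; rewrite ler_norml; lra.
Qed.

(** The constant is the minimum of the form on the unit sphere. *)
Lemma posdef_coercive G : posdef G ->
  exists2 lam : R, 0 < lam & forall u, lam * `|u| ^+ 2 <= bilin G u u.
Proof.
move=> Gp; have [Gs Gpos] := Gp.
pose S : set 'rV[R]_n := [set u | `|u| = 1].
have [S0|/nonemptyPn S0] := pselect (S !=set0); last first.
  exists 1 => // u; have [->|u0] := eqVneq u 0.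
    by rewrite normr0 expr0n mulr0 posdef_ge0.
  have : S (`|u|^-1 *: u) by rewrite /S/= normrZ normfV normr_id mulVf// normr_eq0.
  by rewrite S0.
have cS : compact S.
  apply: bounded_closed_compact.
    by exists 1; split => // M M1 u /= ->; exact: ltW.
  rewrite (_ : S = (fun u : 'rV[R]_n => `|u|) @^-1` [set 1])//.
  apply: preimage_closed => [u _|]; last exact: closed_eq.
  exact: norm_continuous.
have cG : continuous (fun u => bilin G u u).
  under eq_fun do rewrite bilinE.
  move=> u; apply: (@cvg_bigsum R _ _ (nbhs u) _) => i; apply: (@cvg_bigsum R _ _ (nbhs u) _) => j.
  apply: (@cvgM _ _ (nbhs u) _); last exact: coord_continuous.
  by apply: (@cvgMr_tmp _ _ (nbhs u) _); exact: coord_continuous.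
have [c cS' cmin] := compact_EVT_min S0 cS (continuous_subspaceT cG).
move: cS'; rewrite inE /S/= => c1.
exists (bilin G c c).
  by apply: Gpos; apply/eqP => c0; move: c1; rewrite c0 normr0 => /eqP; rewrite eq_sym oner_eq0.
move=> u; have [->|u0] := eqVneq u 0.
  by rewrite normr0 expr0n mulr0 posdef_ge0.
have nu : 0 < `|u| by rewrite normr_gt0.
have := cmin (`|u|^-1 *: u); rewrite inE /S/= normrZ normfV normr_id mulVf ?gt_eqF//.
move=> /(_ erefl); rewrite bilinZl bilinZr mulrA -invfM mulrC.
by rewrite ler_pdivlMr ?mulr_gt0// expr2.
Qed.

End Bilin.

(** * The geodesic equation in momentum form *)

Lemma derive_row (R : realType) n (g : 'rV[R]_n -> R) (p v : 'rV[R]_n) :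
  differentiable g p ->
  'D_v g p = \sum_a 'D_(delta_mx 0 a) g p * v 0 a.
Proof.
move=> dg; rewrite deriveE// {1}(row_sum_delta v) linear_sum.
by apply: eq_bigr => a _; rewrite linearZ deriveE// mulrC.
Qed.

Lemma is_derive_along (R : realType) n (g : 'rV[R]_n -> R) (c : R -> 'rV[R]_n)
    (t : R) :
  derivable c t 1 -> differentiable g (c t) ->
  is_derive t 1 (fun s => g (c s))
    (\sum_a 'D_(delta_mx 0 a) g (c t) * derive1 c t 0 a).
Proof.
move=> dc dg; have dc' : differentiable c t by apply/derivable1_diffP.
have dgc : differentiable (g \o c) t by exact: differentiable_comp.
apply: DeriveDef; first by apply/derivable1_diffP.
rewrite -derive_row// deriveE// (_ : (fun s => _) = g \o c)//.
by rewrite deriveE// diff_comp//= derive1E deriveE.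
Qed.

(** Contracting the geodesic equation with [G] cancels the inverse matrix in the
    Christoffel symbols.  Two of the three derivatives of [G] are absorbed by the
    derivative of [G] along the curve, and Hamilton's equation for the momentum
    remains. *)
Lemma geodesic_momentum (R : realType) n (G : 'rV[R]_n -> 'M[R]_n)
    (c : R -> 'rV[R]_n) (t : R) (m : 'I_n) :
  derivable c t 1 -> derivable (derive1 c) t 1 ->
  (forall j : 'I_n, derive1 (derive1 c) t 0 j +
     \sum_(a < n) \sum_(b < n)
        christoffel G (c t) j a b * derive1 c t 0 a * derive1 c t 0 b = 0) ->
  G (c t) \in unitmx ->
  (forall b, differentiable (fun q => G q m b) (c t)) ->
  is_derive t 1 (fun s => \sum_b G (c s) m b * derive1 c s 0 b)
    (2^-1 * \sum_a \sum_b 'D_(delta_mx 0 m) (fun q => G q a b) (c t)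
              * derive1 c t 0 a * derive1 c t 0 b).
Proof.
move=> dc dc' geo uG dG.
set v := derive1 c t.
pose dG' (x a b : 'I_n) : R := 'D_(delta_mx 0 x) (fun q => G q a b : R) (c t).
have H : is_derive t 1 (fun s => \sum_b G (c s) m b * derive1 c s 0 b)
   (\sum_b ((\sum_a dG' a m b * v 0 a) * v 0 b +
            G (c t) m b * derive1 (derive1 c) t 0 b)).
  apply: is_derive_sum_fin => b.
  have h1 := is_derive_along dc (dG b).
  have h2 : is_derive t 1 (fun s => derive1 c s 0 b) (derive1 (derive1 c) t 0 b).
    by have /is_derive_mxP := derivableP dc'; rewrite -derive1E; exact.
  apply: (@is_derive_eq _ _ _ ((fun s => G (c s) m b) * (fun s => derive1 c s 0 b))
    _ _ _ _ (is_deriveM h1 h2)).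
  by rewrite -![_ *: _]/(_ * _) addrC; congr (_ + _); rewrite mulrC.
apply: is_derive_eq H _.
rewrite big_split/=.
have -> : \sum_b G (c t) m b * derive1 (derive1 c) t 0 b =
  - \sum_i \sum_j 2^-1 * (dG' i m j + dG' j m i - dG' m i j) * v 0 i * v 0 j.
  transitivity (- \sum_b \sum_i \sum_j
      (G (c t) m b * christoffel G (c t) b i j) * v 0 i * v 0 j).
    rewrite -sumrN; apply: eq_bigr => b _.
    have /eqP := geo b; rewrite addr_eq0 => /eqP ->.
    rewrite mulrN mulr_sumr; congr (- _); apply: eq_bigr => i _.
    rewrite mulr_sumr; apply: eq_bigr => j _.
    by rewrite !mulrA.
  congr (- _).
  rewrite exchange_big/=; apply: eq_bigr => i _.
  rewrite exchange_big/=; apply: eq_bigr => j _.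
  rewrite -!mulr_suml; congr (_ * _ * _).
  rewrite /christoffel.
  under eq_bigr do rewrite mulrCA mulr_sumr.
  rewrite -mulr_sumr exchange_big/=; congr (_ * _).
  under eq_bigr => k _ do (under eq_bigr do rewrite mulrA; rewrite -mulr_suml).
  rewrite (bigD1 m)//= [X in _ + X]big1 ?addr0; last first.
    move=> k km.
    have /matrixP/(_ m k) := mulmxV uG; rewrite !mxE eq_sym (negbTE km) => ->.
    by rewrite mul0r.
  have /matrixP/(_ m m) := mulmxV uG; rewrite !mxE eqxx => ->.
  by rewrite mul1r.
pose A := \sum_i \sum_j dG' i m j * v 0 i * v 0 j.
pose B := \sum_i \sum_j dG' m i j * v 0 i * v 0 j.
have E1 : \sum_i (\sum_a dG' a m i * v 0 a) * v 0 i = A.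
  rewrite /A exchange_big/=; apply: eq_bigr => i _.
  by rewrite mulr_suml.
have E2 : \sum_i \sum_j dG' j m i * v 0 i * v 0 j = A.
  by rewrite /A exchange_big/=; apply: eq_bigr => i _; apply: eq_bigr => j _; ring.
have E3 : \sum_i \sum_j 2^-1 * (dG' i m j + dG' j m i - dG' m i j) * v 0 i * v 0 j
   = 2^-1 * (A + A - B).
  rewrite -{2}E2 /A /B -big_split -sumrB/= mulr_sumr; apply: eq_bigr => i _.
  rewrite -big_split -sumrB/= mulr_sumr; apply: eq_bigr => j _ /=.
  by ring.
rewrite E1 E3 -/B.
by field.
Qed.

Section algebraic_bound.
Context {R : realType} {d : nat}.

(** The expression is the derivative of the squared momentum found in
    [derive_momentum_square].  After the substitution of [u - zt be] for [y'] the
    terms without the factor [zt] cancel, so the whole rate is proportional to the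
    vertical speed; the rest is estimated through [W |u| <= M s]. *)
Lemma momentum_rate_bound (W wk wkap zt s M : R) (u be y' : 'rV[R]_d)
   (S : 'I_d -> R) (b : 'I_d -> 'rV[R]_d) (h : 'I_d -> 'M[R]_d) (Hz : 'M[R]_d) :
  1 <= M -> 0 <= W <= wk -> 0 <= wkap <= wk -> `|zt| <= 2 ->
  0 <= s -> W * `|u| <= M * s -> `|be| <= M -> y' = u - zt *: be ->
  (forall j, `|S j| <= M) -> (forall j (v : 'rV[R]_d), `|(b j *m v^T) 0 0| <= M * `|v|) ->
  (forall j v v', `|bilin (h j) v v'| <= M * `|v| * `|v'|) ->
  (forall v, `|bilin Hz v v| <= M * `|v| * `|v|) ->
  `|2 * W * (\sum_j (2^-1 * (- wkap * S j * zt ^+ 2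
        + 2 * W * zt * (b j *m y'^T) 0 0 + W * bilin (h j) y' y')) * u 0 j)
    - W ^+ 2 * (zt * bilin Hz u u + \sum_j y' 0 j * bilin (h j) u u)|
  <= ((8 * d)%:R + 1) * M ^+ 4 * (`|zt| * (s ^+ 2 + wk * s)).
Proof.
move=> M1 /andP[W0 Wwk] /andP[wkap0 wkapwk] zt2 s0 Wu beM y'E SM bM hM HzM.
set n' := `|u|; have n0 : 0 <= n' by exact: normr_ge0.
have wk0 : 0 <= wk by exact: le_trans Wwk.
have M0 : 0 <= M by exact: le_trans M1.
have az0 : 0 <= `|zt| by exact: normr_ge0.
have uj j : `|u 0 j| <= n' by exact: norm_entry.
have bej j : `|be 0 j| <= M by apply: le_trans (norm_entry _ _ _) beM.
(* The terms cubic in u, W^2 u_j bilin (h j) u u, occur with both signs. *)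
pose q j := u 0 j * (- (W * wkap * zt ^+ 2 * S j) + 2 * W ^+ 2 * zt * (b j *m y'^T) 0 0
   - W ^+ 2 * zt * (bilin (h j) be u + bilin (h j) u be)
   + W ^+ 2 * zt ^+ 2 * bilin (h j) be be) + W ^+ 2 * zt * be 0 j * bilin (h j) u u.
rewrite (_ : _ - _ = \sum_j q j - W ^+ 2 * zt * bilin Hz u u); last first.
  rewrite mulrDr opprD addrA [in LHS]addrAC -[in RHS]mulrA; congr (_ - _).
  rewrite !mulr_sumr -sumrB; apply: eq_bigr => j _.
  rewrite /q {2 3 4}y'E !mxE bilinDl !bilinDr !bilinNl !bilinNr !bilinZl !bilinZr.
  by field.
have W2 : 0 <= W ^+ 2 by exact: sqr_ge0.
have z2 : 0 <= zt ^+ 2 by exact: sqr_ge0.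
have az2 : zt ^+ 2 <= 2 * `|zt|.
  by rewrite -real_normK ?num_real// expr2 ler_wpM2r.
have ny : `|y'| <= n' + 2 * M.
  rewrite y'E (le_trans (ler_normB _ _))// lerD2l normrZ ler_pM//.
have qb j : `|q j| <= 8 * M ^+ 4 * (`|zt| * (s ^+ 2 + wk * s)).
  have b1 : `|W * wkap * zt ^+ 2 * S j| <= W * wk * (2 * `|zt|) * M.
    rewrite normrM ler_pM//.
    rewrite ger0_norm; last by apply: mulr_ge0 => //; exact: mulr_ge0.
    by apply: ler_pM => //; [exact: mulr_ge0|exact: ler_wpM2l].
  have b2 : `|2 * W ^+ 2 * zt * (b j *m y'^T) 0 0| <= 2 * W ^+ 2 * `|zt| * (M * (n' + 2 * M)).
    rewrite normrM ler_pM//.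
      by rewrite (@normrM _ _ zt) ger0_norm ?sqr_ge0 ?mulr_ge0 ?sqr_ge0.
    by apply: le_trans (bM _ _) _; rewrite ler_wpM2l.
  have b3 : `|W ^+ 2 * zt * (bilin (h j) be u + bilin (h j) u be)|
     <= W ^+ 2 * `|zt| * (2 * (M * M * n')).
    rewrite normrM ler_pM//; first by rewrite (@normrM _ _ zt) ger0_norm ?sqr_ge0.
    rewrite (le_trans (ler_normD _ _))// mulr2n mulrDl mul1r lerD//.
      by apply: le_trans (hM _ _ _) _; rewrite ler_wpM2r// ler_wpM2l.
    apply: le_trans (hM _ _ _) _; rewrite mulrAC ler_wpM2r//.
    by rewrite ler_wpM2l.
  have b4 : `|W ^+ 2 * zt ^+ 2 * bilin (h j) be be| <= W ^+ 2 * (2 * `|zt|) * (M * M * M).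
    rewrite normrM ler_pM//.
      by rewrite ger0_norm; [apply: ler_wpM2l|apply: mulr_ge0].
    apply: le_trans (hM _ _ _) _; rewrite ler_pM ?mulr_ge0//.
    by rewrite ler_wpM2l.
  have b5 : `|W ^+ 2 * zt * be 0 j * bilin (h j) u u| <= W ^+ 2 * `|zt| * M * (M * n' * n').
    rewrite normrM ler_pM//.
    rewrite normrM ler_pM//.
    by rewrite (@normrM _ _ zt) ger0_norm ?sqr_ge0.
  have H : `|q j| <= n' * (W * wk * (2 * `|zt|) * M + 2 * W ^+ 2 * `|zt| * (M * (n' + 2 * M))
      + W ^+ 2 * `|zt| * (2 * (M * M * n')) + W ^+ 2 * (2 * `|zt|) * (M * M * M))
      + W ^+ 2 * `|zt| * M * (M * n' * n').
    rewrite (le_trans (ler_normD _ _))// lerD// normrM ler_pM//.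
    rewrite (le_trans (ler_normD _ _))// lerD//.
    rewrite (le_trans (ler_normB _ _))// lerD//.
    rewrite (le_trans (ler_normD _ _))// lerD// normrN//.
  apply: le_trans H _.
  set v := W * n'.
  rewrite [leLHS](_ : _ = `|zt| * (2 * M * (v * wk) + 2 * M * v ^+ 2 + 4 * M ^+ 2 * (W * v)
     + 2 * M ^+ 2 * v ^+ 2 + 2 * M ^+ 3 * (W * v) + M ^+ 2 * v ^+ 2)); last first.
    by rewrite /v; ring.
  rewrite [leRHS]mulrCA ler_wpM2l//.
  have v0 : 0 <= v by rewrite mulr_ge0.
  have v2 : v ^+ 2 <= M ^+ 2 * s ^+ 2 by rewrite -exprMn lerXn2r ?nnegrE ?mulr_ge0.
  have vwk : v * wk <= M * (wk * s).
    by rewrite mulrCA [leRHS]mulrC ler_wpM2r.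
  have Wv : W * v <= M * (wk * s) by rewrite (le_trans _ vwk)// mulrC ler_wpM2l.
  have e2 : M <= M ^+ 2 by rewrite expr2 ler_peMl.
  have e3 : M ^+ 2 <= M ^+ 3 by rewrite exprS ler_peMl ?sqr_ge0.
  have e4 : M ^+ 3 <= M ^+ 4 by rewrite [leRHS]exprS ler_peMl// exprn_ge0.
  set X := s ^+ 2 in v2 *; set Y := wk * s in vwk Wv *.
  have X0 : 0 <= X by exact: sqr_ge0.
  have Y0 : 0 <= Y by exact: mulr_ge0.
  have i1 : M * v ^+ 2 <= M ^+ 4 * X.
    rewrite (@le_trans _ _ (M * (M ^+ 2 * X)))//; first by rewrite ler_wpM2l.
    by rewrite mulrA -exprS ler_wpM2r.
  have i2 : M ^+ 2 * v ^+ 2 <= M ^+ 4 * X.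
    rewrite (@le_trans _ _ (M ^+ 2 * (M ^+ 2 * X)))//; first by rewrite ler_wpM2l ?sqr_ge0.
    by rewrite mulrA -exprD.
  have i3 : M * (v * wk) <= M ^+ 4 * Y.
    rewrite (@le_trans _ _ (M * (M * Y)))//; first by rewrite ler_wpM2l.
    by rewrite mulrA -expr2 ler_wpM2r// (le_trans e3).
  have i4 : M ^+ 2 * (W * v) <= M ^+ 4 * Y.
    rewrite (@le_trans _ _ (M ^+ 2 * (M * Y)))//; first by rewrite ler_wpM2l ?sqr_ge0.
    by rewrite mulrA -exprSr ler_wpM2r.
  have i5 : M ^+ 3 * (W * v) <= M ^+ 4 * Y.
    rewrite (@le_trans _ _ (M ^+ 3 * (M * Y)))//; first by rewrite ler_wpM2l ?exprn_ge0.
    by rewrite mulrA -exprSr.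
  have M4X : 0 <= M ^+ 4 * X by rewrite mulr_ge0// exprn_ge0.
  lra.
have Hb : `|W ^+ 2 * zt * bilin Hz u u| <= M ^+ 4 * (`|zt| * (s ^+ 2 + wk * s)).
  rewrite normrM (@le_trans _ _ (W ^+ 2 * `|zt| * (M * n' * n')))//.
    by rewrite ler_pM// (@normrM _ _ zt) ger0_norm ?sqr_ge0.
  rewrite (_ : _ * (_ * _) = `|zt| * (M * (W * n') ^+ 2)); last by ring.
  rewrite [leRHS]mulrCA ler_wpM2l//.
  rewrite (@le_trans _ _ (M * (M * s) ^+ 2))//.
    by rewrite ler_wpM2l// lerXn2r ?nnegrE ?mulr_ge0.
  rewrite exprMn mulrA -exprS ler_pM ?exprn_ge0 ?sqr_ge0//.
    by rewrite [leRHS]exprS ler_peMl// exprn_ge0.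
  by rewrite lerDl mulr_ge0.
rewrite (le_trans (ler_normB _ _))// !mulrDl mul1r lerD//.
rewrite (le_trans (ler_norm_sum _ _ _))// (le_trans (ler_sum _ (fun j _ => qb j)))//.
rewrite sumr_const card_ord -[leLHS]mulr_natl natrM le_eqVlt; apply/orP; left; apply/eqP; ring.
Qed.

End algebraic_bound.

Lemma differentiable_height (R : realType) d (p : 'rV[R]_(1 + d)) :
  differentiable (fun q : 'rV[R]_(1 + d) => lsubmx q 0 0) p.
Proof.
apply: (@differentiable_comp _ _ _ _ (fun q : 'rV[R]_(1 + d) => lsubmx q)
  (fun N : 'M[R]_(1, 1) => N 0 0)); first exact: differentiable_lsubmx.
exact: differentiable_coord.
Qed.

Lemma is_derive_rshift (R : realType) (W : normedModType R) (d : nat)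
    (g : R -> 'rV[R]_d -> W) (p : 'rV[R]_(1 + d)) (j : 'I_d) l :
  is_derive (rsubmx p) (delta_mx 0 j) (g (lsubmx p 0 0)) l ->
  is_derive p (delta_mx 0 (rshift 1 j))
    (fun q : 'rV[R]_(1 + d) => g (lsubmx q 0 0) (rsubmx q)) l.
Proof.
move=> [H1 <-].
have E1 (h : R) : rsubmx (h *: delta_mx 0 (rshift 1 j) + p) = h *: delta_mx 0 j + rsubmx p :> 'rV[R]_d.
  apply/rowP => a; by rewrite !mxE !eqxx !andTb eq_rshift.
have E (f0 : W) : (fun h : R => h^-1 *: (g (lsubmx (h *: delta_mx 0 (rshift 1 j) + p) 0 0)
      (rsubmx (h *: delta_mx 0 (rshift 1 j) + p)) - f0)) =
    (fun h => h^-1 *: (g (lsubmx p 0 0) (h *: delta_mx 0 j + rsubmx p) - f0)).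
  apply/funext => h; congr (_ *: (g _ _ - _)).
    rewrite !mxE (_ : (lshift d 0 == rshift 1 j) = false) ?andbF ?mulr0 ?add0r//.
  exact: E1.
apply: DeriveDef; last by rewrite /derive E.
by move: H1; rewrite /derivable E.
Qed.

Lemma is_derive_lshift (R : realType) (W : normedModType R) (d : nat)
    (g : R -> 'rV[R]_d -> W) (p : 'rV[R]_(1 + d)) l :
  is_derive p (delta_mx 0 (lshift d 0))
    (fun q : 'rV[R]_(1 + d) => g (lsubmx q 0 0) (rsubmx q)) l ->
  is_derive (lsubmx p 0 0) 1 (fun s => g s (rsubmx p)) l.
Proof.
move=> [H1 <-].
have E1 (h : R) : rsubmx (h *: delta_mx 0 (lshift d 0) + p) = rsubmx p :> 'rV[R]_d.
  apply/rowP => a; rewrite !mxE (_ : (rshift 1 a == lshift d 0) = false) ?andbF ?mulr0 ?add0r//.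
have E (f0 : W) : (fun h : R => h^-1 *: (g (lsubmx (h *: delta_mx 0 (lshift d 0) + p) 0 0)
      (rsubmx (h *: delta_mx 0 (lshift d 0) + p)) - f0)) =
    (fun h => h^-1 *: (g (h *: 1 + lsubmx p 0 0) (rsubmx p) - f0)).
  apply/funext => h; congr (_ *: (g _ _ - _)).
    by rewrite !mxE !eqxx.
  exact: E1.
apply: DeriveDef; last by rewrite /derive E.
by move: H1; rewrite /derivable E.
Qed.

Lemma bilin_block (R : realType) (d : nat) (a : R) (B : 'rV[R]_d)
    (H : 'M[R]_d) (v : 'rV[R]_(1 + d)) :
  let zt := lsubmx v 0 0 in let y' := rsubmx v in
  bilin (block_mx a%:M B B^T H) v v =
  a * zt ^+ 2 + 2 * zt * (B *m y'^T) 0 0 + bilin H y' y'.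
Proof.
move=> zt y'.
have -> : bilin (block_mx a%:M B B^T H) v v =
  (lsubmx v *m a%:M *m (lsubmx v)^T + y' *m B^T *m (lsubmx v)^T
   + (lsubmx v *m B *m y'^T + y' *m H *m y'^T)) 0 0.
  rewrite -[in LHS](hsubmxK v) /bilin mul_row_block tr_row_mx mul_row_col.
  by rewrite !mulmxDl.
have vE : lsubmx v = zt%:M by rewrite [LHS]mx11_scalar.
rewrite vE tr_scalar_mx -!scalar_mxM !mul_scalar_mx mul_mx_scalar -scalemxAl.
have -> : y' *m B^T = (B *m y'^T)^T by rewrite trmx_mul trmxK.
rewrite /bilin; move: (B *m y'^T) (y' *m H *m y'^T) => X X'.
rewrite !mxE eqxx mulr1n; ring.
Qed.

Section chart_computation.
Context {R : realType} {d : nat}.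
Variables (k kappa : nat) (wf : R -> R) (S : R -> 'rV[R]_d -> R)
  (b : R -> 'rV[R]_d -> 'rV[R]_d) (h : R -> 'rV[R]_d -> 'M[R]_d).

Definition metric_mx (q : 'rV[R]_(1 + d)) : 'M[R]_(1 + d) :=
  let z := lsubmx q 0 0 in let x := rsubmx q in
  block_mx (1 - wf z ^+ kappa * S z x)%:M (wf z ^+ (2 * k) *: b z x)
    (wf z ^+ (2 * k) *: (b z x)^T) (wf z ^+ (2 * k) *: h z x).

Definition momentum (q v : 'rV[R]_(1 + d)) : 'rV[R]_d :=
  \row_m \sum_a metric_mx q (rshift 1 m) a * v 0 a.

Lemma momentumE (q v : 'rV[R]_(1 + d)) :
  let z := lsubmx q 0 0 in let x := rsubmx q in
  momentum q v = wf z ^+ (2 * k) *: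
    (lsubmx v 0 0 *: b z x + rsubmx v *m (h z x)^T).
Proof.
move=> z x; apply/rowP => m; rewrite !mxE big_split_ord/= big_ord1.
have ME : metric_mx q = block_mx (1 - wf z ^+ kappa * S z x)%:M (wf z ^+ (2 * k) *: b z x)
    (wf z ^+ (2 * k) *: (b z x)^T) (wf z ^+ (2 * k) *: h z x) by [].
rewrite ME block_mxEdl !mxE mulrDr; congr (_ + _).
  by ring.
rewrite mulr_sumr; apply: eq_bigr => a _.
by rewrite block_mxEdr !mxE; ring.
Qed.

Lemma bilin_metric (q v : 'rV[R]_(1 + d)) :
  let z := lsubmx q 0 0 in let x := rsubmx q in
  let zt := lsubmx v 0 0 in let y' := rsubmx v in
  bilin (metric_mx q) v v = (1 - wf z ^+ kappa * S z x) * zt ^+ 2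
    + wf z ^+ (2 * k) * (2 * zt * (b z x *m y'^T) 0 0 + bilin (h z x) y' y').
Proof.
move=> z x zt y'; rewrite /metric_mx -/z -/x.
have -> : wf z ^+ (2 * k) *: (b z x)^T = (wf z ^+ (2 * k) *: b z x)^T by rewrite linearZ.
rewrite bilin_block -/zt -/y' -scalemxAl /bilin -scalemxAr -scalemxAl !mxE.
ring.
Qed.

Variables (c : R -> 'rV[R]_(1 + d)) (t : R).
Let p := c t.
Let z := lsubmx p 0 0.
Let x := rsubmx p.
Let v := derive1 c t.
Let zt := lsubmx v 0 0.
Let y' := rsubmx v.
Let W := wf z ^+ (2 * k).
Let dx (j : 'I_d) : 'rV[R]_d := delta_mx 0 j.
Let Sj j := 'D_(dx j) (S z) x.
Let bj j := 'D_(dx j) (b z) x.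
Let hj j := 'D_(dx j) (h z) x.
Let Hz := derive1 (fun s => h s x) z.

Hypothesis dc : derivable c t 1.
Hypothesis dc' : derivable (derive1 c) t 1.
Hypothesis geo : forall j : 'I_(1 + d), derive1 (derive1 c) t 0 j +
     \sum_(a < 1 + d) \sum_(b < 1 + d)
        christoffel metric_mx (c t) j a b * derive1 c t 0 a * derive1 c t 0 b = 0.
Hypothesis uG : metric_mx p \in unitmx.
Hypothesis dw : derivable wf z 1.
Hypothesis db : forall m, differentiable
  (fun q : 'rV[R]_(1 + d) => b (lsubmx q 0 0) (rsubmx q) 0 m) p.
Hypothesis dh : forall m n, differentiable
  (fun q : 'rV[R]_(1 + d) => h (lsubmx q 0 0) (rsubmx q) m n) p.
Hypothesis dS : forall j, derivable (S z) x (dx j).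
Hypothesis dbx : forall j, derivable (b z) x (dx j).
Hypothesis dhx : forall j, derivable (h z) x (dx j).

Lemma differentiable_metric_row m a :
  differentiable (fun q => metric_mx q (rshift 1 m) a) p.
Proof.
have dW : differentiable (fun q : 'rV[R]_(1 + d) => wf (lsubmx q 0 0) ^+ (2 * k)) p.
  have dwf : differentiable (fun q : 'rV[R]_(1 + d) => wf (lsubmx q 0 0)) p.
    apply: (@differentiable_comp _ _ _ _ (fun q : 'rV[R]_(1 + d) => lsubmx q 0 0) wf).
      exact: differentiable_height.
    by apply/derivable1_diffP.
  rewrite (_ : (fun _ => _) = (fun q : 'rV[R]_(1 + d) => wf (lsubmx q 0 0)) ^+ (2 * k)).
    case: (2 * k)%N => [|n]; last exact: differentiableX.
    rewrite expr0; exact: (@differentiable_cst _ _ _ (1 : R)).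
  by apply/funext => q; rewrite exprfctE.
rewrite /metric_mx; have [i ->|i ->] := split_ordP a.
  rewrite (_ : (fun _ => _) = (fun q : 'rV[R]_(1 + d) => wf (lsubmx q 0 0) ^+ (2 * k))
     * (fun q : 'rV[R]_(1 + d) => b (lsubmx q 0 0) (rsubmx q) 0 m)).
    exact: differentiableM.
  by apply/funext => q; rewrite block_mxEdl ord1 [LHS]mxE [X in _ * X]mxE.
rewrite (_ : (fun _ => _) = (fun q : 'rV[R]_(1 + d) => wf (lsubmx q 0 0) ^+ (2 * k))
     * (fun q : 'rV[R]_(1 + d) => h (lsubmx q 0 0) (rsubmx q) m i)).
  exact: differentiableM.
by apply/funext => q; rewrite block_mxEdr [LHS]mxE.
Qed.

Lemma derive_metric j :
  is_derive p (delta_mx 0 (rshift 1 j)) metric_mx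
   (block_mx (- (wf z ^+ kappa * Sj j))%:M (W *: bj j) (W *: (bj j)^T) (W *: hj j)).
Proof.
apply: (@is_derive_rshift _ _ _ (fun z x =>
  block_mx (1 - wf z ^+ kappa * S z x)%:M (wf z ^+ (2 * k) *: b z x)
    (wf z ^+ (2 * k) *: (b z x)^T) (wf z ^+ (2 * k) *: h z x))).
rewrite -/z -/x.
have HS := @derivableP _ _ _ (S z) x (dx j) (@dS j); have Hb := @derivableP _ _ _ (b z) x (dx j) (@dbx j); have Hh := @derivableP _ _ _ (h z) x (dx j) (@dhx j).
apply/is_derive_mxP => a a'.
have [i ->|i ->] := split_ordP a; have [i' ->|i' ->] := split_ordP a'.
- rewrite block_mxEul !ord1 !mxE eqxx mulr1n (_ : (fun _ => _) = cst 1 - (wf z ^+ kappa) *: S z).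
    by apply: (is_derive_eq (is_deriveB _ _)); rewrite sub0r.
  by apply/funext => q; rewrite block_mxEul !mxE eqxx.
- rewrite block_mxEur (_ : (fun _ => _) = W *: (fun q => b z q i i')).
    rewrite mxE; apply: is_deriveZ.
    by move/is_derive_mxP : Hb; exact.
  by apply/funext => q; rewrite block_mxEur !mxE.
- rewrite block_mxEdl (_ : (fun _ => _) = W *: (fun q => b z q i' i)).
    rewrite !mxE; apply: is_deriveZ.
    by move/is_derive_mxP : Hb; exact.
  by apply/funext => q; rewrite block_mxEdl !mxE.
- rewrite block_mxEdr (_ : (fun _ => _) = W *: (fun q => h z q i i')).
    rewrite mxE; apply: is_deriveZ.
    by move/is_derive_mxP : Hh; exact.
  by apply/funext => q; rewrite block_mxEdr !mxE.
Qed.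

Lemma derive_momentum :
  is_derive t 1 (fun s => momentum (c s) (derive1 c s))
    (\row_j (2^-1 * (- wf z ^+ kappa * Sj j * zt ^+ 2
        + 2 * W * zt * (bj j *m y'^T) 0 0 + W * bilin (hj j) y' y'))).
Proof.
apply/is_derive_mxP => i j; rewrite ord1 mxE.
rewrite (_ : (fun _ => _) = (fun s => \sum_a metric_mx (c s) (rshift 1 j) a * derive1 c s 0 a)); last first.
  by apply/funext => s; rewrite mxE.
have := @geodesic_momentum _ _ metric_mx c t (rshift 1 j) dc dc' geo uG
  (differentiable_metric_row j).
move=> Hgm; apply: (is_derive_eq Hgm); congr (_ * _).
set DG := block_mx (- (wf z ^+ kappa * Sj j))%:M (W *: bj j) (W *: (bj j)^T) (W *: hj j).
have DE a a' : 'D_(delta_mx 0 (rshift 1 j)) (fun q => metric_mx q a a') (c t) = DG a a'.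
  by have /is_derive_mxP/(_ a a') [] := derive_metric j.
transitivity (bilin DG v v).
  rewrite bilinE; apply: eq_bigr => a _; apply: eq_bigr => a' _.
  by rewrite DE [_ * derive1 c t 0 a]mulrC.
rewrite /DG.
have -> : W *: (bj j)^T = (W *: bj j)^T by rewrite linearZ.
rewrite bilin_block -/zt -/y' -scalemxAl /bilin -scalemxAr -scalemxAl.
rewrite [(W *: (bj j *m _)) 0 0]mxE [(W *: (y' *m _ *m _)) 0 0]mxE; ring.
Qed.

Lemma derive_h :
  is_derive t 1 (fun s => h (lsubmx (c s) 0 0) (rsubmx (c s)))
    (zt *: Hz + \sum_j y' 0 j *: hj j).
Proof.
apply/is_derive_mxP => a a'.
apply: (is_derive_eq (is_derive_along dc (dh a a'))).
rewrite big_split_ord/= big_ord1 !mxE summxE; congr (_ + _).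
  rewrite [RHS]mulrC; congr (_ * _).
  rewrite /Hz derive1E.
  have : is_derive z 1 (fun s => h s x) (\matrix_(a, a')
     'D_(delta_mx 0 (lshift d 0)) (fun q : 'rV[R]_(1 + d) => h (lsubmx q 0 0) (rsubmx q) a a') p).
    apply/is_derive_mxP => e e'; rewrite mxE.
    apply: (@is_derive_lshift _ _ _ (fun s x => h s x e e')).
    by apply: derivableP; apply: diff_derivable; exact: dh.
  by case=> _ ->; rewrite mxE.
  by rewrite /zt mxE.
apply: eq_bigr => j _; rewrite !mxE mulrC; congr (_ * _).
have /is_derive_mxP/(_ a a') Hh := @derivableP _ _ _ (h z) x (dx j) (@dhx j).
by have [_ ->] := @is_derive_rshift _ _ _ (fun s x => h s x a a') p j _ Hh.
Qed.

Hypothesis hp : posdef (h z x).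
Let be := b z x *m invmx (h z x).
Let eta := momentum p v.
(** In terms of [zt] and this vector the metric is block diagonal, see
    [unit_speed_split]: it is the orthogonal projection of the velocity to the
    level set of the height. *)
Definition lifted_velocity : 'rV[R]_d := y' + zt *: be.
Let u := lifted_velocity.

Lemma momentum_lift : eta = W *: (u *m h z x).
Proof.
have uh := posdef_unit hp; have [hs _] := hp.
rewrite /eta momentumE -/z -/x -/W -/zt -/y' hs /u mulmxDl -scalemxAl mulmxKV//.
by rewrite addrC.
Qed.

Lemma momentum_square :
  bilin (invmx (h z x)) eta eta = W ^+ 2 * bilin (h z x) u u.
Proof.
have uh := posdef_unit hp; have [hs _] := hp.
rewrite momentum_lift bilinZl bilinZr mulrA -expr2; congr (_ * _).
by rewrite /bilin mulmxK// trmx_mul hs mulmxA.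
Qed.

Lemma unit_speed_split :
  bilin (metric_mx p) v v = (1 - wf z ^+ kappa * S z x
     - W * bilin (invmx (h z x)) (b z x) (b z x)) * zt ^+ 2
    + W * bilin (h z x) u u.
Proof.
have uh := posdef_unit hp; have [hs _] := hp.
rewrite bilin_metric -/z -/x -/zt -/y' -/W /u /lifted_velocity.
rewrite bilinDl !bilinDr !bilinZl !bilinZr (bilinC be y' hs).
have -> : bilin (h z x) y' be = (b z x *m y'^T) 0 0.
  by rewrite (bilinC _ _ hs) /bilin /be mulmxKV.
have -> : bilin (h z x) be be = bilin (invmx (h z x)) (b z x) (b z x).
  by rewrite /bilin /be mulmxKV// trmx_mul trmx_inv hs mulmxA.
ring.
Qed.

(** The product rule for [eta h^-1 eta^T], with Hamilton's equation for the
    derivative of [eta]. *)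
Lemma derive_momentum_square :
  is_derive t 1 (fun s => bilin (invmx (h (lsubmx (c s) 0 0) (rsubmx (c s))))
                  (momentum (c s) (derive1 c s)) (momentum (c s) (derive1 c s)))
   (2 * W * (\sum_j (2^-1 * (- wf z ^+ kappa * Sj j * zt ^+ 2
        + 2 * W * zt * (bj j *m y'^T) 0 0 + W * bilin (hj j) y' y')) * u 0 j)
    - W ^+ 2 * (zt * bilin Hz u u + \sum_j y' 0 j * bilin (hj j) u u)).
Proof.
have uh := posdef_unit hp; have [hs _] := hp.
have He := derive_momentum; have Hi := is_derive_invmx uh derive_h.
set de := \row_j _ in He.
set dh' := _ + \sum_j _ in Hi.
have := is_derive_mulmx (is_derive_mulmx He Hi) (is_derive_trmx He).
move=> /is_derive_mxP/(_ 0 0) Hgm; apply: (is_derive_eq Hgm).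
rewrite -/p -/v -/eta -/z -/x.
have e1 : eta *m invmx (h z x) = W *: u by rewrite momentum_lift -scalemxAl mulmxK.
have e2 : invmx (h z x) *m eta^T = W *: u^T.
  by rewrite momentum_lift linearZ/= trmx_mul hs -scalemxAr mulKmx.
have -> : (de *m invmx (h z x) + eta *m - (invmx (h z x) *m dh' *m invmx (h z x))) *m eta^T
  + eta *m invmx (h z x) *m de^T =
  W *: (de *m u^T) - W ^+ 2 *: (u *m dh' *m u^T) + W *: (u *m de^T).
  rewrite mulmxDl -mulmxA e2 mulmxN mulNmx e1 -scalemxAl -scalemxAr; congr (_ - _ + _).
  by rewrite !mulmxA e1 -!mulmxA e2 -!scalemxAr -!scalemxAl mulmxA scalerA expr2.
have mx11 (A B C : 'M[R]_1) : (W *: A - W ^+ 2 *: B + W *: C) 0 0 =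
  W * A 0 0 - W ^+ 2 * B 0 0 + W * C 0 0 by rewrite !mxE.
rewrite mx11.
have E1 : (de *m u^T) 0 0 = \sum_j (2^-1 * (- wf z ^+ kappa * Sj j * zt ^+ 2
        + 2 * W * zt * (bj j *m y'^T) 0 0 + W * bilin (hj j) y' y')) * u 0 j.
  by rewrite [LHS]mxE; apply: eq_bigr => j _; rewrite [u^T j 0]mxE [de 0 j]mxE.
have -> : (u *m de^T) 0 0 = (de *m u^T) 0 0.
  by rewrite -[in LHS](trmxK u) -trmx_mul mxE.
rewrite E1.
have -> : (u *m dh' *m u^T) 0 0 = zt * bilin Hz u u + \sum_j y' 0 j * bilin (hj j) u u.
  rewrite -[LHS]/(bilin dh' u u) /dh' /bilin mulmxDr mulmxDl [LHS]mxE; congr (_ + _).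
    by rewrite -scalemxAr -scalemxAl [LHS]mxE.
  rewrite mulmx_sumr mulmx_suml summxE; apply: eq_bigr => j _.
  by rewrite -scalemxAr -scalemxAl [LHS]mxE.
ring.
Qed.

End chart_computation.

(** * Bounds on the coefficients *)

Lemma near_eq_differentiable (R : realType) (V W : normedModType R)
    (f g : V -> W) (a : V) :
  (\forall x \near a, f x = g x) -> differentiable f a -> differentiable g a.
Proof.
move=> fg df; apply: (@differentiable_expansion _ _ _ g ('d f a)).
  exact: diff_continuous.
move=> eps eps0.
have := diff_locally df => /eqaddoP/(_ eps eps0) H.
have fg0 : \forall h \near (0 : V), f (h + a) = g (h + a).
  by move: fg; rewrite (near_shift 0 a)/=; apply: filterS => h /=; rewrite subr0.
have fga := nbhs_singleton fg.
near=> h.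
rewrite -fga -(near fg0 h)//.
have : `|((f \o shift a) - (cst (f a) + 'd f a)) h| <= eps * `|id h|.
  by near: h; exact: H.
by rewrite /= !fctE/= opprD addrA.
Unshelve. all: by end_near. Qed.

(** The form at [q0] is coercive, and a form within half of its coercivity
    constant keeps the other half. *)
Lemma smooth_on_local_coercive (R : realType) (n : nat) (V : normedModType R)
    (A : set V) (f : V -> 'M[R]_n) (q0 : V) :
  smooth_on A f -> A q0 -> posdef (f q0) ->
  exists C : R, \forall q \near q0, A q ->
    forall v, `|v| ^+ 2 <= C * bilin (f q) v v.
Proof.
move=> sf Aq0 pf; have [U [F [oU Uq0 sF Ff]]] := sf q0 Aq0.
have [lam lam0 Hlam] := posdef_coercive pf.
(* [bilin_bound] loses the factor n ^ 2, which may be 0 *)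
pose eta := lam / 2 / (n ^ 2).+1%:R.
have eta0 : 0 < eta by rewrite !divr_gt0.
exists (2 / lam); near=> q => Aq v.
have Uq : U q by near: q; exact: open_nbhs_nbhs.
have fq : `|f q - f q0| <= eta.
  rewrite -!Ff// distrC; near: q.
  by have /cvgrPdist_le := (sF 0%N).1 q0 Uq0; apply.
have E : bilin (f q) v v = bilin (f q0) v v + bilin (f q - f q0) v v.
  rewrite /bilin mulmxBr mulmxBl; move: (v *m f q *m v^T) (v *m f q0 *m v^T) => X Y.
  by rewrite !mxE; ring.
have Hb : `|bilin (f q - f q0) v v| <= lam / 2 * `|v| ^+ 2.
  apply: le_trans (bilin_bound _ _ _) _.
  rewrite -mulrA -expr2 ler_wpM2r ?sqr_ge0//.
  rewrite (@le_trans _ _ ((n ^ 2)%:R * eta))//; first by rewrite ler_wpM2l.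
  rewrite /eta mulrCA ler_piMr ?divr_ge0 ?(ltW lam0)//.
  by rewrite ler_pdivrMr// mul1r ler_nat.
have := Hlam v; rewrite E; move: Hb; rewrite ler_norml => /andP[Hb _] Hl.
rewrite mulrAC ler_pdivlMr//; lra.
Unshelve. all: by end_near. Qed.

Section polar.
Context {R : realType}.
Implicit Types e z : R.

Definition polar_radius e z : R := Num.sqrt (e ^+ 2 + z ^+ 2).
Definition polar_angle e z : R := atan (z / e).

Lemma polar_radius_gt0 e z : 0 < e -> 0 < polar_radius e z.
Proof. by move=> e0; rewrite sqrtr_gt0 ltr_wpDr ?sqr_ge0// exprn_gt0. Qed.

Lemma polar_cos e z : 0 < e -> polar_radius e z * cos (polar_angle e z) = e.
Proof.
move=> e0; rewrite cos_atan.
have -> : 1 + (z / e) ^+ 2 = (e ^+ 2 + z ^+ 2) / e ^+ 2.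
  by rewrite exprMn exprVn mulrDl divff// expf_neq0// gt_eqF.
rewrite sqrtrM ?addr_ge0 ?sqr_ge0// sqrtrV ?sqr_ge0// sqrtr_sqr gtr0_norm//.
rewrite -/(polar_radius e z) invfM invrK mulrA divff ?mul1r//.
by rewrite gt_eqF// polar_radius_gt0.
Qed.

Lemma polar_sin e z : 0 < e -> polar_radius e z * sin (polar_angle e z) = z.
Proof.
move=> e0; have c0 : cos (polar_angle e z) != 0.
  by apply/eqP => c0; have := polar_cos z e0; rewrite c0 mulr0; move/eqP; rewrite lt_eqF.
have : tan (polar_angle e z) = z / e by rewrite atanK.
rewrite /tan => /(congr1 (fun x => x * cos (polar_angle e z))); rewrite divfK// => ->.
by rewrite mulrCA polar_cos// divfK// gt_eqF.
Qed.

Lemma polar_angle_range e z : - (pi / 2) <= polar_angle e z <= pi / 2.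
Proof. by rewrite !ltW ?atan_gtNpi2 ?atan_ltpi2. Qed.

Lemma polar_radius_le e z rho : 0 <= rho -> 0 < e <= rho -> `|z| <= rho ->
  polar_radius e z <= 2 * rho.
Proof.
move=> rho0 /andP[e0 er] zr.
rewrite -[leRHS]ger0_norm ?mulr_ge0// -sqrtr_sqr ler_wsqrtr//.
have h1 : e ^+ 2 <= rho ^+ 2 by rewrite lerXn2r ?nnegrE// ltW.
have h2 : z ^+ 2 <= rho ^+ 2.
  by rewrite -[z ^+ 2]real_normK ?num_real// lerXn2r ?nnegrE.
have := sqr_ge0 rho; rewrite exprMn; lra.
Qed.

Lemma derivable_polar_radius e z : 0 < e -> derivable (polar_radius e) z 1.
Proof.
move=> e0; have p0 : 0 < e ^+ 2 + z ^+ 2 by rewrite ltr_wpDr ?sqr_ge0// exprn_gt0.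
apply/derivable1_diffP.
apply: (@differentiable_comp _ _ _ _ (fun z => e ^+ 2 + z ^+ 2) Num.sqrt).
  apply/derivable1_diffP; apply: derivableD; first exact: derivable_cst.
  exact: exprn_derivable.
by apply/derivable1_diffP; have := is_derive1_sqrt p0; case.
Qed.

Lemma derivable_polar_angle e z : derivable (polar_angle e) z 1.
Proof.
apply/derivable1_diffP.
apply: (@differentiable_comp _ _ _ _ (fun z => z / e) atan).
  apply/derivable1_diffP; apply: derivableM; first exact: derivable_id.
  exact: derivable_cst.
by apply/derivable1_diffP; exact: derivable_atan.
Qed.

End polar.

Section coefficients.
Context {R : realType} {d : nat} {Y : closedManifold R d}.
Variables (I : set R) (e1 : R) (D : coeffs Y).
Hypotheses (oI : open I) (iI : is_interval I).
Hypothesis hD : regular_coeffs e1 I D.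

Lemma polar_in_blowup e z : 0 < e < e1 -> I z ->
  blowup_domain e1 I (polar_radius e z, polar_angle e z).
Proof.
move=> /andP[e0 ee1] Iz; split => /=.
- exact/ltW/polar_radius_gt0.
- exact: polar_angle_range.
- by rewrite polar_cos.
- by rewrite polar_sin.
Qed.

(** For fixed [e > 0] the polar coordinates are smooth functions of [z], so that
    smoothness on the blow-up yields a differential in [(z, x)] jointly. *)
Lemma differentiable_blowup_entry (i : chart_index Y) m n
    (fB : R -> R -> Y -> 'M[R]_(m, n)) (fD : R -> R -> Y -> 'M[R]_(m, n)) e
    (p : 'rV[R]_(1 + d)) a b :
  smooth_on (blowup_domain e1 I `*` ccod (atlas i))
    (fun q => fB q.1.1 q.1.2 (param (atlas i) q.2)) ->
  (forall r phi y, blowup_domain e1 I (r, phi) -> 0 < r * cos phi ->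
     cdom (atlas i) y -> fB r phi y = fD (r * cos phi) (r * sin phi) y) ->
  0 < e < e1 -> I (lsubmx p 0 0) -> ccod (atlas i) (rsubmx p) ->
  differentiable (fun q : 'rV[R]_(1 + d) =>
    fD e (lsubmx q 0 0) (param (atlas i) (rsubmx q)) a b) p.
Proof.
move=> sf BD /andP[e0 ee1] Iz cx.
pose pol (q : 'rV[R]_(1 + d)) : R * R * 'rV[R]_d :=
  (polar_radius e (lsubmx q 0 0), polar_angle e (lsubmx q 0 0), rsubmx q).
have Ap : (blowup_domain e1 I `*` ccod (atlas i)) (pol p).
  by split => //=; apply: polar_in_blowup => //; rewrite e0.
have [U [F [oU Up sF Ff]]] := sf _ Ap.
have dz := differentiable_height p.
have dpol : differentiable pol p.
  apply: differentiable_pair; last exact: differentiable_rsubmx.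
  apply: differentiable_pair.
    apply: (@differentiable_comp _ _ _ _ (fun q : 'rV[R]_(1 + d) => lsubmx q 0 0)) => //.
    by apply/derivable1_diffP; exact: derivable_polar_radius.
  apply: (@differentiable_comp _ _ _ _ (fun q : 'rV[R]_(1 + d) => lsubmx q 0 0)) => //.
  by apply/derivable1_diffP; exact: derivable_polar_angle.
have dF : differentiable (fun q => F q a b) (pol p).
  apply: (@C1_differentiable_param _ _ _ U) => //.
  by apply: Cn_on1_entry => //; exact: sF.
have := differentiable_comp dpol dF.
apply: near_eq_differentiable.
have NU : \forall q \near p, U (pol q).
  by apply: (differentiable_continuous dpol); exact: open_nbhs_nbhs.
have NI : \forall q \near p, I (lsubmx q 0 0 : R).
  by apply: (differentiable_continuous dz); exact: open_nbhs_nbhs.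
have NC : \forall q \near p, ccod (atlas i) (rsubmx q).
  apply: (differentiable_continuous (@differentiable_rsubmx _ 1 1 d p)).
  by apply: open_nbhs_nbhs; split => //; exact: ccod_open.
near=> q.
have Iq : I (lsubmx q 0 0) by near: q.
have Cq : ccod (atlas i) (rsubmx q) by near: q.
have Bq : blowup_domain e1 I (pol q).1 by apply: polar_in_blowup; rewrite // e0.
rewrite /= Ff//; last by near: q.
by rewrite /= BD//= ?polar_cos// ?polar_sin//; exact: (paramP Cq).1.
Unshelve. all: by end_near. Qed.

(** The derivative of [h] along [z] is bounded by hypothesis and not by
    compactness: a smooth function of the polar coordinates may have a derivative
    in [z] of the size of the inverse radius. *)
Definition chart_bounds (C : R) (i : chart_index Y) (e z : R) (x : 'rV[R]_d) : Prop :=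
  let S x := cS D e z (param (atlas i) x) in
  let b x := cb D i e z (param (atlas i) x) in
  let h x := ch D i e z (param (atlas i) x) in
  [/\ `|S x| <= C /\
      (forall j, derivable S x (delta_mx 0 j) /\ `|'D_(delta_mx 0 j) S x| <= C),
      `|b x| <= C /\
      (forall j, derivable b x (delta_mx 0 j) /\ `|'D_(delta_mx 0 j) b x| <= C),
      `|h x| <= C /\
      (forall j, derivable h x (delta_mx 0 j) /\ `|'D_(delta_mx 0 j) h x| <= C),
      (forall v, `|v| ^+ 2 <= C * bilin (h x) v v) &
      `|derive1 (fun s => ch D i e s (param (atlas i) x)) z| <= C].

Lemma polar_box_in_blowup rho : 0 <= rho -> rho < e1 -> I (- rho) -> I rho ->
  forall r phi, 0 <= r <= rho -> - (pi / 2) <= phi <= pi / 2 ->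
  blowup_domain e1 I (r, phi).
Proof.
move=> rho0 re1 Im Ip r phi /andP[r0 rr] hphi; split => //=.
  rewrite (le_lt_trans _ re1)// (le_trans _ rr)//.
  by rewrite ler_piMr// cos_le1.
have hs : - rho <= r * sin phi <= rho.
  rewrite -ler_norml normrM (ger0_norm r0) (le_trans _ rr)//.
  by rewrite ler_piMr// sin_max.
exact: (iI Im Ip hs).
Qed.

(** For [e] and [|z|] at most [rho] the polar coordinates lie in a compact
    rectangle, which together with a closed coordinate ball is contained in the
    set where the coefficients are smooth.  The bounds found by compactness hold
    down to [e = 0]. *)
Lemma chart_bounds_near rho : 0 < rho -> 2 * rho < e1 -> I (- (2 * rho)) ->
  I (2 * rho) -> forall y : Y, exists C : R, \forall y' \near y,
    exists i, cdom (atlas i) y' /\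
     forall e z, 0 < e <= rho -> `|z| <= rho ->
       chart_bounds C i e z (coord (atlas i) y').
Proof.
move=> rho0 re1 Im Ip y; set i := chart_at y.
have [_ [B [cB sB BD _ _]] hz] := hD.
have cy : cdom (atlas i) y := chart_atP y.
have [cx _] := coordP cy.
set x0 := coord (atlas i) y in cx.
have /nbhs_ballP[del /= del0 ballC] : nbhs x0 (ccod (atlas i)).
  by apply: open_nbhs_nbhs; split => //; exact: ccod_open.
(* half the radius, so that the closed ball stays in the chart *)
pose K : set 'rV[R]_d := [set x | `|x0 - x| <= del / 2].
have KC : K `<=` ccod (atlas i).
  move=> x Kx; apply: ballC; rewrite -ball_normE/=.
  by rewrite (le_lt_trans Kx)// ltr_pdivrMr// ltr_pMr// ltr1n.
have cK : compact K.
  apply: bounded_closed_compact.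
    exists (`|x0| + del / 2); split; first exact: num_real.
    move=> M HM x Kx; rewrite /= (le_trans _ (ltW HM))//.
    rewrite -[x](subKr x0) (le_trans (ler_normB _ _))//.
    by rewrite lerD2l.
  rewrite (_ : K = (fun x : 'rV[R]_d => `|x0 - x|) @^-1` [set r | r <= del / 2])//.
  apply: preimage_closed => [x _|]; last exact: closed_le.
  apply: (@continuous_comp _ _ _ (fun x : 'rV[R]_d => x0 - x) (fun x => `|x|)).
    exact: (@cvgB _ _ _ (nbhs x) _ (fun=> x0) id x0 x (cvg_cst _) cvg_id).
  exact: norm_continuous.
pose Q : set (R * R * 'rV[R]_d) :=
  (`[0, 2 * rho] `*` `[- (pi / 2), pi / 2]) `*` K.
have cQ : compact Q by do 2?apply: compact_setX => //; exact: segment_compact.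
pose A : set (R * R * 'rV[R]_d) := blowup_domain e1 I `*` ccod (atlas i).
have QA : Q `<=` A.
  move=> [[r phi] x] [[/= r0 hphi] Kx]; split => /=; last exact: KC.
  have r2 : 0 <= 2 * rho by rewrite mulr_ge0 ?ltW.
  exact: (polar_box_in_blowup r2 re1 Im Ip r0 hphi).
have [sS sb sh] := sB i.
have bound (W : normedModType R) (f : R * R * 'rV[R]_d -> W) : smooth_on A f ->
   exists2 C, 0 < C & forall q, Q q -> `|f q| <= C /\
    forall j, derivable (fun x => f (q.1, x)) q.2 (delta_mx 0 j) /\
              `|'D_(delta_mx 0 j) (fun x => f (q.1, x)) q.2| <= C.
  move=> sf; apply: compact_uniform_bound => //.
    move=> C C' q CC' [b1 b2]; split; first exact: le_trans CC'.
    by move=> j; have [? b3] := b2 j; split => //; exact: le_trans CC'.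
  move=> q /QA Aq.
  have [C HC] := smooth_on_local_bound (@ccod_open _ _ _ (atlas i)) sf Aq.
  by exists C; apply: filterS HC => q' H /QA; exact: H.
have [CS CS0 HCS] := bound _ _ sS.
have [Cb Cb0 HCb] := bound _ _ sb.
have [Ch Ch0 HCh] := bound _ _ sh.
have [Cp Cp0 HCp] : exists2 C, 0 < C & forall q, Q q ->
    posdef (ch B i q.1.1 q.1.2 (param (atlas i) q.2)) /\
    forall v, `|v| ^+ 2 <= C * bilin (ch B i q.1.1 q.1.2 (param (atlas i) q.2)) v v.
  apply: compact_uniform_bound => //.
    move=> C C' q CC' [pd b1]; split => // v.
    by apply: le_trans (b1 v) _; rewrite ler_wpM2r// posdef_ge0.
  have pdA q : A q -> posdef (ch B i q.1.1 q.1.2 (param (atlas i) q.2)).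
    move=> [Aq1 Aq2]; have [_ [_ pd]] := cB _ Aq1; apply: pd.
    exact: (paramP Aq2).1.
  move=> q /QA Aq.
  have [C HC] := smooth_on_local_coercive sh Aq (pdA _ Aq).
  by exists C; apply: filterS HC => q' H /QA Aq'; split; [exact: pdA|exact: H].
have [Cz HCz] := hz i K cK KC.
pose C := CS + Cb + Ch + Cp + `|Cz|.
have CSC : CS <= C by rewrite /C -!addrA lerDl !addr_ge0// ltW.
have CbC : Cb <= C by rewrite /C -!addrA addrCA lerDl !addr_ge0// ltW.
have ChC : Ch <= C by rewrite /C; have := normr_ge0 Cz; lra.
have CpC : Cp <= C by rewrite /C; have := normr_ge0 Cz; lra.
have CzC : Cz <= C by rewrite /C; have := ler_norm Cz; lra.
exists C.
have Nd : \forall y' \near y, cdom (atlas i) y'.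
  by apply: open_nbhs_nbhs; split => //; exact: cdom_open.
have NK : \forall y' \near y, K (coord (atlas i) y').
  have /cvgrPdist_le := coord_cont cy; apply.
  by rewrite divr_gt0.
near=> y'; exists i; split; first by near: y'.
move=> e z /andP[e0 er] zr; set x := coord (atlas i) y'.
have Kx : K (coord (atlas i) y') by near: y'.
have Cx : ccod (atlas i) x := KC _ Kx.
pose r := polar_radius e z; pose phi := polar_angle e z.
have Qq : Q (r, phi, x).
  split => //; split => /=; rewrite in_itv/=.
    by rewrite ltW ?polar_radius_gt0//= polar_radius_le ?e0// ltW.
  exact: polar_angle_range.
have Bq : blowup_domain e1 I (r, phi) := (QA _ Qq).1.
have rc : 0 < r * cos phi by rewrite polar_cos.
have EqS x' : cS B r phi (param (atlas i) x') = cS D e z (param (atlas i) x').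
  by have [-> _ _] := BD r phi (param (atlas i) x') Bq rc; rewrite polar_cos ?polar_sin.
have Eqb x' : ccod (atlas i) x' ->
    cb B i r phi (param (atlas i) x') = cb D i e z (param (atlas i) x').
  move=> /paramP[cd _]; have [_ -> // _] := BD r phi (param (atlas i) x') Bq rc.
  by rewrite polar_cos ?polar_sin.
have Eqh x' : ccod (atlas i) x' ->
    ch B i r phi (param (atlas i) x') = ch D i e z (param (atlas i) x').
  move=> /paramP[cd _]; have [_ _ -> //] := BD r phi (param (atlas i) x') Bq rc.
  by rewrite polar_cos ?polar_sin.
have Nx : \forall x' \near x, ccod (atlas i) x'.
  by apply: open_nbhs_nbhs; split => //; exact: ccod_open.
have Nb : \forall x' \near x,
    cb B i r phi (param (atlas i) x') = cb D i e z (param (atlas i) x').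
  by apply: filterS Nx => x'; exact: Eqb.
have Nh : \forall x' \near x,
    ch B i r phi (param (atlas i) x') = ch D i e z (param (atlas i) x').
  by apply: filterS Nx => x'; exact: Eqh.
split.
- have [/= b1 b2] := HCS _ Qq; split.
    by rewrite -EqS; exact: le_trans CSC.
  have NS : (fun x' => cS B r phi (param (atlas i) x')) =
            (fun x' => cS D e z (param (atlas i) x')) by apply/funext.
  by move=> j; have [? b3] := b2 j; rewrite -NS; split => //; exact: le_trans CSC.
- have [b1 b2] := HCb _ Qq; split.
    by rewrite -Eqb//; exact: le_trans CbC.
  move=> j; have [b3 b4] := b2 j; split.
    exact: (@near_eq_derivable _ _ _ (fun x' => cb B i r phi (param (atlas i) x')) _ _ _ Nb b3).
  have E := near_eq_derive (delta_mx 0 j) Nb; rewrite -E; exact: le_trans b4 CbC.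
- have [b1 b2] := HCh _ Qq; split.
    by rewrite -Eqh//; exact: le_trans ChC.
  move=> j; have [b3 b4] := b2 j; split.
    exact: (@near_eq_derivable _ _ _ (fun x' => ch B i r phi (param (atlas i) x')) _ _ _ Nh b3).
  have E := near_eq_derive (delta_mx 0 j) Nh; rewrite -E; exact: le_trans b4 ChC.
- move=> v; have [/= pd b1] := HCp _ Qq; rewrite -Eqh//.
  by apply: le_trans (b1 v) _; rewrite ler_wpM2r// posdef_ge0.
- apply: le_trans CzC; apply: HCz => //.
  have := Bq; rewrite /blowup_domain/= polar_cos// polar_sin// => -[_ _ ? ?].
  by rewrite /param_domain/= e0.
Unshelve. all: by end_near. Qed.

(** Compactness of [Y]; the chart with good bounds near a point varies over a
    finite set and differs from the one provided by [chart_at] in general. *)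
Lemma chart_bounds_uniform rho : 0 < rho -> 2 * rho < e1 -> I (- (2 * rho)) ->
  I (2 * rho) -> exists2 C : R, 0 < C & forall y : Y,
    exists i, cdom (atlas i) y /\
     forall e z, 0 < e <= rho -> `|z| <= rho ->
       chart_bounds C i e z (coord (atlas i) y).
Proof.
move=> rho0 re1 Im Ip.
have := @compact_uniform_bound R Y [set: Y] (fun C y => 0 <= C /\ exists i, cdom (atlas i) y /\
     forall e z, 0 < e <= rho -> `|z| <= rho ->
       chart_bounds C i e z (coord (atlas i) y)) (@carrier_compact _ _ Y).
case=> [C C' y CC' [C0 [i [ci H]]]|y _|C C0 H].
- split; first exact: le_trans CC'.
  exists i; split => // e z er zr; have [[S1 S2] [b1 b2] [h1 h2] p1 z1] := H e z er zr.
  split; try (split; first exact: le_trans CC').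
  + by move=> j; have [? ?] := S2 j; split => //; exact: le_trans CC'.
  + by move=> j; have [? ?] := b2 j; split => //; exact: le_trans CC'.
  + by move=> j; have [? ?] := h2 j; split => //; exact: le_trans CC'.
  + move=> v; apply: le_trans (p1 v) _; rewrite ler_wpM2r//.
    have [->|v0] := eqVneq v 0; first by rewrite /bilin !mul0mx mxE.
    have := p1 v; have : 0 < `|v| ^+ 2 by rewrite exprn_gt0// normr_gt0.
    move=> /lt_le_trans/[apply] Cb; rewrite leNgt; apply/negP => bn.
    by move: Cb; rewrite ltNge mulr_ge0_le0// ltW.
  + exact: le_trans CC'.
- have [C HC] := chart_bounds_near rho0 re1 Im Ip y.
  exists C; apply: filterS HC => y' [i [ci H]] _; split; last by exists i.
  have re : 0 < rho <= rho by rewrite rho0/=.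
  have zr : `|0 : R| <= rho by rewrite normr0 ltW.
  by have [[S1 _] _ _ _ _] := H rho 0 re zr; apply: le_trans S1.
- by exists C => // y; have [] := H y Logic.I.
Qed.

End coefficients.

(** * The scaling function *)

(** On a vertical line [e > 0] all derivatives of [w e] are directional
    derivatives of a smooth extension of [w]. *)
Lemma scaling_smooth (R : realType) (w : R -> R -> R) (e z : R) :
  scaling_function w -> 0 < e -> exists2 r : R, 0 < r &
    forall (j : nat) (x : R), `|z - x| < r -> derivable (derive1n j (w e)) x 1.
Proof.
move=> [_ sw _ _ _] e0.
have A (x : R) : ([set p : R * R | 0 <= p.1] `\ (0, 0)) (e, x).
  by split => /=; [exact: ltW|case=> ee _; rewrite ee ltxx in e0].
have [U [F [oU Up sF Ff]]] := sw _ (A z).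
pose Fj := fix Fj j : R * R -> R := if j is i.+1 then 'D_(0, 1) (Fj i) else F.
have sFj j : smooth_open U (Fj j).
  by elim: j => [|j IHj] //= n; exact: ((IHj n.+1).2 (0, 1)).2.
have Dj j Z : U (e, Z) -> derivable (fun s => Fj j (e, s)) Z 1 /\
    derive1 (fun s => Fj j (e, s)) Z = Fj j.+1 (e, Z).
  move=> UZ; have [/(_ _ UZ) d _] := ((sFj j 1%N).2 (0, 1)).
  have E : (fun h : R => h^-1 *: ((Fj j \o shift (e, Z)) (h *: (0, 1)) - Fj j (e, Z))) =
     (fun h : R => h^-1 *: (((fun s => Fj j (e, s)) \o shift Z) (h *: 1) - Fj j (e, Z))).
    apply/funext => h /=; congr (_ *: (Fj j (_, _) - _)).
    by rewrite /= [h *: 0]mulr0 add0r.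
  split; first by move: d; rewrite /derivable E.
  by rewrite derive1E /derive /= -E.
have /nbhs_ballP[r /= r0 rU] : nbhs z [set s | U (e, s)].
  have : (fun s : R => (e, s)) @ z --> (e, z).
    exact: (@cvg_pair _ _ _ (nbhs z) (nbhs e) (nbhs z) _ _ _ (fun=> e) id (cvg_cst _) cvg_id).
  by apply; exact: open_nbhs_nbhs.
have nr (x : R) : `|z - x| < r -> \forall s \near x, `|z - s| < r.
  have cn : `|z - s| @[s --> x] --> `|z - x|.
    by apply: cvg_norm; apply: cvgB; [exact: cvg_cst|exact: cvg_id].
  by move=> xr; exact: (cvgr_lt `|z - x| cn r xr).
have fE j (x : R) : `|z - x| < r -> derive1n j (w e) x = Fj j (e, x).
  elim: j x => [|j IHj] x xr /=; first by rewrite (Ff (e, x)) //; exact: rU.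
  rewrite -[RHS]/(Fj j.+1 (e, x)) -(Dj j x (rU _ xr)).2 !derive1E.
  by apply: near_eq_derive => //; near=> s; apply: IHj; near: s; exact: nr.
exists r => // j x xr.
apply: (@near_eq_derivable _ _ _ (fun s => Fj j (e, s))) => //.
  by near=> s; rewrite fE//; near: s; exact: nr.
exact: (Dj j x (rU _ xr)).1.
Unshelve. all: by end_near. Qed.

Lemma scaling_derivable (R : realType) (w : R -> R -> R) (e z : R) :
  scaling_function w -> 0 < e -> derivable (w e) z 1.
Proof.
move=> hw e0; have [r r0 dr] := scaling_smooth z hw e0.
by apply: (dr 0%N); rewrite subrr normr0.
Qed.

Lemma scaling_gt0 (R : realType) (w : R -> R -> R) (e z : R) :
  scaling_function w -> 0 < e -> 0 < w e z.
Proof.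
move=> [_ _ pw _ _] e0; apply: (pw e z (ltW e0) _).1.
by case=> ee _; rewrite ee ltxx in e0.
Qed.

Section scaling.
Context {R : realType}.
Variable w : R -> R -> R.
Hypothesis hw : scaling_function w.
Let f := w 1.

Lemma scaling_homogeneous e z : 0 < e -> w e z = e * f (z / e).
Proof.
case: hw => _ _ _ _ hom e0; rewrite -hom// mulr1.
by rewrite mulrCA divff ?mulr1// gt_eqF.
Qed.

Lemma profile0 : f 0 = 1. Proof. by case: hw => _ _ _ [we _] _; exact: we ler01. Qed.

Lemma scaling_nondecreasing e z1 z2 : 0 < e -> 0 <= z1 -> z1 <= z2 -> w e z1 <= w e z2.
Proof.
move=> e0 z10 z12; have [_ _ sg _ _] := hw.
apply: (@ger0_derive1_ndecr _ (w e) 0 z2) => //.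
- by move=> x _; exact: scaling_derivable.
- move=> x /[!in_itv]/= /andP[x0 _].
  have en0 : (e, x) <> (0, 0) by case=> ee _; rewrite ee ltxx in e0.
  have [_] := sg e x (ltW e0) en0; rewrite (gtr0_sg x0) => /eqP.
  by rewrite sgr_cp0 => /ltW.
- apply: derivable_within_continuous => x _; exact: scaling_derivable.
Qed.

Lemma profile_derivable Z : derivable f Z 1. Proof. exact: scaling_derivable. Qed.

Lemma profile_continuous : continuous f.
Proof.
move=> Z; apply: differentiable_continuous; apply/derivable1_diffP.
exact: profile_derivable.
Qed.

Lemma profile_nondecreasing Z1 Z2 : 0 <= Z1 -> Z1 <= Z2 -> f Z1 <= f Z2.
Proof. exact: scaling_nondecreasing. Qed.

Lemma profile_ge1 Z : 0 <= Z -> 1 <= f Z.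
Proof. by move=> Z0; rewrite -profile0 profile_nondecreasing. Qed.

Lemma profile_gt1 Z : 0 < Z -> 1 < f Z.
Proof.
move=> Z0; rewrite -profile0; apply: (@gtr0_derive1_incr _ f 0 Z) => //.
- by move=> x _; exact: profile_derivable.
- move=> x /[!in_itv]/= /andP[x0 _]; have [_ _ sg _ _] := hw.
  have en0 : (1 : R, x) <> (0, 0) by case=> /eqP; rewrite oner_eq0.
  have [_] := sg 1 x ler01 en0; rewrite (gtr0_sg x0) => /eqP.
  by rewrite sgr_cp0.
- by apply: derivable_within_continuous => x _; exact: profile_derivable.
Qed.

(** As [E] tends to 0, [w E 1] tends to [w 0 1 = 1], so by homogeneity [w] exceeds
    a multiple of [z] where [e] is small compared with [z]; elsewhere [w >= e]
    suffices. *)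
Lemma scaling_lower : exists2 m : R, 0 < m & forall e z, 0 < e -> 0 <= z -> m * (e + z) <= w e z.
Proof.
have [_ sw _ [we wz] hom] := hw.
have A1 : ([set p : R * R | 0 <= p.1] `\ (0, 0)) (0, 1).
  by split => /=; [rewrite lexx|case=> /eqP; rewrite oner_eq0].
have [U [F [oU U1 sF Ff]]] := sw _ A1.
have cp : (E, 1 : R) @[E --> (0 : R)] --> (0 : R, 1 : R).
  exact: (@cvg_pair _ _ _ (nbhs (0 : R)) (nbhs (0 : R)) (nbhs (1 : R)) _ _ _ id (fun=> 1) cvg_id (cvg_cst _)).
have F1 : F (0, 1) = 1 by rewrite Ff//= wz normr1.
have NF : \forall E \near (0 : R), U (E, 1) /\ 1 / 2 <= F (E, 1).
  have cF : F (E, 1) @[E --> (0 : R)] --> F (0, 1).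
    by apply: (@continuous_comp _ _ _ (fun E : R => (E, 1 : R)) F); [exact: cp|exact: (sF 0%N).1].
  near=> E; split; first by near: E; apply: cp; exact: open_nbhs_nbhs.
  near: E; rewrite F1 in cF; apply: (cvgr_ge _ cF); rewrite ltr_pdivrMr//; lra.
have /nbhs_ballP[E0 /= E00 HE] := NF.
pose m := Num.min (1 / 2) E0 / 2.
have m0 : 0 < m by rewrite divr_gt0// lt_min E00 divr_gt0.
have m1 : m <= 1 / 4.
  by rewrite ler_pdivrMr// ge_min; apply/orP; left; lra.
exists m => // e z e0 z0.
have we' : e <= w e z by rewrite -[leLHS](we e (ltW e0)) scaling_nondecreasing.
have wz' : 2 * m * z <= w e z.
  have [zE|zE] := leP (E0 * z) e.
    apply: le_trans we'; apply: le_trans zE; rewrite ler_wpM2r// /m mulrC divfK//.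
    by rewrite ge_min lexx orbT.
  have zp : 0 < z.
    by rewrite lt_neqAle z0 andbT; apply/eqP => z00; move: zE; rewrite -z00 mulr0 ltNge ltW.
  have -> : w e z = z * w (e / z) 1.
    by rewrite -hom ?divr_ge0// ?(ltW e0)// mulr1 mulrC divfK// gt_eqF.
  rewrite mulrC ler_wpM2l//.
  have B : ball (0 : R) E0 (e / z).
    rewrite -ball_normE/= sub0r normrN ger0_norm ?divr_ge0 ?ltW//.
    by rewrite ltr_pdivrMr.
  have [UE FE] := HE _ B.
  rewrite Ff// in FE; last first.
    by split => /=; [rewrite divr_ge0 ?ltW|case=> _ /eqP; rewrite oner_eq0].
  by apply: le_trans FE => /=; lra.
rewrite mulrDr; have : m * e <= 1 / 4 * e by rewrite ler_wpM2r// ltW.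
lra.
Unshelve. all: by end_near. Qed.

Lemma scaling_small eta : 0 < eta -> exists2 r : R, 0 < r &
  forall e z, 0 < e < r -> `|z| < r -> w e z < eta.
Proof.
move=> eta0; have [cw _ _ [we wz] _] := hw.
have A0 : [set p : R * R | 0 <= p.1] (0, 0) by rewrite /= lexx.
move/subspace_continuousP : cw => /(_ (0, 0) A0)/cvgrPdist_lt/(_ _ eta0); rewrite near_withinE => /nbhs_ballP[r /= r0 H].
exists r => // e z /andP[e0 er] zr.
have B : ball ((0, 0) : R * R) r (e, z).
  by split; rewrite /= -ball_normE/= sub0r normrN// gtr0_norm.
have := H _ B (ltW e0); rewrite -[X in X < _ -> _]/(`|w 0 0 - w e z|) we ?lexx// sub0r normrN.
by apply: le_lt_trans; exact: ler_norm.
Qed.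

End scaling.

(** * Geodesics of the degenerating metric *)

Section chart_curve.
Context {R : realType} {d : nat} {Y : closedManifold R d}.

Lemma curve_derivative (i : chart_index Y) (z : R -> R) (y : R -> Y) (t : R) :
  derivable (curve_in i z y) t 1 ->
  [/\ derivable z t 1, lsubmx (derive1 (curve_in i z y) t) 0 0 = derive1 z t &
   rsubmx (derive1 (curve_in i z y) t) = derive1 (fun s => coord (atlas i) (y s)) t].
Proof.
move=> dc; have := derivableP dc; rewrite -derive1E => /is_derive_mxP H.
have Hz : is_derive t 1 z (derive1 (curve_in i z y) t 0 (lshift d 0)).
  have E : (fun s => curve_in i z y s 0 (lshift d 0)) = z.
    by apply/funext => s; rewrite /curve_in row_mxEl mxE eqxx.
  by rewrite -[X in is_derive _ _ X _]E.
split.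
- by case: Hz.
- by rewrite mxE [RHS]derive1E; case: Hz => _ ->.
- apply/rowP => j; rewrite mxE.
  have : is_derive t 1 (fun s => coord (atlas i) (y s))
      (rsubmx (derive1 (curve_in i z y) t)).
    apply/is_derive_mxP => a b; rewrite ord1 mxE.
    rewrite (_ : (fun _ => _) = (fun s => curve_in i z y s 0 (rshift 1 b))); first exact: H.
    by apply/funext => s; rewrite /curve_in row_mxEr.
  by rewrite [in RHS]derive1E; case=> _ ->; rewrite mxE.
Qed.

Lemma curve_split (i : chart_index Y) (z : R -> R) (y : R -> Y) (t : R) :
  (lsubmx (curve_in i z y t) 0 0 = z t) *
  (rsubmx (curve_in i z y t) = coord (atlas i) (y t)).
Proof.
by rewrite /curve_in row_mxKl row_mxKr mxE eqxx.
Qed.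

End chart_curve.

Section lateral.
Context {R : realType} {d : nat} {Y : closedManifold R d}.
Variables (D : coeffs Y).

(** The square of the length of [b] with respect to [h], computed in one chart. *)
Definition lateral_in (i : chart_index Y) (e z : R) (y : Y) : R :=
  bilin (invmx (ch D i e z y)) (cb D i e z y) (cb D i e z y).

Definition lateral (e z : R) (y : Y) : R := lateral_in (chart_at y) e z y.

Lemma lateral_chart i j e z y :
  is_one_form (fun i => cb D i e z) -> is_metric (fun i => ch D i e z) ->
  cdom (atlas i) y -> cdom (atlas j) y ->
  lateral_in i e z y = lateral_in j e z y.
Proof.
move=> ob [mh ph] ci cj.
have uhi := posdef_unit (ph i y ci); have uhj := posdef_unit (ph j y cj).
have bE := ob i j y ci cj; have hE := mh i j y ci cj.
rewrite /lateral_in bE hE.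
set J := jac i j y in bE hE *.
have uJ : J \in unitmx.
  by move: uhi; rewrite hE !unitmx_mul => /andP[/andP[]].
have uJT : J^T \in unitmx by rewrite unitmx_tr.
have -> : invmx (J *m ch D j e z y *m J^T) =
    invmx J^T *m invmx (ch D j e z y) *m invmx J.
  apply: (can_inj (mulmxK (_ : J *m ch D j e z y *m J^T \in unitmx))).
    by rewrite !unitmx_mul uJ uhj uJT.
  rewrite mulVmx ?unitmx_mul ?uJ ?uhj ?uJT// !mulmxA mulmxKV//.
  by rewrite mulmxKV// mulVmx.
by rewrite /bilin !mulmxA trmx_mul trmxK mulmxK// !mulmxA mulmxKV.
Qed.

End lateral.

Section geodesic_facts.
Context {R : realType} {d : nat} {Y : closedManifold R d}.
Variables (k kappa : nat) (w : R -> R -> R) (I : set R) (e1 : R) (D : coeffs Y).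
Hypotheses (hkappa : (k <= kappa)%N) (hw : scaling_function w).
Hypotheses (oI : open I) (hD : regular_coeffs e1 I D).
Hypothesis hg : forall e z, param_domain e1 I (e, z) ->
  forall (i : chart_index Y) (y : Y), cdom (atlas i) y ->
    posdef (gmat k kappa w D e i z y).
Variables (rho C : R).
Hypothesis C0 : 0 < C.
Hypothesis HB : forall y : Y, exists i, cdom (atlas i) y /\
  forall e z, 0 < e <= rho -> `|z| <= rho ->
    chart_bounds D C i e z (coord (atlas i) y).

Let dR : R := d%:R.
Definition bound_cst : R := 1 + C + dR * C + (d ^ 2)%:R * C + dR * C ^+ 2 + dR ^+ 2 * C ^+ 3.
Let M := bound_cst.

(** The coefficient of the squared vertical speed after completing the square. *)
Definition radial_coef (e z : R) (y : Y) : R :=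
  1 - w e z ^+ kappa * cS D e z y - w e z ^+ (2 * k) * lateral D e z y.

Lemma bound_cst_ge : [/\ 1 <= M, C <= M, dR * C <= M, (d ^ 2)%:R * C <= M &
  dR * C ^+ 2 <= M /\ dR ^+ 2 * C ^+ 3 <= M].
Proof.
have d0 : 0 <= dR by rewrite ler0n.
have := mulr_ge0 d0 (ltW C0).
have : 0 <= (d ^ 2)%:R * C by rewrite mulr_ge0// ltW.
have : 0 <= dR * C ^+ 2 by rewrite mulr_ge0// sqr_ge0.
have : 0 <= dR ^+ 2 * C ^+ 3 by rewrite mulr_ge0// ?sqr_ge0// exprn_ge0// ltW.
by move=> h1 h2 h3 h4; rewrite /M /bound_cst; move: C0 => c0; split; [| | | |split]; lra.
Qed.

Section fixed_geodesic.
Variables (e T del : R) (z : R -> R) (y : R -> Y).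
Hypotheses (e0 : 0 < e) (ee1 : e < e1).
Hypothesis geo : forall t, - del < t < T + del ->
    [/\ I (z t), {for t, continuous y} &
        forall i : chart_index Y, cdom (atlas i) (y t) ->
          let c := curve_in i z y in
          let G := gcoord k kappa w D e i in
          [/\ derivable c t 1,
              derivable (derive1 c) t 1,
              (forall j : 'I_(1 + d),
                 derive1 (derive1 c) t 0 j +
                 \sum_(a < 1 + d) \sum_(b < 1 + d)
                   christoffel G (c t) j a b * derive1 c t 0 a * derive1 c t 0 b = 0) &
              gnorm (G (c t)) (derive1 c t) = 1]].

(** The square of the momentum conjugate to the coordinates of [Y], see
    [angular_square_momentum], expressed through the height by unit speed so that
    no chart is involved. *)
Definition angular_square (t : R) : R :=
  w e (z t) ^+ (2 * k) * (1 - radial_coef e (z t) (y t) * (derive1 z t) ^+ 2).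
Let N := angular_square.

Let Sc i (z : R) (x : 'rV[R]_d) := cS D e z (param (atlas i) x).
Let bc i (z : R) (x : 'rV[R]_d) := cb D i e z (param (atlas i) x).
Let hc i (z : R) (x : 'rV[R]_d) := ch D i e z (param (atlas i) x).

Lemma gcoordE i : gcoord k kappa w D e i = metric_mx k kappa (w e) (Sc i) (bc i) (hc i).
Proof. by []. Qed.

Lemma geo_domain t : - del < t < T + del -> param_domain e1 I (e, z t).
Proof. by move=> /geo[Iz _ _]; split => //=; rewrite e0. Qed.

Lemma w_gt0 s : 0 < w e s. Proof. exact: scaling_gt0. Qed.

Lemma metric_h i t : - del < t < T + del -> cdom (atlas i) (y t) ->
  posdef (ch D i e (z t) (y t)).
Proof.
move=> /geo_domain pd ci; have [cD _ _] := hD.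
by have [_ [_ p]] := cD _ pd; exact: p.
Qed.

Lemma unit_speed i t : - del < t < T + del -> cdom (atlas i) (y t) ->
  bilin (gcoord k kappa w D e i (curve_in i z y t)) (derive1 (curve_in i z y) t)
    (derive1 (curve_in i z y) t) = 1.
Proof.
move=> ht ci; have [_ _ /(_ i ci)[_ _ _ g1]] := geo ht.
have pG : posdef (gcoord k kappa w D e i (curve_in i z y t)).
  rewrite /gcoord curve_split curve_split (coordP ci).2.
  by apply: hg ci; exact: geo_domain.
by rewrite -sqr_gnorm// g1 expr1n.
Qed.

Lemma lateral_in_chart i t : - del < t < T + del -> cdom (atlas i) (y t) ->
  lateral D e (z t) (y t) = lateral_in D i e (z t) (y t).
Proof.
move=> ht ci; have [cD _ _] := hD; have [ob mt] := cD _ (geo_domain ht).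
by apply: lateral_chart => //; exact: chart_atP.
Qed.

Lemma hcE i t : cdom (atlas i) (y t) -> hc i (z t) (coord (atlas i) (y t)) = ch D i e (z t) (y t).
Proof. by move=> ci; rewrite /hc (coordP ci).2. Qed.

Lemma bcE i t : cdom (atlas i) (y t) -> bc i (z t) (coord (atlas i) (y t)) = cb D i e (z t) (y t).
Proof. by move=> ci; rewrite /bc (coordP ci).2. Qed.

Lemma ScE i t : cdom (atlas i) (y t) -> Sc i (z t) (coord (atlas i) (y t)) = cS D e (z t) (y t).
Proof. by move=> ci; rewrite /Sc (coordP ci).2. Qed.

Let uu i t := lifted_velocity (bc i) (hc i) (curve_in i z y) t.

Lemma unit_speed_radial i t : - del < t < T + del -> cdom (atlas i) (y t) ->
  radial_coef e (z t) (y t) * (derive1 z t) ^+ 2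
   + w e (z t) ^+ (2 * k) * bilin (ch D i e (z t) (y t)) (uu i t) (uu i t) = 1.
Proof.
move=> ht ci; have [_ _ /(_ i ci)[dc _ _ _]] := geo ht.
have [_ Ez _] := curve_derivative dc.
have := unit_speed ht ci; rewrite gcoordE.
have ph : posdef (hc i (lsubmx (curve_in i z y t) 0 0) (rsubmx (curve_in i z y t))).
  by rewrite !curve_split hcE//; exact: metric_h.
rewrite (unit_speed_split k kappa (w e) (Sc i) (bc i) ph) Ez !curve_split hcE// bcE// ScE//.
by rewrite /radial_coef (lateral_in_chart ht ci) /lateral_in.
Qed.

Lemma angular_square_chart i t : - del < t < T + del -> cdom (atlas i) (y t) ->
  N t = w e (z t) ^+ (2 * k) ^+ 2 * bilin (ch D i e (z t) (y t)) (uu i t) (uu i t).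
Proof.
move=> ht ci; have := unit_speed_radial ht ci; rewrite /N /angular_square.
set W := w e (z t) ^+ (2 * k); set X := bilin _ _ _; set A := _ * _ ^+ 2.
move=> H; have -> : 1 - A = W * X by rewrite -H addrAC subrr add0r.
by rewrite expr2 mulrA.
Qed.

Lemma angular_square_momentum i t : - del < t < T + del -> cdom (atlas i) (y t) ->
  N t = let c := curve_in i z y in
    let p := momentum k kappa (w e) (Sc i) (bc i) (hc i) (c t) (derive1 c t) in
    bilin (invmx (hc i (lsubmx (c t) 0 0) (rsubmx (c t)))) p p.
Proof.
move=> ht ci; rewrite (angular_square_chart ht ci).
have ph : posdef (hc i (lsubmx (curve_in i z y t) 0 0) (rsubmx (curve_in i z y t))).
  by rewrite !curve_split hcE//; exact: metric_h.
by rewrite /= (momentum_square k kappa (w e) (Sc i) (bc i) ph) !curve_split hcE.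
Qed.

Lemma angular_square_ge0 t : - del < t < T + del -> 0 <= N t.
Proof.
move=> ht; rewrite (angular_square_chart ht (chart_atP (y t))).
by rewrite mulr_ge0 ?sqr_ge0// posdef_ge0//; exact: metric_h (chart_atP _).
Qed.

Lemma unit_speed_angular t : - del < t < T + del ->
  radial_coef e (z t) (y t) * (derive1 z t) ^+ 2 + N t / w e (z t) ^+ (2 * k) = 1.
Proof.
move=> ht; rewrite /N /angular_square mulrC; rewrite [X in _ + X]mulrAC divff ?mul1r; first by ring.
by rewrite gt_eqF// exprn_gt0// w_gt0.
Qed.

Lemma near_chart i t : - del < t < T + del -> cdom (atlas i) (y t) ->
  \forall s \near t, - del < s < T + del /\ cdom (atlas i) (y s).
Proof.
move=> ht ci; have [_ cy _] := geo ht; near=> s; split.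
  apply/andP; split; near: s.
    by apply: lt_nbhsr; case/andP: ht.
  by apply: lt_nbhsl; case/andP: ht.
near: s; apply: cy; apply: open_nbhs_nbhs; split => //; exact: cdom_open.
Unshelve. all: by end_near. Qed.

Lemma height_C2 t : - del < t < T + del ->
  derivable z t 1 /\ derivable (derive1 z) t 1.
Proof.
move=> ht; have ci := chart_atP (y t); set i := chart_at (y t) in ci.
have [_ _ /(_ i ci)[dc dc' _ _]] := geo ht.
have [dz _ _] := curve_derivative dc; split; first exact: dz.
apply: (@near_eq_derivable _ _ _ (fun s => derive1 (curve_in i z y) s 0 (lshift d 0))).
  apply: filterS (near_chart ht ci) => s [hs cs].
  have [_ _ /(_ i cs)[dcs _ _ _]] := geo hs.
  by have [_ <- _] := curve_derivative dcs; rewrite mxE.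
have /derivable_mxP H := dc'; exact: (H 0 (lshift d 0)).
Qed.

Let beta i t := cb D i e (z t) (y t) *m invmx (ch D i e (z t) (y t)).

Lemma lateral_beta i t : - del < t < T + del -> cdom (atlas i) (y t) ->
  lateral D e (z t) (y t) = bilin (ch D i e (z t) (y t)) (beta i t) (beta i t) /\
  lateral D e (z t) (y t) = (cb D i e (z t) (y t) *m (beta i t)^T) 0 0.
Proof.
move=> ht ci; have ph := metric_h ht ci; have uh := posdef_unit ph.
have [hs _] := ph; rewrite (lateral_in_chart ht ci) /lateral_in /bilin /beta.
by rewrite mulmxKV// trmx_mul trmx_inv hs mulmxA.
Qed.

(** Coercivity gives [|beta|^2 <= C h (beta, beta) = C (b beta^T)], whose right
    side is linear in [beta]; this bounds [beta] and then the length of [b]. *)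
Lemma good_chart t : - del < t < T + del -> e <= rho -> `|z t| <= rho ->
  exists i, [/\ cdom (atlas i) (y t),
     chart_bounds D C i e (z t) (coord (atlas i) (y t)), `|beta i t| <= M &
     0 <= lateral D e (z t) (y t) <= M].
Proof.
move=> ht er zr; have [i [ci H]] := HB (y t).
have [M1 MC MdC Md2C [MdC2 Md2C3]] := bound_cst_ge.
have cB : chart_bounds D C i e (z t) (coord (atlas i) (y t)).
  by apply: H; rewrite ?e0.
exists i; have [_ [bC _] _ pC _] := cB; rewrite (coordP ci).2 in bC pC.
have ph := metric_h ht ci.
have [lE1 lE2] := lateral_beta ht ci.
set be := beta i t in lE1 lE2 *.
have lb : `|lateral D e (z t) (y t)| <= dR * C * `|be|.
  rewrite lE2 mxE (le_trans (ler_norm_sum _ _ _))//.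
  rewrite (@le_trans _ _ (\sum_(j < d) C * `|be|))//.
    apply: ler_sum => j _; rewrite normrM mxE ler_pM ?norm_entry//.
    exact: le_trans (norm_entry _ _ _) bC.
  by rewrite sumr_const card_ord -mulr_natl mulrA.
have beC : `|be| <= dR * C ^+ 2.
  have [->|be0] := eqVneq be 0; first by rewrite normr0 mulr_ge0 ?sqr_ge0// ler0n.
  have nb : 0 < `|be| by rewrite normr_gt0.
  rewrite -(ler_pM2r nb) -expr2 (le_trans (pC be))//.
  rewrite -lE1 (_ : _ * _ * _ = C * (dR * C * `|be|)); last by ring.
  by rewrite ler_pM2l// (le_trans (ler_norm _)).
split => //; first exact: le_trans MdC2.
rewrite {1}lE1 posdef_ge0//= (le_trans (ler_norm _))// (le_trans lb)//.
apply: le_trans Md2C3.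
rewrite (_ : dR ^+ 2 * C ^+ 3 = dR * C * (dR * C ^+ 2)); last by ring.
by rewrite ler_wpM2l// mulr_ge0 ?ler0n// ltW.
Qed.

(** Both corrections carry at least the factor [w^k], because [w <= 1]. *)
Lemma radial_coef_bound t : - del < t < T + del -> e <= rho -> `|z t| <= rho ->
  w e (z t) <= 1 -> `|radial_coef e (z t) (y t) - 1| <= 2 * M * w e (z t) ^+ k.
Proof.
move=> ht er zr w1; have [i [ci cB _ /andP[l0 lM]]] := good_chart ht er zr.
have [M1 MC _ _ _] := bound_cst_ge.
have w0 := ltW (w_gt0 (z t)).
have [[SC _] _ _ _ _] := cB; rewrite (coordP ci).2 in SC.
rewrite /radial_coef (_ : forall a b : R, 1 - a - b - 1 = - (a + b)); last by move=> *; ring.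
rewrite normrN.
rewrite (le_trans (ler_normD _ _))// mulr_natl mulr2n mulrDl lerD//.
  rewrite normrM mulrC ler_pM//; first exact: le_trans MC.
  by rewrite normrX ger0_norm// ler_wiXn2l.
rewrite normrM mulrC ler_pM//; first by rewrite ger0_norm.
by rewrite normrX ger0_norm// ler_wiXn2l// mul2n -addnn leq_addr.
Qed.

(** The velocity along [Y] and the lifted velocity differ by [z' b h^-1], whose
    length is controlled; the lifted velocity has length [sqrt N / w^(2k)]. *)
Lemma angular_speed_bound t : - del < t < T + del -> e <= rho -> `|z t| <= rho ->
  `|angular_speed D e z y t - Num.sqrt (N t) / w e (z t) ^+ (2 * k)|
    <= M * `|derive1 z t|.
Proof.
move=> ht er zr; have [_ [_ _ _ /andP[l0 lM]]] := good_chart ht er zr.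
have [M1 _ _ _ _] := bound_cst_ge.
have ci := chart_atP (y t); set i := chart_at (y t) in ci.
have ph := metric_h ht ci; have [lE _] := lateral_beta ht ci.
have [_ _ /(_ i ci)[dc _ _ _]] := geo ht.
have [_ Ez Ey] := curve_derivative dc.
have W0 : 0 < w e (z t) ^+ (2 * k) by rewrite exprn_gt0// w_gt0.
have -> : Num.sqrt (N t) / w e (z t) ^+ (2 * k) = gnorm (ch D i e (z t) (y t)) (uu i t).
  rewrite (angular_square_chart ht ci) sqrtrM ?sqr_ge0// sqrtr_sqr gtr0_norm//.
  by rewrite mulrAC divff ?mul1r// gt_eqF.
have -> : angular_speed D e z y t = gnorm (ch D i e (z t) (y t))
    (uu i t - derive1 z t *: beta i t).
  rewrite /angular_speed -/i -Ey /uu /lifted_velocity Ez !curve_split hcE// bcE//.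
  by rewrite addrK.
apply: le_trans (gnormB_dist _ _ ph) _.
rewrite gnormZ mulrC ler_wpM2r// /Defs.gnorm -lE.
rewrite (@le_trans _ _ (Num.sqrt (M ^+ 2)))//.
  by rewrite ler_wsqrtr// (le_trans lM)// expr2 ler_peMl// (le_trans _ M1).
by rewrite sqrtr_sqr ger0_norm// (le_trans _ M1).
Qed.

Definition rate_cst : R := ((8 * d)%:R + 1) * M ^+ 4.

(** As [N] does not depend on the chart, its derivative may be computed in one
    where the coefficients have uniform bounds. *)
Lemma angular_square_rate t : - del < t < T + del -> e <= rho -> `|z t| <= rho ->
  w e (z t) <= 1 -> `|derive1 z t| <= 2 ->
  derivable N t 1 /\
  `|derive1 N t| <= rate_cst * (`|derive1 z t| *
     (N t + w e (z t) ^+ k * Num.sqrt (N t))).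
Proof.
move=> ht er zr w1 zt2; have [i [ci cB beM _]] := good_chart ht er zr.
have [M1 MC MdC Md2C _] := bound_cst_ge.
have ph := metric_h ht ci; have uh := posdef_unit ph.
have [_ _ /(_ i ci)[dc dc' ge _]] := geo ht.
have [_ Ez Ey] := curve_derivative dc.
have cx := (coordP ci).1; have px := (coordP ci).2.
set c := curve_in i z y in dc dc' ge Ez Ey *.
have [_ [B [_ sB BD _ _]] _] := hD.
have [_ sb sh] := sB i.
have [Iz _ _] := geo ht.
have e01 : 0 < e < e1 by rewrite e0.
have zE : lsubmx (c t) 0 0 = z t by rewrite curve_split.
have xE : rsubmx (c t) = coord (atlas i) (y t) by rewrite curve_split.
have [[SC SjC] [bC bjC] [hC hjC] pC HzC] := cB.
have db m : differentiable (fun q : 'rV[R]_(1 + d) => bc i (lsubmx q 0 0) (rsubmx q) 0 m) (c t).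
  apply: (@differentiable_blowup_entry R d Y I e1 oI i 1 d (cb B i) (cb D i) e (c t) 0 m sb) => //.
  - by move=> r phi y' bd rc cy; have [_ -> //] := BD r phi y' bd rc.
  - by rewrite zE.
  - by rewrite xE.
have dh m n : differentiable (fun q : 'rV[R]_(1 + d) => hc i (lsubmx q 0 0) (rsubmx q) m n) (c t).
  apply: (@differentiable_blowup_entry R d Y I e1 oI i d d (ch B i) (ch D i) e (c t) m n sh) => //.
  - by move=> r phi y' bd rc cy; have [_ _ -> //] := BD r phi y' bd rc.
  - by rewrite zE.
  - by rewrite xE.
have uG : metric_mx k kappa (w e) (Sc i) (bc i) (hc i) (c t) \in unitmx.
  apply: posdef_unit; rewrite -gcoordE /gcoord zE xE px.
  by apply: hg ci; exact: geo_domain.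
have dw : derivable (w e) (lsubmx (c t) 0 0) 1 by exact: scaling_derivable.
have dS j : derivable (Sc i (lsubmx (c t) 0 0)) (rsubmx (c t)) (delta_mx 0 j).
  by rewrite zE xE; exact: (SjC j).1.
have dbx j : derivable (bc i (lsubmx (c t) 0 0)) (rsubmx (c t)) (delta_mx 0 j).
  by rewrite zE xE; exact: (bjC j).1.
have dhx j : derivable (hc i (lsubmx (c t) 0 0)) (rsubmx (c t)) (delta_mx 0 j).
  by rewrite zE xE; exact: (hjC j).1.
have ph' : posdef (hc i (lsubmx (c t) 0 0) (rsubmx (c t))) by rewrite zE xE hcE.
have HN := derive_momentum_square dc dc' ge uG dw db dh dS dbx dhx ph'.
have nN : \forall s \near t, bilin (invmx (hc i (lsubmx (c s) 0 0) (rsubmx (c s))))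
    (momentum k kappa (w e) (Sc i) (bc i) (hc i) (c s) (derive1 c s))
    (momentum k kappa (w e) (Sc i) (bc i) (hc i) (c s) (derive1 c s)) = N s.
  by apply: filterS (near_chart ht ci) => s [hs cs]; rewrite (angular_square_momentum hs cs).
have {nN}HN := near_eq_is_derive nN HN.
rewrite zE xE Ez Ey -/(uu i t) in HN.
have [dN NE] := HN; split => //; rewrite derive1E NE.
have Nge := angular_square_ge0 ht.
have w0 := ltW (w_gt0 (z t)).
have wk1 : 0 <= w e (z t) ^+ k by rewrite exprn_ge0.
have s2 : Num.sqrt (N t) ^+ 2 = N t by rewrite sqr_sqrtr.
rewrite -[X in X + _ * Num.sqrt _]s2.
apply: momentum_rate_bound => //.
- rewrite exprn_ge0//= ler_wiXn2l// mul2n -addnn leq_addr//.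
- by rewrite exprn_ge0//= ler_wiXn2l.
- have M0 : 0 <= M by exact: le_trans M1.
  rewrite -[leRHS]ger0_norm ?mulr_ge0 ?sqrtr_ge0// -sqrtr_sqr exprMn s2.
  rewrite -[leLHS]ger0_norm ?mulr_ge0 ?exprn_ge0// -sqrtr_sqr ler_wsqrtr//.
  rewrite exprMn (angular_square_chart ht ci) [leRHS]mulrCA; apply: ler_wpM2l; first exact: sqr_ge0.
  apply: le_trans (pC (uu i t)) _; rewrite px ler_wpM2r ?posdef_ge0//.
  by rewrite (le_trans MC)// expr2 ler_peMl.
- exact: beM.
- by rewrite /uu /lifted_velocity Ez Ey zE xE hcE// bcE// addrK.
- by move=> j; exact: le_trans (SjC j).2 MC.
- move=> j v; rewrite mxE (le_trans (ler_norm_sum _ _ _))//.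
  apply: (@le_trans _ _ (\sum_(j < d) C * `|v|)).
    apply: ler_sum => a _; rewrite normrM [v^T a 0]mxE; apply: ler_pM => //; last exact: norm_entry.
    by apply: le_trans (norm_entry _ _ _) (bjC j).2.
  rewrite sumr_const card_ord -mulr_natl mulrA.
  by apply: ler_wpM2r.
- move=> j v v'; apply: le_trans (bilin_bound _ _ _) _.
  do 2 apply: ler_wpM2r => //.
  exact: le_trans (ler_wpM2l (ler0n R (d ^ 2)) (hjC j).2) Md2C.
- move=> v; apply: le_trans (bilin_bound _ _ _) _.
  do 2 apply: ler_wpM2r => //.
  exact: le_trans (ler_wpM2l (ler0n R (d ^ 2)) HzC) Md2C.
Qed.

(** At the waist [w = e], and the orthogonal projection of the velocity to the
    waist, of length [cos phi], is the lifted velocity. *)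
Lemma impact_angular_square phi : - del < 0 < T + del -> z 0 = 0 ->
  impact_angle k kappa w D e z y phi -> N 0 = (e ^+ k * cos phi) ^+ 2.
Proof.
move=> ht z0 [_ [u' [uorth unorm]]].
have ci := chart_atP (y 0); set i := chart_at (y 0) in ci uorth unorm.
have ph := metric_h ht ci; have uh := posdef_unit ph; have [hs _] := ph.
have [_ _ /(_ i ci)[dc _ _ g1]] := geo ht.
have [_ Ez Ey] := curve_derivative dc.
have px := (coordP ci).2.
have we0 : w e 0 = e by case: hw => _ _ _ [we _] _; rewrite we// ltW.
set v := derive1 (curve_in i z y) 0 in Ez Ey g1.
have GE : gmat k kappa w D e i (z 0) (y 0) = gcoord k kappa w D e i (curve_in i z y 0).
  by rewrite /gcoord !curve_split px.
set G := gmat _ _ _ _ _ _ _ _ in uorth unorm GE.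
have pG : posdef G by apply: hg ci; exact: geo_domain.
have W0 : 0 < w e (z 0) ^+ (2 * k) by rewrite exprn_gt0// w_gt0.
have vE : v = row_mx (derive1 z 0)%:M (rsubmx v).
  rewrite -[LHS]hsubmxK; congr (row_mx _ _).
  by rewrite [LHS]mx11_scalar Ez.
(* orthogonality to the waist is a linear equation for u' with the invertible matrix h *)
have uE : u' = uu i 0.
  have H (x' : 'rV[R]_d) : (derive1 z 0 *: cb D i e (z 0) (y 0) + (rsubmx v - u') *m ch D i e (z 0) (y 0)) *m x'^T = 0.
    have := uorth x'; rewrite -/(velocity i z y 0).
    rewrite [velocity i z y 0]vE /G /gmat /bilin.
    have -> : row_mx (derive1 z 0)%:M (rsubmx v) - row_mx 0 u' = row_mx (derive1 z 0)%:M (rsubmx v - u').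
      by rewrite opp_row_mx add_row_mx oppr0 addr0.
    rewrite mul_row_block tr_row_mx mul_row_col trmx0 mulmx0 add0r.
    rewrite mul_scalar_mx scalerA mulrC -scalerA -scalemxAr -scalerDr -scalemxAl mxE.
    move=> /eqP; rewrite mulf_eq0 gt_eqF//= => /eqP H.
    by apply/matrixP => a b; rewrite !ord1 H mxE.
  have H0 : derive1 z 0 *: cb D i e (z 0) (y 0) + (rsubmx v - u') *m ch D i e (z 0) (y 0) = 0.
    apply/rowP => j; have /matrixP/(_ 0 0) := H (delta_mx 0 j).
    by rewrite trmx_delta -colE mxE [RHS]mxE => ->; rewrite mxE.
  rewrite /uu /lifted_velocity Ez !curve_split hcE// bcE//.
  have /(congr1 (fun X => X *m invmx (ch D i e (z 0) (y 0)))) := H0.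
  rewrite mul0mx mulmxDl mulmxK// -scalemxAl => /eqP.
  by rewrite addrA subr_eq0 addrC => /eqP <-.
have gv : gnorm G v = 1 by rewrite GE.
have : gnorm G (row_mx 0 u') ^+ 2 = cos phi ^+ 2.
  by rewrite unorm -/(velocity i z y 0) -[velocity i z y 0]/v gv mul1r.
rewrite sqr_gnorm// /G /gmat /bilin mul_row_block !mul0mx !add0r tr_row_mx mul_row_col trmx0 mulmx0 add0r.
rewrite -scalemxAr -scalemxAl mxE -[(_ *m _) 0 0]/(bilin _ u' u') uE => HW.
rewrite (angular_square_chart ht ci) expr2 -mulrA HW z0 we0 exprMn.
by rewrite -exprM mulnC.
Qed.

End fixed_geodesic.
End geodesic_facts.

(** * Integrals and a Gronwall inequality *)

Lemma FTC2_within (R : realType) (f F : R -> R) (a b : R) : a < b ->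
  {within `[a, b], continuous f} -> {within `[a, b], continuous F} ->
  (forall x, a < x < b -> is_derive x 1 F (f x)) ->
  (\int[mu]_(x in `[a, b]) (f x)%:E = (F b - F a)%:E)%E.
Proof.
move=> ab cf cF dF; rewrite EFinB; apply: continuous_FTC2 => //.
  have /continuous_within_itvP := cF; move=> /(_ ab)[_ h1 h2].
  by split => // x /[!in_itv]/= /dF[].
by move=> x /[!in_itv]/= /dF[_ <-]; rewrite derive1E.
Qed.

(** The integral of a nonnegative function, measurable or not, is a supremum over
    the simple functions below it. *)
Lemma integral_le_nonmeasurable (R : realType) d (T : measurableType d)
    (m : {measure set T -> \bar R}) (D : set T) (f g : T -> \bar R) :
  (forall x, D x -> 0 <= f x)%E -> (forall x, D x -> f x <= g x)%E ->
  (\int[m]_(x in D) f x <= \int[m]_(x in D) g x)%E.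
Proof.
move=> f0 fg; have g0 x : D x -> (0 <= g x)%E.
  by move=> Dx; apply: le_trans (fg x Dx); exact: f0.
rewrite !ge0_integralE//; apply: ge_ereal_sup => _ [h hf <-].
apply: ereal_sup_ubound; exists h => // x; apply: (le_trans (hf x)).
exact: lee_restrict.
Qed.

(** By [integral_le_nonmeasurable], the integral of [sp] lies between those of
    [dm - dE] and [dm + dE].  The integrand in view is the angular speed, which is
    put together from different charts at different times. *)
Lemma integral_sandwich (R : realType) (sp m E dm dE : R -> R) (T : R) :
  0 < T ->
  {within `[0, T], continuous dm} -> {within `[0, T], continuous m} ->
  (forall x, 0 < x < T -> is_derive x 1 m (dm x)) ->
  {within `[0, T], continuous dE} -> {within `[0, T], continuous E} ->
  (forall x, 0 < x < T -> is_derive x 1 E (dE x)) ->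
  (forall t, 0 <= t <= T -> 0 <= sp t /\ `|sp t - dm t| <= dE t) ->
  `|\int[mu]_(t in `[0, T]) sp t - (m T - m 0)| <= E T - E 0.
Proof.
move=> T0 cdm cm dmE cdE cE dEE spE.
pose U t := dm t + dE t; pose L t := dm t - dE t.
have inT t : `[0, T]%classic t -> 0 <= t <= T by rewrite /= in_itv.
have cU : {within `[0, T], continuous U} by move=> x; apply: cvgD; [exact: cdm|exact: cdE].
have cL : {within `[0, T], continuous L} by move=> x; apply: cvgB; [exact: cdm|exact: cdE].
have IU : (\int[mu]_(t in `[0%R, T]) (U t)%:E = ((m T + E T) - (m 0%R + E 0%R))%R%:E)%E.
  apply: (@FTC2_within _ _ (fun t => m t + E t)) => //.
    by move=> x; apply: cvgD; [exact: cm|exact: cE].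
  by move=> x x0T; have h1 := dmE x x0T; have h2 := dEE x x0T; exact: is_deriveD.
have IL : (\int[mu]_(t in `[0%R, T]) (L t)%:E = ((m T - E T) - (m 0%R - E 0%R))%R%:E)%E.
  apply: (@FTC2_within _ _ (fun t => m t - E t)) => //.
    by move=> x; apply: cvgB; [exact: cm|exact: cE].
  by move=> x x0T; have h1 := dmE x x0T; have h2 := dEE x x0T; exact: is_deriveB.
have spU : (\int[mu]_(t in `[0%R, T]) (sp t)%:E <= ((m T + E T) - (m 0%R + E 0%R))%R%:E)%E.
  rewrite -IU; apply: integral_le_nonmeasurable => x /inT/spE[s0 s1]; rewrite lee_fin//.
  by rewrite /U; move: s1; rewrite ler_norml; lra.
have spL : (((m T - E T) - (m 0%R - E 0%R))%R%:E <= \int[mu]_(t in `[0%R, T]) (sp t)%:E)%E.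
  rewrite -IL.
  (* L may be negative; its positive part is below sp as well *)
  apply: (@le_trans _ _ (\int[mu]_(t in `[0%R, T]) (Num.max 0%R (L t))%:E)%E).
    have := @integralE _ _ _ mu `[0%R, T] (EFin \o L); rewrite /= => ->.
    rewrite (_ : (\int[mu]_(t in `[0%R, T]) (Num.max 0%R (L t))%:E)%E =
      (\int[mu]_(t in `[0%R, T]) ((EFin \o L)^\+ t))%E).
      by rewrite geeDl// oppe_le0 integral_ge0.
    by apply: eq_integral => x _; rewrite funeposE maxC EFin_max.
  apply: integral_le_nonmeasurable => x /inT/spE[s0 s1]; rewrite lee_fin.
    by rewrite le_max lexx.
  by rewrite ge_max s0/= /L; move: s1; rewrite ler_norml; lra.
rewrite /Rintegral.
have fin : (\int[mu]_(t in `[0%R, T]) (sp t)%:E)%E \is a fin_num.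
  by apply/fin_numPlt; rewrite (lt_le_trans _ spL) ?ltNyr//= (le_lt_trans spU) ?ltry.
move: spU spL; rewrite -(fineK fin) !lee_fin ler_norml; lra.
Qed.

Section improper.
Context {R : realType}.

Lemma primitive_exists (G : R -> R) : continuous G ->
  exists Phi : R -> R, forall x : R, -1 < x -> is_derive x 1 Phi (G x).
Proof.
move=> cG; exists (fun x => \int[mu]_(t in `[-1, x]) G t) => x x1.
have iG : mu.-integrable `[-1, x + 1] (EFin \o G).
  apply: continuous_compact_integrable; first exact: segment_compact.
  exact: continuous_subspaceT.
have := @continuous_FTC1_closed R G (-1) x (x + 1) _ iG x1 (cG x).
by rewrite ltrDl ltr01 => /(_ isT)[h1 h2]; apply: DeriveDef; rewrite -?derive1E.
Qed.

Lemma quadratic_decay_integral (a : R) : 0 <= a ->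
  (\int[mu]_(x in `[a, +oo[) ((1 + x) ^- 2)%:E = ((1 + a)^-1)%:E)%E.
Proof.
move=> a0.
have d (x : R) : a <= x -> is_derive x 1 (fun x => - (1 + x)^-1) ((1 + x) ^- 2).
  move=> ax; have x1 : 1 + x != 0 by rewrite gt_eqF// ltr_pwDl// (le_trans a0).
  have h : is_derive x 1 (fun x : R => 1 + x) 1.
    rewrite (_ : (fun x : R => 1 + x) = shift (1 : R)); first exact: is_derive_shift.
    by apply/funext => y; rewrite /= addrC.
  apply: (is_derive_eq (is_deriveN (is_deriveV x1 h))).
  by rewrite -[_ *: 1]/(_ * 1) mulr1 opprK.
rewrite (@ge0_continuous_FTC2y _ _ (fun x => - (1 + x)^-1) a 0).
- by rewrite sub0e EFinN oppeK.
- by move=> x ax; rewrite invr_ge0 exprn_ge0// addr_ge0// (le_trans a0).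
- apply/continuous_within_itvcyP; split.
    move=> x /[!in_itv]/= /[!andbT] ax.
    have x1 : (1 + x) ^+ 2 != 0 by rewrite expf_neq0// gt_eqF// ltr_pwDl// ltW// (le_lt_trans a0).
    apply: cvgV => //; apply: (@continuous_comp _ _ _ (fun x : R => 1 + x) (fun x => x ^+ 2)).
      by apply: cvgD; [exact: cvg_cst|exact: cvg_id].
    exact: exprn_continuous.
  apply: cvg_at_right_filter.
  have x1 : (1 + a) ^+ 2 != 0 by rewrite expf_neq0// gt_eqF// ltr_pwDl.
  apply: cvgV => //; apply: (@continuous_comp _ _ _ (fun x : R => 1 + x) (fun x => x ^+ 2)).
    by apply: cvgD; [exact: cvg_cst|exact: cvg_id].
  exact: exprn_continuous.
- apply/cvgrPdist_le => eps eps0; near=> x.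
  have x0 : 0 < x by near: x; apply: nbhs_pinfty_gt; exact: num_real.
  have xe : eps^-1 <= x by near: x; apply: nbhs_pinfty_ge; exact: num_real.
  have p : 0 < 1 + x by lra.
  rewrite sub0r opprK gtr0_norm ?invr_gt0// invf_ple ?posrE//; lra.
- by move=> x ax; case: (d x (ltW ax)).
- apply: cvg_at_right_filter; apply: (@differentiable_continuous R R R a (fun x : R => - (1 + x)^-1)).
  by apply/derivable1_diffP; case: (d a (lexx a)).
- by move=> x /[!in_itv]/= /[!andbT] ax; rewrite derive1E; case: (d x (ltW ax)).
Unshelve. all: by end_near. Qed.

Let P (K Z : R) : R := K * (1 + `|Z|) ^- 2.

Lemma quadratic_decay_continuous K : continuous (P K).
Proof.
move=> x; apply: cvgM; first exact: cvg_cst.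
have x1 : (1 + `|x|) ^+ 2 != 0 by rewrite expf_neq0// gt_eqF// ltr_pwDl.
apply: cvgV => //; apply: (@continuous_comp _ _ _ (fun x : R => 1 + `|x|) (fun x => x ^+ 2)).
  by apply: cvgD; [exact: cvg_cst|exact: norm_continuous].
exact: exprn_continuous.
Qed.

Let PE K (x : R) : 0 <= x -> P K x = K * (1 + x) ^- 2.
Proof. by move=> x0; rewrite /P ger0_norm. Qed.

Let IP K (a : R) : 0 <= K -> 0 <= a ->
  (\int[mu]_(x in `[a, +oo[) (P K x)%:E = (K / (1 + a))%:E)%E.
Proof.
move=> K0 a0; rewrite EFinM -quadratic_decay_integral//.
have E1 : P 1 = (fun x => (1 + `|x|) ^- 2) by apply/funext => x; rewrite /P mul1r.
rewrite -ge0_integralZl//; last 2 first.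
- apply/measurable_EFinP; apply: (eq_measurable_fun (P 1)).
    by move=> x; rewrite inE/= in_itv/= andbT => ax; rewrite PE ?mul1r// (le_trans a0).
  apply: measurable_funTS; apply: continuous_measurable_fun.
  exact: quadratic_decay_continuous.
- by move=> x; rewrite /= in_itv/= andbT => ax; rewrite lee_fin invr_ge0 exprn_ge0// addr_ge0// (le_trans a0).
by apply: eq_integral => x; rewrite inE/= in_itv/= andbT => ax; rewrite -EFinM PE// (le_trans a0).
Qed.

Let iP K : 0 <= K -> mu.-integrable `[0, +oo[ (EFin \o P K).
Proof.
move=> K0; apply/integrableP; split.
  apply/measurable_EFinP; apply: measurable_funTS.
  apply: continuous_measurable_fun; exact: quadratic_decay_continuous.
have -> : (\int[mu]_(x in `[0%R, +oo[) `|(EFin \o P K) x| =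
   \int[mu]_(x in `[0%R, +oo[) (P K x)%:E)%E.
  apply: eq_integral => x _; rewrite /= ger0_norm//.
  by rewrite /P mulr_ge0// invr_ge0 sqr_ge0.
by rewrite IP// ltry.
Qed.

Lemma quadratic_decay_integrable (G : R -> R) (K : R) : continuous G ->
  (forall Z, 0 <= Z -> 0 <= G Z <= K * (1 + Z) ^- 2) ->
  mu.-integrable `[0, +oo[ (EFin \o G).
Proof.
move=> cG GK.
have K0 : 0 <= K by have := GK 0 (lexx 0); rewrite addr0 expr1n invr1 mulr1 => /andP[]; exact: le_trans.
apply: le_integrable (iP K0) => //.
  apply/measurable_EFinP; apply: measurable_funTS.
  exact: continuous_measurable_fun.
move=> x; rewrite /= in_itv/= andbT => x0; rewrite lee_fin.
have := GK x x0; rewrite -PE// => /andP[h1 h2].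
by rewrite !ger0_norm// (le_trans h1).
Qed.

Lemma quadratic_decay_tail (G : R -> R) (K a : R) :
  mu.-integrable `[0, +oo[ (EFin \o G) -> 0 <= a ->
  (forall Z, a <= Z -> 0 <= G Z <= K * (1 + Z) ^- 2) ->
  \int[mu]_(x in `[0, a]) G x <= \int[mu]_(x in `[0, +oo[) G x
    <= \int[mu]_(x in `[0, a]) G x + K / (1 + a).
Proof.
move=> iG a0 GK.
have K0 : 0 <= K.
  have /andP[h1 h2] := GK a (lexx a); have := le_trans h1 h2.
  by rewrite pmulr_lge0// invr_gt0 exprn_gt0// ltr_pwDl.
have sub : `]a, +oo[ `<=` `[(0 : R), +oo[.
  by move=> x; rewrite /= !in_itv/= !andbT => /ltW; exact: le_trans.
have := @Rintegral_itvB R G (BLeft 0) +oo%O a iG.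
rewrite bnd_simp a0 => /(_ isT isT) E.
have B1 : 0 <= \int[mu]_(x in `]a, +oo[) G x.
  apply: Rintegral_ge0 => x; rewrite /= in_itv/= andbT => /ltW x0.
  by have /andP[] := GK x x0.
have B2 : \int[mu]_(x in `]a, +oo[) G x <= K / (1 + a).
  apply: (@le_trans _ _ (\int[mu]_(x in `]a, +oo[) P K x)).
    apply: le_Rintegral => //.
    + exact: integrableS iG.
    + exact: integrableS (iP K0).
    + move=> x; rewrite /= in_itv/= andbT => /ltW x0; rewrite PE ?(le_trans a0)//.
      by have /andP[] := GK x x0.
  rewrite Rintegral_itv_obnd_cbnd; last exact: integrableS (iP K0).
  by rewrite /Rintegral IP.
rewrite -E in B1 B2; apply/andP; split; lra.
Qed.

End improper.

(** Divided by [2 sqrt N], the hypothesis is a linear differential inequality for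
    [sqrt N] in the variable [z].  The shift by [dl] keeps the square root
    differentiable where [N] vanishes. *)
Lemma gronwall_sqrt_shift (R : realType) (T0 K W1 dl : R) (z N wk : R -> R) :
  0 <= T0 -> 0 <= K -> 0 <= W1 -> 0 < dl -> z 0 = 0 ->
  (forall t, 0 <= t <= T0 ->
    [/\ derivable z t 1, 0 <= derive1 z t, derivable N t 1, 0 <= N t &
        `|derive1 N t| <= K * (derive1 z t * (N t + wk t * Num.sqrt (N t)))
        /\ 0 <= wk t <= W1]) ->
  `|Num.sqrt (N T0 + dl) - Num.sqrt (N 0 + dl)| <=
    (expR (K * z T0) - 1) * (Num.sqrt (N 0 + dl) + W1).
Proof.
move=> T00 K0 W10 dl0 z00 H.
pose s t := Num.sqrt (N t + dl).
have s_gt0 t : 0 <= t <= T0 -> 0 < s t.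
  by move=> /H[_ _ _ N0 _]; rewrite sqrtr_gt0 ltr_wpDl.
have ds t : 0 <= t <= T0 -> is_derive t 1 s ((2 * s t)^-1 * derive1 N t).
  move=> ht; have [_ _ dN N0 _] := H t ht.
  have hN : is_derive t 1 (fun t => N t + dl) (derive1 N t).
    have h1 := derivableP dN; rewrite -derive1E in h1.
    by apply: (is_derive_eq (is_deriveD h1 (is_derive_cst dl _ _))); rewrite addr0.
  apply: (@is_derive1_comp _ Num.sqrt (fun t => N t + dl)).
  by apply: is_derive1_sqrt; rewrite ltr_wpDl.
have s'b t : 0 <= t <= T0 ->
    `|(2 * s t)^-1 * derive1 N t| <= K * derive1 z t * (s t + W1).
  move=> ht; have st := s_gt0 t ht; have [_ z' _ N0 [Nb /andP[w0 wW]]] := H t ht.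
  have sN : Num.sqrt (N t) <= s t by rewrite ler_wsqrtr// lerDl ltW.
  have N2 : N t <= s t ^+ 2 by rewrite sqr_sqrtr ?addr_ge0 ?(ltW dl0)// lerDl ltW.
  rewrite normrM gtr0_norm ?invr_gt0 ?mulr_gt0// mulrC ler_pdivrMr ?mulr_gt0//.
  apply: (le_trans Nb); rewrite -!mulrA ler_wpM2l// ler_wpM2l//.
  have h2 : wk t * Num.sqrt (N t) <= W1 * s t by rewrite ler_pM ?sqrtr_ge0.
  have h3 : 0 <= W1 * s t by rewrite mulr_ge0// ltW.
  have h4 : 0 <= s t ^+ 2 by exact: sqr_ge0.
  rewrite (_ : (s t + W1) * (2 * s t) = 2 * s t ^+ 2 + 2 * (W1 * s t)); last by ring.
  lra.
(* a = K gives the lower and a = - K the upper bound *)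
pose g (a : R) t := (s t + W1) * expR (a * z t).
have dg a t : 0 <= t <= T0 -> is_derive t 1 (g a)
    (expR (a * z t) * ((2 * s t)^-1 * derive1 N t + a * derive1 z t * (s t + W1))).
  move=> ht; have [dz _ _ _ _] := H t ht.
  have h1 : is_derive t 1 (fun t => s t + W1) ((2 * s t)^-1 * derive1 N t).
    by apply: (is_derive_eq (is_deriveD (ds t ht) (is_derive_cst W1 _ _))); rewrite addr0.
  have h2 : is_derive t 1 (fun t => a * z t) (a * derive1 z t).
    have hz := derivableP dz; rewrite -derive1E in hz.
    by have := is_deriveZ a hz.
  have h3 : is_derive t 1 (fun t => expR (a * z t)) (expR (a * z t) * (a * derive1 z t)).
    exact: (@is_derive1_comp _ expR (fun t => a * z t)).
  apply: (is_derive_eq (is_deriveM h1 h3)).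
  by rewrite -![_ *: _]/(_ * _); ring.
have cg a : {within `[0, T0], continuous (g a)}.
  by apply: derivable_within_continuous => t /[!in_itv]/= ht; case: (dg a t ht).
have g0 a : g a 0 = s 0 + W1 by rewrite /g z00 mulr0 expR0 mulr1.
have h1 : g (- K) T0 <= s 0 + W1.
  rewrite -(g0 (- K)); apply: (@ler0_derive1_nincr _ (g (- K)) 0 T0) => //.
  - by move=> x /[!in_itv]/= /andP[x0 xT]; case: (dg (- K) x _); rewrite ?ltW.
  - move=> x /[!in_itv]/= /andP[x0 xT]; have hx : 0 <= x <= T0 by rewrite !ltW.
    have [_ E] := dg (- K) x hx; rewrite derive1E E pmulr_rle0 ?expR_gt0//.
    have := s'b x hx; rewrite ler_norml mulNr mulNr; lra.
have h2 : s 0 + W1 <= g K T0.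
  rewrite -(g0 K); apply: (@ger0_derive1_ndecr _ (g K) 0 T0) => //.
  - by move=> x /[!in_itv]/= /andP[x0 xT]; case: (dg K x _); rewrite ?ltW.
  - move=> x /[!in_itv]/= /andP[x0 xT]; have hx : 0 <= x <= T0 by rewrite !ltW.
    have [_ E] := dg K x hx; rewrite derive1E E pmulr_rge0 ?expR_gt0//.
    have := s'b x hx; rewrite ler_norml; lra.
rewrite /g mulNr expRN ler_pdivrMr ?expR_gt0// in h1.
rewrite /g in h2.
have T0T : 0 <= T0 <= T0 by rewrite T00 lexx.
have sT := s_gt0 T0 T0T.
have s0 := s_gt0 0; rewrite lexx T00 in s0; have {}s0 := s0 isT.
rewrite -/(s T0) -/(s 0).
set x := expR (K * z T0) in h1 h2 *.
set b := s 0 + W1 in h1 h2 *.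
have x0 : 0 < x by exact: expR_gt0.
have b0 : 0 < b by rewrite ltr_wpDr.
have e1 : s T0 - s 0 = (s T0 + W1) - b by rewrite /b; ring.
rewrite e1 ler_norml; apply/andP; split; last first.
  by rewrite mulrBl mul1r mulrC lerB.
(* the lower bound comes with 1 - 1 / x, which x + 1 / x >= 2 compares with x - 1 *)
have h3 : b / x <= s T0 + W1 by rewrite ler_pdivrMr.
have h4 : (2 - x) * b <= b / x.
  rewrite ler_pdivlMr// mulrAC -[leRHS]mul1r ler_wpM2r ?(ltW b0)//.
  have := sqr_ge0 (x - 1); rewrite sqrrB expr2; nra.
lra.
Qed.

(** The limit of [gronwall_sqrt_shift] as the shift tends to 0. *)
Lemma gronwall_sqrt (R : realType) (T0 K W1 : R) (z N wk : R -> R) :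
  0 <= T0 -> 0 <= K -> 0 <= W1 -> z 0 = 0 ->
  (forall t, 0 <= t <= T0 ->
    [/\ derivable z t 1, 0 <= derive1 z t, derivable N t 1, 0 <= N t &
        `|derive1 N t| <= K * (derive1 z t * (N t + wk t * Num.sqrt (N t)))
        /\ 0 <= wk t <= W1]) ->
  `|Num.sqrt (N T0) - Num.sqrt (N 0)| <=
    (expR (K * z T0) - 1) * (Num.sqrt (N 0) + W1).
Proof.
move=> T00 K0 W10 z00 H.
have cs (a : R) : {for 0, continuous (fun dl => Num.sqrt (a + dl))}.
  apply: continuous_comp; last exact: sqrt_continuous.
  by apply: cvgD; [exact: cvg_cst|exact: cvg_id].
pose F dl := (expR (K * z T0) - 1) * (Num.sqrt (N 0 + dl) + W1)
   - `|Num.sqrt (N T0 + dl) - Num.sqrt (N 0 + dl)|.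
have cF : F dl @[dl --> 0^'+] --> F 0.
  apply: cvg_at_right_filter.
  apply: cvgB.
    apply: cvgM; first exact: cvg_cst.
    by apply: cvgD; [exact: cs|exact: cvg_cst].
  by apply: cvg_norm; apply: cvgB; exact: cs.
have : 0 <= F 0.
  apply: (cvgr_to_ge cF); near=> dl.
  by rewrite subr_ge0; apply: (@gronwall_sqrt_shift _ _ _ _ _ _ _ wk).
by rewrite /F !addr0 subr_ge0.
Unshelve. all: by end_near. Qed.

(** * The integrand of the constant *)

Section kernel.
Context {R : realType}.
Variables (w : R -> R -> R) (k : nat) (m : R).
Hypotheses (hw : scaling_function w) (hk : (2 <= k)%N) (m0 : 0 < m).
Hypothesis hm : forall e z, 0 < e -> 0 <= z -> m * (e + z) <= w e z.
Let f := w 1.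

(** The integrand of the constant for [c = cos phi]; the absolute value extends it
    continuously to negative arguments. *)
Definition kernel (c Z : R) : R :=
  (f `|Z| ^+ k * Num.sqrt (f `|Z| ^+ (2 * k) - c ^+ 2))^-1.

Variables (c dlt : R).
Hypotheses (c0 : 0 <= c) (dlt0 : 0 < dlt) (c1 : c <= 1 - dlt).

Lemma profile_abs_ge1 (Z : R) : 1 <= f `|Z|. Proof. exact: profile_ge1. Qed.

Lemma kernel_radicand_gt0 (Z : R) : 0 < f `|Z| ^+ (2 * k) - c ^+ 2.
Proof.
have h1 : 1 <= f `|Z| ^+ (2 * k) by rewrite exprn_ege1// profile_abs_ge1.
have c01 : c < 1 by move: c1 dlt0; lra.
have h2 : c ^+ 2 < 1 by rewrite expr_lt1.
have := h1; have := h2; rewrite subr_gt0 => h3 h4; exact: lt_le_trans h3 h4.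
Qed.

Lemma kernel_continuous : continuous (kernel c).
Proof.
move=> Z; have fZ : 0 < f `|Z| by rewrite (lt_le_trans ltr01)// profile_abs_ge1.
have cf : {for Z, continuous (fun Z : R => f `|Z|)}.
  by apply: (@continuous_comp _ _ _ (fun Z : R => `|Z|) f); [exact: norm_continuous|exact: profile_continuous].
have cX n : {for Z, continuous (fun Z : R => f `|Z| ^+ n)}.
  by apply: (@continuous_comp _ _ _ (fun Z : R => f `|Z|) (fun x => x ^+ n)) => //; exact: exprn_continuous.
apply: cvgV.
  by rewrite mulf_neq0// gt_eqF// ?exprn_gt0// sqrtr_gt0 kernel_radicand_gt0.
apply: cvgM; first exact: cX.
apply: (@continuous_comp _ _ _ (fun Z : R => f `|Z| ^+ (2 * k) - c ^+ 2) Num.sqrt).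
  by apply: cvgB; [exact: cX|exact: cvg_cst].
exact: sqrt_continuous.
Qed.

Lemma kernel_decay_at (s Z : R) : 0 <= Z -> 0 < s ->
  s ^+ 2 * f Z ^+ (2 * k) <= f Z ^+ (2 * k) - c ^+ 2 ->
  0 <= kernel c Z <= (m ^+ (2 * k) * s)^-1 * (1 + Z) ^- 2.
Proof.
move=> Z0 s0 hs; have fZ : 1 <= f `|Z| by exact: profile_abs_ge1.
have fZ0 : 0 < f `|Z| by exact: lt_le_trans fZ.
rewrite /kernel invr_ge0 mulr_ge0 ?sqrtr_ge0 ?exprn_ge0 ?(ltW fZ0)//=.
rewrite -invfM lef_pV2 ?posrE; last 2 first.
- by rewrite mulr_gt0 ?exprn_gt0// sqrtr_gt0 kernel_radicand_gt0.
- by rewrite !mulr_gt0 ?exprn_gt0//; lra.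
have s1 : f `|Z| ^+ k * s <= Num.sqrt (f `|Z| ^+ (2 * k) - c ^+ 2).
  rewrite -[leLHS]ger0_norm ?mulr_ge0 ?exprn_ge0 ?(ltW fZ0) ?(ltW s0)// -sqrtr_sqr ler_wsqrtr//.
  by rewrite exprMn -exprM mulnC (ger0_norm Z0) mulrC.
apply: (@le_trans _ _ (f `|Z| ^+ k * (f `|Z| ^+ k * s))); last first.
  by rewrite ler_wpM2l// exprn_ge0// ltW.
rewrite mulrA -exprD addnn -mul2n mulrAC ler_wpM2r ?(ltW s0)//.
have mf : m * (1 + Z) <= f `|Z| by rewrite ger0_norm//; apply: hm.
rewrite (@le_trans _ _ ((m * (1 + Z)) ^+ (2 * k)))//; last first.
  by rewrite lerXn2r ?nnegrE ?mulr_ge0 ?(ltW m0) ?(ltW fZ0)//; lra.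
rewrite exprMn ler_wpM2l ?exprn_ge0 ?(ltW m0)//.
by rewrite ler_weXn2l//; [lra|rewrite mul2n -addnn (leq_trans hk)// leq_addr].
Qed.

Definition kernel_cst : R := (m ^+ (2 * k) * dlt)^-1.

Lemma kernel_decay Z : 0 <= Z -> 0 <= kernel c Z <= kernel_cst * (1 + Z) ^- 2.
Proof.
have [c0' c1' dlt0'] : [/\ 0 <= c, c <= 1 - dlt & 0 < dlt] by [].
move=> Z0; apply: kernel_decay_at => //.
set F := f Z ^+ (2 * k); have F1 : 1 <= F by rewrite exprn_ege1// profile_ge1.
have dlt1 : dlt <= 1 by lra.
have cc : c ^+ 2 <= 1 - dlt by rewrite (le_trans _ c1)// expr2 ler_piMl//; lra.
have dd : dlt ^+ 2 <= dlt by rewrite expr2 ler_piMl// ltW.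
have : F * dlt ^+ 2 <= F * dlt by rewrite ler_wpM2l// (le_trans ler01).
have : 0 <= (F - 1) * (1 - dlt) by rewrite mulr_ge0; lra.
lra.
Qed.

Lemma Cconst_kernel phi : c = cos phi ->
  Cconst k f phi = \int[mu]_(Z in `[0, +oo[) kernel c Z.
Proof.
move=> ->; apply: eq_Rintegral => Z; rewrite inE/= in_itv/= andbT => Z0.
by rewrite /kernel ger0_norm.
Qed.

End kernel.

(** * The length of a crossing *)

(** A geodesic enters through its height [z], the coefficient [A] of [z'^2], the
    squared momentum [N] and the angular speed [sp], and through a single
    constant [K] that bounds how far they are from the case of a surface of
    revolution. *)
Section crossing.
Context {R : realType}.
Variables (w : R -> R -> R) (k : nat) (m : R).
Hypotheses (hw : scaling_function w) (hk : (2 <= k)%N) (m0 : 0 < m).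
Hypothesis hm : forall e z, 0 < e -> 0 <= z -> m * (e + z) <= w e z.
Let f := w 1.
Variables (K c dlt z0 e T del : R) (z N A sp : R -> R).
Hypotheses (K1 : 1 <= K) (c0 : 0 <= c) (dlt0 : 0 < dlt) (cdlt : c <= 1 - dlt).
Hypotheses (z00 : 0 < z0) (e0 : 0 < e) (T0 : 0 < T) (del0 : 0 < del).
Let zt := derive1 z.
Let wt t := w e (z t).
Let dom t := - del < t < T + del.
Definition drift_cst : R := K * expR K.
Let K3 := drift_cst.
Hypotheses (K3z0 : 8 * K3 * z0 <= 1) (K3e : 8 * K3 * e <= m * dlt) (e11 : e + z0 <= 1).
Hypothesis wsmall : forall s, 0 <= s <= z0 -> 2 * (K * w e s ^+ k) <= 1.
Hypothesis H_C2 : forall t, dom t -> derivable z t 1 /\ derivable zt t 1.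
Hypothesis H_N0 : forall t, dom t -> 0 <= N t.
Hypothesis H_unit : forall t, dom t -> A t * zt t ^+ 2 + N t / wt t ^+ (2 * k) = 1.
Hypothesis H_A : forall t, dom t -> 0 <= z t <= z0 -> `|A t - 1| <= K * wt t ^+ k.
Hypothesis H_rate : forall t, dom t -> 0 <= z t <= z0 -> `|zt t| <= 2 ->
  derivable N t 1 /\
  `|derive1 N t| <= K * (`|zt t| * (N t + wt t ^+ k * Num.sqrt (N t))).
Hypothesis H_sp : forall t, dom t -> 0 <= z t <= z0 ->
  0 <= sp t /\ `|sp t - Num.sqrt (N t) / wt t ^+ (2 * k)| <= K * `|zt t|.
Hypotheses (zi : z 0 = 0) (zti : 0 <= zt 0) (zf : z T = z0).
Hypothesis zle : forall t, 0 <= t <= T -> z t <= z0.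
Hypothesis Ni : N 0 = (e ^+ k * c) ^+ 2.

Lemma crossing_dom t : 0 <= t <= T -> dom t.
Proof.
by move=> /andP[t0 tT]; rewrite /dom; have := del0 => d0; apply/andP; split; lra.
Qed.

Lemma width_gt0 s : 0 < w e s. Proof. exact: scaling_gt0. Qed.

Lemma width_ge s : 0 <= s -> e <= w e s.
Proof.
move=> s0; case: (hw) => _ _ _ [we _] _.
by rewrite -[leLHS](we e (ltW e0)) (scaling_nondecreasing hw).
Qed.

Lemma radial_half t : dom t -> 0 <= z t <= z0 -> 2^-1 <= A t <= 3 / 2.
Proof.
move=> dt zt0; have := H_A dt zt0; have := wsmall zt0.
rewrite -/(wt t) ler_norml => h1 /andP[h2 h3]; apply/andP; split; lra.
Qed.

Lemma speed_le2 t : dom t -> 0 <= z t <= z0 -> `|zt t| <= 2.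
Proof.
move=> dt zt0; have /andP[A1 _] := radial_half dt zt0.
have := H_unit dt; have : 0 <= N t / wt t ^+ (2 * k).
  by rewrite divr_ge0 ?H_N0// exprn_ge0// ltW// width_gt0.
have : 2^-1 * zt t ^+ 2 <= A t * zt t ^+ 2 by rewrite ler_wpM2r// sqr_ge0.
move=> h1 h2 h3; rewrite -(@ler_pXn2r _ 2)// ?nnegrE// real_normK ?num_real//.
rewrite -[2 ^+ 2]/((2 : R) ^+ 2) expr2; lra.
Qed.

Lemma drift_ge0 : 0 <= K3.
Proof. by rewrite /K3 /drift_cst mulr_ge0 ?expR_ge0// (le_trans _ K1). Qed.

Let q t := Num.sqrt (N t) / wt t ^+ k.
Let p t := e ^+ k * c / wt t ^+ k.

Lemma monotone_height t : 0 <= t <= T -> (forall s, 0 <= s <= t -> 0 <= zt s) ->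
  forall s, 0 <= s <= t -> 0 <= z s /\ z s <= z t.
Proof.
move=> /andP[t0 tT] zs s /andP[s0 st].
have D x : 0 <= x <= t -> derivable z x 1.
  by move=> /andP[x0 xt]; apply: (H_C2 _).1; apply: crossing_dom; rewrite x0 (le_trans xt).
have mono : forall x y, 0 <= x -> x <= y -> y <= t -> z x <= z y.
  apply: ger0_derive1_ndecr.
  - by move=> x /[!in_itv]/= /andP[x0 xt]; apply: D; rewrite !ltW.
  - by move=> x /[!in_itv]/= /andP[x0 xt]; apply: zs; rewrite !ltW.
  - by apply: derivable_within_continuous => x /[!in_itv]/= hx; exact: D.
by split; [rewrite -zi; exact: mono|exact: mono].
Qed.

(** Clairaut's relation up to an error: [q] is the component of the velocity along
    [Y], [p] is what it would be if the momentum were conserved. *)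
Lemma momentum_drift t : 0 <= t <= T -> (forall s, 0 <= s <= t -> 0 <= zt s) ->
  `|q t - p t| <= 2 * K3 * z t.
Proof.
move=> ht zs; have /andP[t0 tT] := ht.
have mono := monotone_height ht zs.
have wk0 : 0 < wt t ^+ k by rewrite exprn_gt0// width_gt0.
have htt : 0 <= t <= t by rewrite t0 lexx.
have [zt0 _] := mono t htt.
have ztz0 := zle ht.
have := @gronwall_sqrt R t K (wt t ^+ k) z N (fun s => wt s ^+ k) t0 _ (ltW wk0) zi _.
have K0 : 0 <= K by rewrite (le_trans _ K1).
move=> /(_ K0) H.
have {}H : `|Num.sqrt (N t) - Num.sqrt (N 0)| <=
    (expR (K * z t) - 1) * (Num.sqrt (N 0) + wt t ^+ k).
  apply: H => s hs; have /andP[s0 st] := hs.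
  have ds : dom s by apply: crossing_dom; rewrite s0 (le_trans st).
  have [zs0 zst] := mono s hs; have zsz : 0 <= z s <= z0 by rewrite zs0 (le_trans zst).
  have [dN Nb] := H_rate ds zsz (speed_le2 ds zsz).
  split => //.
  - exact: (H_C2 ds).1.
  - exact: zs.
  - exact: H_N0.
  - rewrite (ger0_norm (zs s hs)) in Nb; split => //.
    rewrite exprn_ge0 ?(ltW (width_gt0 _))//=.
    by rewrite lerXn2r ?nnegrE ?(ltW (width_gt0 _))// (scaling_nondecreasing hw).
have ek0 : 0 <= e ^+ k * c by rewrite mulr_ge0// exprn_ge0// ltW.
rewrite Ni sqrtr_sqr (ger0_norm ek0) in H.
have ekw : e ^+ k * c <= wt t ^+ k.
  rewrite (@le_trans _ _ (e ^+ k))//.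
    by rewrite ler_piMr ?exprn_ge0 ?(ltW e0)//; have := cdlt; have := dlt0; lra.
  by rewrite lerXn2r ?nnegrE ?(ltW e0) ?(ltW (width_gt0 _))// width_ge.
have z1 : z t <= 1 by have := e11; have := e0; lra.
have ex : expR (K * z t) - 1 <= K3 * z t.
  have x0 : 0 <= K * z t by rewrite mulr_ge0.
  have h1 : 1 - expR (- (K * z t)) <= K * z t by have := expR_ge1Dx (- (K * z t)); lra.
  have h2 : expR (K * z t) <= expR K by rewrite ler_expR ler_piMr.
  have h3 : expR (K * z t) - 1 = expR (K * z t) * (1 - expR (- (K * z t))).
    by rewrite mulrBr mulr1 expRN divff// gt_eqF// expR_gt0.
  rewrite h3 /K3 /drift_cst mulrAC mulrC -mulrA [leRHS]mulrA.
  by rewrite ler_pM// ?subr_ge0 ?expR_le1 ?expR_ge0// oppr_le0.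
rewrite /q /p -mulrBl normrM normfV (gtr0_norm wk0) ler_pdivrMr//.
apply: (le_trans H).
apply: (@le_trans _ _ (K3 * z t * (wt t ^+ k + wt t ^+ k))).
  apply: ler_pM => //; last by rewrite lerD2r.
    by rewrite subr_ge0 -[leLHS]expR0 ler_expR mulr_ge0.
  by rewrite addr_ge0 ?(ltW wk0).
by rewrite le_eqVlt; apply/orP; left; apply/eqP; ring.
Qed.

Lemma width_ratio s : 0 <= s -> 0 <= e ^+ k * c / w e s ^+ k <= c.
Proof.
move=> s0; have w0 := width_gt0 s.
have wk0 : 0 < w e s ^+ k by rewrite exprn_gt0.
rewrite divr_ge0 ?mulr_ge0 ?exprn_ge0 ?(ltW e0) ?(ltW w0)//=.
rewrite ler_pdivrMr// mulrC ler_wpM2l// lerXn2r ?nnegrE ?(ltW e0) ?(ltW w0)//.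
exact: width_ge.
Qed.

Definition gap : R := Num.min (1 / 4) (dlt / 2).

Lemma gap_gt0 : 0 < gap.
Proof. by rewrite /gap lt_min !divr_gt0. Qed.

(** While [z] is of the order of [e], the drift is at most [dlt / 2] and [p <= c];
    farther up the drift is at most [1 / 4], and [w >= 2 e] makes [p <= 1 / 2]. *)
Lemma angle_gap t : 0 <= t <= T -> (forall s, 0 <= s <= t -> 0 <= zt s) ->
  q t <= 1 - gap.
Proof.
move=> ht zs; have := momentum_drift ht zs; rewrite ler_norml => /andP[_ qp].
have /andP[t0 tT] := ht.
have htt : 0 <= t <= t by rewrite t0 lexx.
have [zt0 _] := monotone_height ht zs htt.
have K30 := drift_ge0.
have /andP[p0 pc] := width_ratio zt0.
rewrite -/(p t) in pc p0.
have zz : K3 * z t <= K3 * z0 by rewrite ler_wpM2l// zle.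
have g1 : gap <= 1 / 4 by rewrite /gap ge_min lexx.
have g2 : gap <= dlt / 2 by rewrite /gap ge_min lexx orbT.
(* m * z > 2 e implies w >= 2 e *)
have [ze|ze] := leP (z t * m) (2 * e).
  have h : 2 * (K3 * z t) <= dlt / 2.
    rewrite -(ler_pM2r m0); have := K3e.
    have h' : K3 * (z t * m) <= K3 * (2 * e) by rewrite ler_wpM2l.
    move=> h''; lra.
  have := cdlt; lra.
have p2 : p t <= 1 / 2.
  rewrite /p ler_pdivrMr ?exprn_gt0 ?width_gt0//.
  have c1 : c <= 1 by have := cdlt; have := dlt0; lra.
  have w2 : 2 * e <= wt t.
    apply: le_trans (hm e0 zt0); rewrite mulrDr.
    have : 0 <= m * e by rewrite mulr_ge0// ltW.
    by rewrite [z t * m]mulrC in ze; lra.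
  have wk2 : 2 * e ^+ k <= wt t ^+ k.
    apply: (@le_trans _ _ ((2 * e) ^+ k)); last first.
      by rewrite lerXn2r ?nnegrE ?mulr_ge0 ?(ltW e0) ?(ltW (width_gt0 _)).
    rewrite exprMn ler_wpM2r ?exprn_ge0 ?(ltW e0)//.
    by rewrite -[leLHS]expr1 ler_weXn2l ?ler1n// (leq_trans _ hk).
  have : e ^+ k * c <= e ^+ k by rewrite ler_piMr// exprn_ge0// ltW.
  lra.
have := K3z0; lra.
Qed.

Lemma speed_gap t : 0 <= t <= T -> (forall s, 0 <= s <= t -> 0 <= zt s) ->
  gap / 2 <= zt t ^+ 2.
Proof.
move=> ht zs; have q1 := angle_gap ht zs; have /andP[t0 tT] := ht.
have htt : 0 <= t <= t by rewrite t0 lexx.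
have [zt0 _] := monotone_height ht zs htt.
have dt := crossing_dom ht.
have zz : 0 <= z t <= z0 by rewrite zt0 zle.
have /andP[A1 A2] := radial_half dt zz.
have wk0 : 0 < wt t ^+ k by rewrite exprn_gt0// width_gt0.
have q0 : 0 <= q t by rewrite divr_ge0 ?sqrtr_ge0// ltW.
have q2 : N t / wt t ^+ (2 * k) = q t ^+ 2.
  by rewrite /q expr_div_n sqr_sqrtr ?H_N0// mulnC exprM.
have := H_unit dt; rewrite q2 => E.
have g0 := gap_gt0.
have qq : q t ^+ 2 <= 1 - gap.
  by rewrite (le_trans _ q1)// expr2 ler_piMl//; lra.
have : A t * zt t ^+ 2 <= 3 / 2 * zt t ^+ 2 by rewrite ler_wpM2r// sqr_ge0.
lra.
Qed.

(** A continuity argument: up to the first zero of the vertical speed the height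
    increases, so [speed_gap] holds there and keeps the speed away from 0. *)
Lemma speed_positive t : 0 <= t <= T -> 0 < zt t.
Proof.
move=> ht; rewrite ltNge; apply/negP => zt0.
have czt : {within `[0, T], continuous zt}.
  apply: derivable_within_continuous => x /[!in_itv]/= hx.
  exact: (H_C2 (crossing_dom hx)).2.
pose S : set R := `[0, T] `&` (zt @^-1` [set x | x <= 0]).
have S0 : S !=set0 by exists t; split => //=; rewrite in_itv.
have cS : compact S.
  apply: (@subclosed_compact _ _ `[0, T]); last by move=> x [].
    have := czt => /continuous_closedP/(_ _ (@closed_le R 0))/closed_subspaceP[B cB BE].
    by rewrite /S setIC -BE; apply: closedI => //; exact: itv_closed.
  exact: segment_compact.
have cid : {within S, continuous (@id R)} by apply: continuous_subspaceT => x; exact: cvg_id.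
have [t1 t1S tmin] := compact_EVT_min S0 cS cid.
move: t1S; rewrite inE => -[/=]; rewrite in_itv/= => ht1 zt1.
have pos s : 0 <= s <= T -> s < t1 -> 0 < zt s.
  move=> hs st; rewrite ltNge; apply/negP => zs.
  by have := tmin s; rewrite inE /S/= in_itv/= hs zs => /(_ (conj isT isT)); rewrite leNgt st.
have zt1_ge0 : 0 <= zt t1.
  have [->//|t1n0] := eqVneq t1 0.
  have t1p : 0 < t1 by rewrite lt_neqAle eq_sym t1n0; case/andP: ht1.
  have ct1 : {for t1, continuous zt}.
    apply: differentiable_continuous; apply/derivable1_diffP.
    exact: (H_C2 (crossing_dom ht1)).2.
  have cl : zt s @[s --> t1^'-] --> zt t1 by exact: cvg_at_left_filter.
  apply: (cvgr_to_ge cl); near=> s.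
  apply/ltW/pos; last by near: s; exact: nbhs_left_lt.
  have s0 : 0 <= s by near: s; exact: nbhs_left_ge.
  have st1 : s <= t1 by apply/ltW; near: s; exact: nbhs_left_lt.
  by rewrite s0 (le_trans st1)//; case/andP: ht1.
have zs s : 0 <= s <= t1 -> 0 <= zt s.
  move=> /andP[s0]; rewrite le_eqVlt => /predU1P[->//|st].
  by apply/ltW/pos => //; rewrite s0 (le_trans (ltW st))//; case/andP: ht1.
have z0t : zt t1 = 0 by apply/eqP; rewrite eq_le zt1.
have := speed_gap ht1 zs; rewrite z0t expr0n/= leNgt => /negP; apply.
by rewrite divr_gt0// gap_gt0.
Unshelve. all: by end_near. Qed.

Lemma height_range t : 0 <= t <= T -> 0 <= z t <= z0.
Proof.
move=> ht; have /andP[t0 tT] := ht.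
have zs s : 0 <= s <= t -> 0 <= zt s.
  by move=> /andP[s0 st]; apply/ltW/speed_positive; rewrite s0 (le_trans st).
have htt : 0 <= t <= t by rewrite t0 lexx.
by have [-> _] := monotone_height ht zs htt; rewrite zle.
Qed.

Definition speed_cst : R := Num.sqrt (gap / 2).
Let sigma := speed_cst.

Lemma speed_cst_gt0 : 0 < sigma.
Proof. by rewrite sqrtr_gt0 divr_gt0// gap_gt0. Qed.

Lemma speed_ge t : 0 <= t <= T -> sigma <= zt t.
Proof.
move=> ht; have zs s : 0 <= s <= t -> 0 <= zt s.
  move=> /andP[s0 st]; apply/ltW/speed_positive.
  by rewrite s0 (le_trans st)//; case/andP: ht.
rewrite -[leRHS](ger0_norm (ltW (speed_positive ht))) -sqrtr_sqr ler_wsqrtr//.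
exact: speed_gap.
Qed.

Definition mismatch_cst : R := 2 * K3 + (4 * K3 + 2 * K) / dlt.
Let K4 := mismatch_cst.

(** By unit speed, [z'^2] is [(1 - q^2) / A], while [1 - p^2] has [p] in the place
    of [q] and 1 in that of [A].  The difference of [p] and [q] is the drift; that
    of [A] and 1 is of order [w^k], and the factor [p] improves this to [e^k]. *)
Lemma kernel_mismatch t : 0 <= t <= T ->
  `|q t - p t * zt t / Num.sqrt (1 - p t ^+ 2)| <= K4 * (z t + e ^+ k).
Proof.
move=> ht; have zs s : 0 <= s <= t -> 0 <= zt s.
  move=> /andP[s0 st]; apply/ltW/speed_positive.
  by rewrite s0 (le_trans st)//; case/andP: ht.
have dt := crossing_dom ht; have zz := height_range ht.
have qp := momentum_drift ht zs; have ztp := speed_positive ht.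
have /andP[z0t _] := zz.
have /andP[p0 pc] := width_ratio z0t; rewrite -/(p t) in p0 pc.
have /andP[A1 A2] := radial_half dt zz.
have wk0 : 0 < wt t ^+ k by rewrite exprn_gt0// width_gt0.
have q0 : 0 <= q t by rewrite divr_ge0 ?sqrtr_ge0// ltW.
have q1 : q t <= 1 by have := angle_gap ht zs; have := gap_gt0; lra.
have [c1 [c0' d0]] : c <= 1 - dlt /\ 0 <= c /\ 0 < dlt by [].
have p1 : p t <= 1 by lra.
have K30 := drift_ge0.
have K0 : 0 <= K by rewrite (le_trans _ K1).
set g2 := 1 - p t ^+ 2.
have g2d : dlt <= g2.
  rewrite /g2; have : p t ^+ 2 <= p t by rewrite expr2 ler_piMl.
  lra.
have g20 : 0 < g2 by lra.
have gg : Num.sqrt g2 ^+ 2 = g2 by rewrite sqr_sqrtr// ltW.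
have g0 : 0 < Num.sqrt g2 by rewrite sqrtr_gt0.
have q2 : N t / wt t ^+ (2 * k) = q t ^+ 2.
  by rewrite /q expr_div_n sqr_sqrtr ?H_N0// mulnC exprM.
have := H_unit dt; rewrite q2 => E.
have An0 : 0 < A t by lra.
have z2E : zt t ^+ 2 = (1 - q t ^+ 2) / A t.
  by rewrite -E addrK mulrAC divff ?mul1r// gt_eqF.
have Ab := H_A dt zz; rewrite -/(wt t) in Ab.
have D2 : `|g2 - zt t ^+ 2| <= 4 * K3 * z t + 2 * (K * wt t ^+ k).
  have -> : g2 - zt t ^+ 2 = (q t - p t) * (q t + p t) + (1 - q t ^+ 2) * ((A t - 1) / A t).
    by rewrite /g2 z2E; field; rewrite gt_eqF.
  rewrite (le_trans (ler_normD _ _))// lerD//.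
    rewrite normrM (@le_trans _ _ (2 * K3 * z t * 2))//.
      by rewrite ler_pM// ger0_norm ?addr_ge0//; lra.
    by rewrite le_eqVlt; apply/orP; left; apply/eqP; ring.
  rewrite normrM -[leRHS]mul1r ler_pM//.
    by rewrite ger0_norm ?subr_ge0 ?expr_le1// gerBl sqr_ge0.
  rewrite normrM normfV (gtr0_norm An0) ler_pdivrMr// (le_trans Ab)//.
  rewrite mulrAC ler_peMl ?mulr_ge0 ?(ltW wk0)//; lra.
have D1 : `|Num.sqrt g2 - zt t| * Num.sqrt g2 <= 4 * K3 * z t + 2 * (K * wt t ^+ k).
  apply: le_trans D2; rewrite -{3}gg subr_sqr normrM ler_wpM2l//.
  by rewrite ger0_norm ?addr_ge0 ?(ltW ztp) ?(ltW g0)// lerDl ltW.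
have -> : q t - p t * zt t / Num.sqrt g2 =
   (q t - p t) + p t * ((Num.sqrt g2 - zt t) / Num.sqrt g2).
  by field; rewrite gt_eqF.
have pw : p t * (K * wt t ^+ k) = K * (c * e ^+ k).
  by rewrite /p mulrCA divfK ?gt_eqF// [e ^+ k * c]mulrC.
have ek : 0 < e ^+ k by rewrite exprn_gt0.
have D3 : `|p t * ((Num.sqrt g2 - zt t) / Num.sqrt g2)| <= (4 * K3 * z t + 2 * (K * e ^+ k)) / dlt.
  rewrite normrM (ger0_norm p0) normrM normfV (gtr0_norm g0).
  have -> : `|Num.sqrt g2 - zt t| / Num.sqrt g2 = `|Num.sqrt g2 - zt t| * Num.sqrt g2 / g2.
    by rewrite -[X in _ = _ / X]gg expr2 invfM mulrA mulfK ?gt_eqF.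
  rewrite [leLHS]mulrA ler_pdivlMr// [leLHS]mulrAC ler_pdivrMr//.
  apply: (@le_trans _ _ ((4 * K3 * z t + 2 * (K * e ^+ k)) * dlt)); last first.
    by rewrite ler_wpM2l// addr_ge0// ?mulr_ge0// ?mulr_ge0// ltW.
  rewrite ler_wpM2r ?(ltW d0)//.
  apply: (le_trans (ler_wpM2l p0 D1)); rewrite mulrDr lerD//.
    by rewrite ler_piMl// !mulr_ge0.
  rewrite mulrCA pw ler_wpM2l// ler_wpM2l// ler_piMl ?(ltW ek)//; lra.
rewrite (le_trans (ler_normD _ _))// (le_trans (lerD qp D3))//.
rewrite /K4 /mismatch_cst !mulrDl !mulrDr.
have i1 : 0 <= 2 * K3 * e ^+ k by rewrite !mulr_ge0// ltW.
have i2 : 0 <= (4 * K3 + 2 * K) / dlt * (z t + e ^+ k) - (4 * K3 * z t + 2 * (K * e ^+ k)) / dlt.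
  rewrite mulrAC -mulrBl divr_ge0 ?(ltW d0)//.
  have h1 : 0 <= K3 * e ^+ k by rewrite mulr_ge0// ltW.
  have h2 : 0 <= K * z t by rewrite mulr_ge0.
  lra.
move: i2; rewrite !mulrDl !mulrDr; lra.
Qed.

(** The substitution [Z = s / e] and homogeneity of [w]. *)
Lemma kernel_width (s : R) : 0 <= s ->
  e ^- k * c * kernel w k c (s / e) =
  (e ^+ k * c / w e s ^+ k) / (w e s ^+ k * Num.sqrt (1 - (e ^+ k * c / w e s ^+ k) ^+ 2)).
Proof.
move=> s0; have w0 := width_gt0 s; rewrite /kernel ger0_norm ?divr_ge0 ?(ltW e0)//.
have ek : 0 < e ^+ k by rewrite exprn_gt0.
have wk : 0 < w e s ^+ k by rewrite exprn_gt0.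
have -> : w 1 (s / e) = w e s / e.
  by rewrite (scaling_homogeneous hw s e0) mulrAC divff ?mul1r// gt_eqF.
rewrite mulnC exprM [(w e s / e) ^+ k]expr_div_n.
set E := e ^+ k in ek *; set X := w e s ^+ k in wk *.
have -> : (X / E) ^+ 2 - c ^+ 2 = (X / E) ^+ 2 * (1 - (E * c / X) ^+ 2).
  by field; rewrite !gt_eqF.
rewrite sqrtrM ?sqr_ge0// sqrtr_sqr gtr0_norm ?divr_gt0//.
have /andP[p0 pc] := width_ratio s0; rewrite -/E -/X in p0 pc.
have g0 : 0 < Num.sqrt (1 - (E * c / X) ^+ 2).
  have c1 : c < 1 by have := cdlt; have := dlt0; lra.
  by rewrite sqrtr_gt0 subr_gt0 expr_lt1// (le_lt_trans pc).
by field; rewrite !gt_eqF.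
Qed.

(** [dQ] majorizes [(e + s)^(1 - k)] and has the primitive [Q].  For [k > 2] all
    but two of the factors are replaced by [e], which costs nothing in the order
    of the error. *)
Let Q s : R := if (2 < k)%N then - (e ^+ (k - 3))^-1 * (e + s)^-1 else ln (e + s).
Let dQ s : R := if (2 < k)%N then (e ^+ (k - 3))^-1 * (e + s) ^- 2 else (e + s)^-1.

Lemma dQ_ge (s : R) : 0 <= s -> ((e + s) ^+ (k - 1))^-1 <= dQ s.
Proof.
move=> s0; have es : 0 < e + s by rewrite ltr_wpDr.
rewrite /dQ; case: ifPn => k2; last first.
  have -> : (k - 1 = 1)%N by apply/eqP; rewrite eqn_leq subn_gt0 hk leq_subLR addn1 leqNgt k2.
  by rewrite expr1.
have -> : (k - 1 = (k - 3) + 2)%N by case: k k2 => [|[|[|n]]]//= _; rewrite !subSS !subn0 addn2.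
rewrite exprD invfM ler_wpM2r ?invr_ge0 ?sqr_ge0//.
rewrite lef_pV2 ?posrE ?exprn_gt0// lerXn2r ?nnegrE ?(ltW e0) ?(ltW es)//.
by rewrite lerDl.
Qed.

Lemma Q_derive (s : R) : 0 <= s -> is_derive s 1 Q (dQ s).
Proof.
move=> s0; have es : 0 < e + s by rewrite ltr_wpDr.
have h : is_derive s 1 (fun x : R => e + x) 1.
  rewrite (_ : (fun x : R => e + x) = shift e); first exact: is_derive_shift.
  by apply/funext => y; rewrite /= addrC.
rewrite /Q /dQ; case: ifPn => k2.
  have hV := @is_deriveV R (fun x => e + x) s 1 1 (negbT (gt_eqF es)) h.
  apply: (is_derive_eq (is_deriveZ _ hV)).
  by rewrite -![_ *: _]/(_ * _) mulr1 mulrNN.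
have hl := @is_derive1_comp R (@ln R) (fun x => e + x) s _ _ (is_derive1_ln es) h.
by rewrite mulr1 in hl.
Qed.

Lemma dQ_continuous (s : R) : 0 <= s -> {for s, continuous dQ}.
Proof.
move=> s0; have es : 0 < e + s by rewrite ltr_wpDr.
have ce : {for s, continuous (fun x : R => e + x)} by apply: cvgD; [exact: cvg_cst|exact: cvg_id].
rewrite /dQ; case: (boolP (2 < k)%N) => k2.
  apply: cvgM; first exact: cvg_cst.
  apply: cvgV; first by rewrite expf_neq0// gt_eqF.
  by apply: (@continuous_comp _ _ _ (fun x : R => e + x) (fun x => x ^+ 2)) => //; exact: exprn_continuous.
by apply: cvgV => //; rewrite gt_eqF.
Qed.

Lemma Q_increment : e <= expR (-1) ->
  e ^+ (k - 1) * (Q z0 - Q 0) <= if (2 < k)%N then e else e * `|ln e|.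
Proof.
move=> ee; rewrite /Q addr0; case: ifPn => k2.
  have -> : (k - 1 = ((k - 3) + 1) + 1)%N by case: k k2 => [|[|[|n]]]//= _; rewrite !subSS !subn0 !addn1.
  rewrite !exprD !expr1.
  set X := e ^+ (k - 3); have X0 : 0 < X by rewrite exprn_gt0.
  rewrite (_ : X * e * e * _ = e * (1 - e / (e + z0))); last first.
    by field; rewrite !gt_eqF// addr_gt0.
  rewrite ler_piMr ?(ltW e0)// gerBl divr_ge0 ?(ltW e0)// addr_ge0 ?(ltW e0) ?(ltW z00)//.
have -> : (k - 1 = 1)%N by apply/eqP; rewrite eqn_leq subn_gt0 hk leq_subLR addn1 leqNgt k2.
rewrite expr1 ler_wpM2l ?(ltW e0)//.
have l1 : ln (e + z0) <= 0 by rewrite ln_le0.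
have := ler_norm (- ln e); rewrite normrN; lra.
Qed.

Definition error_cst : R := K4 / (m ^+ k * sigma).
Let K5 := error_cst.

(** [kernel_mismatch] is divided by [w^k >= m^k (e + z)^k]; the factor
    [z' / sigma >= 1] makes the error a derivative. *)
Lemma length_integrand (t : R) : 0 <= t <= T ->
  0 <= sp t /\ `|sp t - e ^- k * c * kernel w k c (z t / e) * zt t|
     <= (K + K5 * dQ (z t)) * zt t.
Proof.
move=> ht; have dt := crossing_dom ht; have zz := height_range ht.
have [sp0 spb] := H_sp dt zz; split => //.
have ztp := speed_positive ht; rewrite (gtr0_norm ztp) in spb.
have km := kernel_mismatch ht; have /andP[z0t zt1] := zz.
have wk0 : 0 < wt t ^+ k by rewrite exprn_gt0// width_gt0.
rewrite (kernel_width z0t) -/(wt t) -/(p t).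
have -> : p t / (wt t ^+ k * Num.sqrt (1 - p t ^+ 2)) * zt t =
  (p t * zt t / Num.sqrt (1 - p t ^+ 2)) / wt t ^+ k.
  by rewrite invfM; ring.
have E1 : Num.sqrt (N t) / wt t ^+ (2 * k) = q t / wt t ^+ k.
  by rewrite /q mulnC exprM expr2 invfM mulrA.
rewrite E1 in spb.
rewrite -(subrKA (q t / wt t ^+ k)) (le_trans (ler_normD _ _))// mulrDl lerD//.
rewrite -mulrBl normrM normfV (gtr0_norm wk0).
have ez : 0 < e + z t by rewrite ltr_wpDr.
have K30 := drift_ge0.
have K40 : 0 <= K4.
  have KK : 0 <= K by rewrite (le_trans _ K1).
  apply: addr_ge0; first exact: mulr_ge0.
  by apply: divr_ge0; [apply: addr_ge0; exact: mulr_ge0|exact: ltW].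
have sg := speed_cst_gt0; have sz := speed_ge ht; rewrite -/sigma in sg sz.
have mk : 0 < m ^+ k by rewrite exprn_gt0.
have h1 : (z t + e ^+ k) / wt t ^+ k <= (m ^+ k)^-1 * dQ (z t).
  apply: (@le_trans _ _ ((m ^+ k)^-1 * ((e + z t) ^+ (k - 1))^-1)); last first.
    by rewrite ler_wpM2l ?invr_ge0 ?(ltW mk)// dQ_ge.
  rewrite -invfM ler_pdivrMr// mulrC ler_pdivlMr ?mulr_gt0 ?exprn_gt0//.
  apply: (@le_trans _ _ ((m * (e + z t)) ^+ k)); last first.
    rewrite lerXn2r ?nnegrE ?mulr_ge0 ?(ltW m0) ?(ltW ez) ?(ltW (width_gt0 _))//.
    exact: hm.
  rewrite exprMn mulrCA ler_wpM2l ?(ltW mk)//.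
  have kS : k = (k - 1).+1 by rewrite subn1 prednK// (leq_trans _ hk).
  rewrite [in leRHS]kS exprS ler_wpM2r ?exprn_ge0 ?(ltW ez)//.
  rewrite addrC lerD2r.
  have e1 : e <= 1 by have := e11; have := z00; lra.
  by rewrite -[leRHS]expr1 ler_wiXn2l ?(ltW e0)// (leq_trans _ hk).
apply: (@le_trans _ _ (K4 * ((m ^+ k)^-1 * dQ (z t)))).
  apply: (@le_trans _ _ (K4 * (z t + e ^+ k) / wt t ^+ k)).
    by rewrite ler_wpM2r// invr_ge0 ltW.
  by rewrite -mulrA ler_wpM2l.
have h2 : 0 <= K4 * ((m ^+ k)^-1 * dQ (z t)).
  rewrite mulr_ge0// mulr_ge0 ?invr_ge0 ?(ltW mk)//.
  by apply: le_trans (dQ_ge z0t); rewrite invr_ge0 exprn_ge0// ltW.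
have -> : K5 * dQ (z t) * zt t = K4 * ((m ^+ k)^-1 * dQ (z t)) * (zt t / sigma).
  by rewrite /K5 /error_cst invfM; ring.
by rewrite ler_peMr// ler_pdivlMr// mul1r.
Qed.

(** Main term and error are derivatives along the curve, of a primitive of the
    kernel at [z / e] and of [Q] at [z]; only their values at the ends matter.  The
    bound on [e] makes [|ln e| >= 1]. *)
Lemma crossing_length : e <= expR (-1) -> exists Rem : R,
  \int[mu]_(t in `[0, T]) sp t =
    1 / e ^+ (k - 1) * ((\int[mu]_(Z in `[0, +oo[) kernel w k c Z) * c + Rem) /\
  `|Rem| <= (K + K5 + kernel_cst k m dlt / z0) * (if (2 < k)%N then e else e * `|ln e|).
Proof.
move=> ee; set rate := (if (2 < k)%N then e else e * `|ln e|).
set L := \int[mu]_(t in `[0, T]) sp t.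
set Cc := \int[mu]_(Z in `[0, +oo[) kernel w k c Z.
have ek1 : 0 < e ^+ (k - 1) by rewrite exprn_gt0.
exists (e ^+ (k - 1) * L - Cc * c); split.
  by rewrite addrC subrK mulrA mul1r mulVf ?mul1r// gt_eqF.
have e1 : e <= 1 by have := e11; have := z00; lra.
have e_rate : e <= rate.
  rewrite /rate; case: ifPn => // _; rewrite ler_peMr ?(ltW e0)//.
  have : ln e <= -1 by rewrite -[leRHS]expRK ler_ln ?posrE// expR_gt0.
  by move=> h; have := ler_norm (- ln e); rewrite normrN; lra.
have kc := kernel_continuous hw c0 dlt0 cdlt.
have [Phi dPhi] := primitive_exists (@kc k).
pose M t := e ^- (k - 1) * c * Phi (z t / e).
pose dM t := e ^- k * c * kernel w k c (z t / e) * zt t.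
pose E t := K * z t + K5 * Q (z t).
pose dE t := (K + K5 * dQ (z t)) * zt t.
have zd (t : R) : 0 <= t <= T -> is_derive t 1 z (zt t).
  move=> ht; have [h _] := H_C2 (crossing_dom ht).
  by rewrite /zt derive1E; exact: derivableP.
have zc (t : R) : 0 <= t <= T -> {for t, continuous z}.
  by move=> ht; apply: differentiable_continuous; apply/derivable1_diffP; case: (zd t ht).
have ztc (t : R) : 0 <= t <= T -> {for t, continuous zt}.
  move=> ht; apply: differentiable_continuous; apply/derivable1_diffP.
  exact: (H_C2 (crossing_dom ht)).2.
have MD (t : R) : 0 <= t <= T -> is_derive t 1 M (dM t).
  move=> ht; have /andP[z0t _] := height_range ht.
  have h1 : is_derive t 1 (fun t => z t / e) (zt t / e).
    rewrite (_ : (fun t => z t / e) = e^-1 *: z); last by apply/funext => x; rewrite /= mulrC.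
    by rewrite mulrC; apply: is_deriveZ; exact: zd.
  have ze : -1 < z t / e by rewrite (lt_le_trans (ltrN10 R))// divr_ge0// ltW.
  have h2 := @is_derive1_comp R Phi (fun t => z t / e) t _ _ (dPhi _ ze) h1.
  apply: (is_derive_eq (is_deriveZ (e ^- (k - 1) * c) h2)).
  rewrite /dM -![_ *: _]/(_ * _).
  have -> : e ^- k = e ^- (k - 1) * e^-1.
    by rewrite -invfM -exprSr subn1 prednK// (leq_trans _ hk).
  by ring.
have ED (t : R) : 0 <= t <= T -> is_derive t 1 E (dE t).
  move=> ht; have /andP[z0t _] := height_range ht.
  have h2 := @is_derive1_comp R Q z t _ _ (Q_derive z0t) (zd t ht).
  apply: (is_derive_eq (is_deriveD (is_deriveZ K (zd t ht)) (is_deriveZ K5 h2))).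
  by rewrite /dE -![_ *: _]/(_ * _); ring.
have inT (t : R) : t \in `[0, T]%classic -> 0 <= t <= T by rewrite inE/= in_itv.
have cM : {within `[0, T], continuous M}.
  apply: derivable_within_continuous => t; rewrite in_itv/= => /MD; by case.
have cE : {within `[0, T], continuous E}.
  apply: derivable_within_continuous => t; rewrite in_itv/= => /ED; by case.
have cdM : {within `[0, T], continuous dM}.
  apply: continuous_in_subspaceT => t /inT ht.
  apply: cvgM; last exact: ztc.
  apply: cvgM; first exact: cvg_cst.
  apply: (@continuous_comp _ _ _ (fun t => z t / e) (kernel w k c)); last exact: kc.
  by apply: cvgM; [exact: zc|exact: cvg_cst].
have cdE : {within `[0, T], continuous dE}.
  apply: continuous_in_subspaceT => t /inT ht; have /andP[z0t _] := height_range ht.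
  apply: cvgM; last exact: ztc.
  apply: cvgD; first exact: cvg_cst.
  apply: cvgM; first exact: cvg_cst.
  by apply: (@continuous_comp _ _ _ z dQ); [exact: zc|exact: dQ_continuous].
have := @integral_sandwich R sp M E dM dE T T0 cdM cM _ cdE cE _ length_integrand.
have oc (x : R) : 0 < x < T -> 0 <= x <= T by move=> /andP[x0 xT]; rewrite !ltW.
move=> /(_ (fun x hx => MD x (oc x hx)) (fun x hx => ED x (oc x hx))).
rewrite -/L /M /E zi zf mul0r mulr0 add0r.
have T0T : 0 <= T by exact: ltW.
have kd := kernel_decay hw hk m0 hm c0 dlt0 cdlt.
have iK := quadratic_decay_integrable (@kc k) kd.
have Z00 : 0 < z0 / e by rewrite divr_gt0.
have := quadratic_decay_tail iK (ltW Z00) (fun Z hZ => kd Z (le_trans (ltW Z00) hZ)).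
rewrite -/Cc.
have -> : \int[mu]_(x in `[0, z0 / e]) kernel w k c x = Phi (z0 / e) - Phi 0.
  have dPx (x : R) : 0 <= x -> is_derive x 1 Phi (kernel w k c x).
    by move=> x0; apply: dPhi; rewrite (lt_le_trans (ltrN10 R)).
  have cP : {within `[0, z0 / e], continuous Phi}.
    by apply: derivable_within_continuous => x /[!in_itv]/= /andP[/dPx[]].
  have dPo (x : R) : 0 < x < z0 / e -> is_derive x 1 Phi (kernel w k c x).
    by move=> /andP[x0 _]; apply: dPx; exact: ltW.
  by rewrite /Rintegral (FTC2_within Z00 (continuous_subspaceT (@kc k)) cP dPo).
set dP := Phi (z0 / e) - Phi 0 => /andP[t1 t2] Lb.
have K60 : 0 <= kernel_cst k m dlt.
  by rewrite invr_ge0 mulr_ge0 ?exprn_ge0 ?(ltW m0) ?(ltW dlt0).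
have c1 : c <= 1 by have := cdlt; have := dlt0; lra.
have t3 : kernel_cst k m dlt / (1 + z0 / e) <= kernel_cst k m dlt / z0 * e.
  rewrite -mulrA ler_wpM2l// -[leRHS]invrK invfM invrK lef_pV2 ?posrE ?divr_gt0 ?ltr_wpDr ?(ltW Z00)//.
  by rewrite lerDr.
have B1 : `|Cc * c - c * dP| <= kernel_cst k m dlt / z0 * e.
  rewrite mulrC -mulrBr normrM (ger0_norm c0) ger0_norm ?subr_ge0//.
  apply: (@le_trans _ _ (1 * (Cc - dP))); first by rewrite ler_wpM2r ?subr_ge0.
  lra.
have K50 : 0 <= K5.
  have K30 := drift_ge0.
  rewrite /K5 /error_cst divr_ge0 ?mulr_ge0 ?exprn_ge0 ?(ltW m0) ?(ltW speed_cst_gt0)//.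
  have KK : 0 <= K by rewrite (le_trans _ K1).
  apply: addr_ge0; first exact: mulr_ge0.
  by apply: divr_ge0; [apply: addr_ge0; exact: mulr_ge0|exact: ltW].
have K0 : 0 <= K by rewrite (le_trans _ K1).
have B2 : `|e ^+ (k - 1) * L - c * dP| <= (K + K5) * rate.
  have -> : e ^+ (k - 1) * L - c * dP = e ^+ (k - 1) *
     (L - (e ^- (k - 1) * c * Phi (z0 / e) - e ^- (k - 1) * c * Phi 0)).
    by rewrite /dP; field; rewrite gt_eqF.
  rewrite normrM (gtr0_norm ek1).
  apply: (le_trans (ler_wpM2l (ltW ek1) Lb)).
  rewrite (_ : e ^+ (k - 1) * (K * z0 + K5 * Q z0 - K5 * Q 0) = K * (z0 * e ^+ (k - 1)) + K5 * (e ^+ (k - 1) * (Q z0 - Q 0))); last by ring.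
  rewrite mulrDl lerD// ler_wpM2l//; last exact: Q_increment.
  apply: le_trans e_rate.
  apply: (@le_trans _ _ (1 * e)); last by rewrite mul1r.
  apply: ler_pM; rewrite ?(ltW z00) ?exprn_ge0 ?(ltW e0)//.
    by have := e11; have := e0; lra.
  by rewrite -[leRHS]expr1 ler_wiXn2l ?(ltW e0)// subn_gt0.
have -> : e ^+ (k - 1) * L - Cc * c = (e ^+ (k - 1) * L - c * dP) - (Cc * c - c * dP) by ring.
rewrite (le_trans (ler_normB _ _))// mulrDl lerD// (le_trans B1)// ler_wpM2l//.
by rewrite divr_ge0// ltW.
Qed.

End crossing.

(** A compact subset of the half-open interval stays away from 0. *)
Lemma compact_impact_angles (R : realType) (K : set R) :
  compact K -> K `<=` `]0, pi / 2] ->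
  exists2 dlt : R, 0 < dlt & forall phi, K phi -> cos phi <= 1 - dlt.
Proof.
move=> cK sK; have p2 : 0 < pi / 2 :> R by rewrite divr_gt0// pi_gt0.
have /nbhs_ballP[r /= r0 rK] : nbhs (0 : R) (~` K).
  apply: open_nbhs_nbhs; split.
    by apply: closed_openC; apply: compact_closed => //; exact: norm_hausdorff.
  by move=> /sK; rewrite /= in_itv/= ltxx.
pose p := Num.min r (pi / 2); have p0 : 0 < p by rewrite lt_min r0 p2.
have pp : p <= pi by rewrite ge_min; apply/orP; right; have := p2; lra.
exists (1 - cos p).
  by rewrite subr_gt0 -[ltRHS]cos0 ltr_cos// in_itv/= ?lexx ?(ltW p0)//= pi_ge0.
move=> phi Kphi; have := sK _ Kphi; rewrite /= in_itv/= => /andP[f0 f1].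
rewrite subKr leNgt ltr_cos -?leNgt ?in_itv/= ?(ltW f0) ?(ltW p0)//=; last by have := p2; lra.
rewrite ge_min leNgt; apply/orP; left; apply/negP => fr.
by apply: (rK phi) => //; rewrite /ball/= sub0r normrN gtr0_norm.
Qed.

(** The bounds on the coefficients hold for [e] and [|z|] up to [rho].  The choice
    of [zeta] makes [w^k] and the drift small for all angles; only the smallness of
    [e] and the constant depend on the compact set of angles, through [dlt]. *)
Lemma geodesic_length (R : realType) (d : nat) (Y : closedManifold R d)
    (k kappa : nat) (hk : (2 <= k)%N) (hkappa : (k <= kappa)%N)
    (w : R -> R -> R) (hw : scaling_function w)
    (I : set R) (hIopen : open I) (hIitv : is_interval I) (hI0 : I 0)
    (e1 : R) (he1 : 0 < e1 <= 1)
    (D : coeffs Y) (hD : regular_coeffs e1 I D)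
    (hg : forall e z, param_domain e1 I (e, z) ->
       forall (i : chart_index Y) (y : Y), cdom (atlas i) y ->
         posdef (gmat k kappa w D e i z y)) :
  exists2 zeta : R, 0 < zeta &
    forall z0 : R, 0 < z0 < zeta ->
    forall K : set R, compact K -> K `<=` `]0, pi / 2] ->
    exists (C : R) (e0 : R), 0 < e0 /\
    forall e : R, 0 < e < e0 -> e < e1 ->
    forall (phi T : R) (z : R -> R) (y : R -> Y),
      K phi -> 0 < T ->
      unit_speed_geodesic k kappa w D I e T z y ->
      z 0 = 0 -> 0 <= derive1 z 0 ->
      impact_angle k kappa w D e z y phi ->
      z T = z0 -> (forall t, 0 <= t <= T -> z t <= z0) ->
      exists Rem : R,
        length_Y D e T z y =
          1 / e ^+ (k - 1) * (Cconst k (w 1) phi * cos phi + Rem) /\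
        `|Rem| <= C * (if (2 < k)%N then e else e * `|ln e|).
Proof.
have /nbhs_ballP[r0 /= r00 r0I] : nbhs (0 : R) I by exact: open_nbhs_nbhs.
have /andP[e10 e11] := he1.
pose rho := Num.min r0 e1 / 4.
have mr : 0 < Num.min r0 e1 by rewrite lt_min r00 e10.
have rho0 : 0 < rho by rewrite divr_gt0.
have rr0 : 2 * rho < r0.
  have : Num.min r0 e1 <= r0 by rewrite ge_min lexx.
  move: mr; rewrite /rho; lra.
have re1 : 2 * rho < e1.
  have : Num.min r0 e1 <= e1 by rewrite ge_min lexx orbT.
  move: mr; rewrite /rho; lra.
have Ir : I (2 * rho).
  by apply: r0I; rewrite /ball/= sub0r normrN gtr0_norm// mulr_gt0.
have Inr : I (- (2 * rho)).
  by apply: r0I; rewrite /ball/= sub0r opprK gtr0_norm// mulr_gt0.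
have [C C0 HB] := chart_bounds_uniform hIitv hD rho0 re1 Inr Ir.
pose M : R := @bound_cst R d C.
pose Kc : R := Num.max (2 * M) (@rate_cst R d C).
have [M1 _ _ _ _] := @bound_cst_ge R d C C0; rewrite -/M in M1.
have KM : 2 * M <= Kc by rewrite le_max lexx.
have Kr : @rate_cst R d C <= Kc by rewrite le_max lexx orbT.
have K1 : 1 <= Kc by lra.
have K0 : 0 < Kc by lra.
have Kd0 : 0 < drift_cst Kc by rewrite mulr_gt0// expR_gt0.
have [m m0 hm] := scaling_lower hw.
have eta0 : 0 < (2 * Kc)^-1 by rewrite invr_gt0 mulr_gt0.
have [r r_gt0 hr] := scaling_small hw eta0.
pose zeta := Num.min (Num.min rho r) (Num.min (8 * drift_cst Kc)^-1 2^-1).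
have K8 : 0 < 8 * drift_cst Kc by rewrite mulr_gt0.
have z8 : 0 < (8 * drift_cst Kc)^-1 by rewrite invr_gt0.
exists zeta; first by rewrite !lt_min rho0 r_gt0 z8 invr_gt0/=.
move=> z0 /andP[z00]; rewrite !lt_min => /andP[/andP[zrho zr] /andP[z08 z02]] K cK sK.
have [dlt dlt0 cdlt] := compact_impact_angles cK sK.
exists (Kc + error_cst k m Kc dlt + kernel_cst k m dlt / z0).
pose e0 := Num.min (Num.min rho r) (Num.min (m * dlt / (8 * drift_cst Kc)) (Num.min 2^-1 (expR (-1)))).
have e8 : 0 < m * dlt / (8 * drift_cst Kc) by apply: divr_gt0; exact: mulr_gt0.
exists e0; split; first by rewrite !lt_min rho0 r_gt0 e8 expR_gt0 invr_gt0 ltr0n.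
move=> e /andP[e_gt0]; rewrite !lt_min => /andP[/andP[erho er] /and3P[ee8 e2 ee]] ee1.
move=> phi T z y Kphi T0 [del del0 geo] zi zti imp zf zle.
have wsmall s : `|s| <= z0 -> w e s < (2 * Kc)^-1.
  by move=> sz; apply: hr; [rewrite e_gt0 er|exact: le_lt_trans zr].
have w1 s : `|s| <= z0 -> w e s <= 1.
  move=> sz; rewrite (le_trans (ltW (wsmall s sz)))// invf_le1 ?mulr_gt0//; lra.
have /sK := Kphi; rewrite /= in_itv/= => /andP[f0 f1].
have c0 : 0 <= cos phi.
  by apply: cos_ge0_pihalf; rewrite f1 andbT (le_trans _ (ltW f0))// oppr_le0 divr_ge0// pi_ge0.
rewrite (Cconst_kernel _ _ (erefl (cos phi))).
have zabs t : 0 <= z t <= z0 -> `|z t| <= z0 by move=> /andP[? ?]; rewrite ger0_norm.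
have zarho t : 0 <= z t <= z0 -> `|z t| <= rho by move=> /zabs h; rewrite (le_trans h)// ltW.
apply: (@crossing_length R w k m hw hk m0 hm Kc (cos phi) dlt z0 e T del z
  (angular_square k kappa w D e z y) (fun t => radial_coef k kappa w D e (z t) (y t))
  (angular_speed D e z y)) => //.
- by apply: cdlt.
- by move: z08; rewrite -[ltRHS]mul1r ltr_pdivlMr// => /ltW; rewrite mulrC.
- by move: ee8; rewrite ltr_pdivlMr// => /ltW; rewrite mulrC.
- lra.
- move=> s /andP[s0 sz]; have sz' : `|s| <= z0 by rewrite ger0_norm.
  have W0 : 0 < w e s by exact: scaling_gt0.
  rewrite mulrA -ler_pdivlMl ?mulr_gt0// mulr1 (le_trans _ (ltW (wsmall s sz')))//.
  by rewrite -[leRHS]expr1 ler_wiXn2l ?(ltW W0) ?w1// (leq_trans _ hk).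
- by move=> t ht; exact: (height_C2 geo ht).
- by move=> t ht; exact: (angular_square_ge0 hD hg e_gt0 ee1 geo).
- by move=> t ht; exact: (unit_speed_angular k kappa D hw z y e_gt0 ht).
- move=> t ht zt.
  apply: (le_trans (radial_coef_bound hkappa hw hD C0 HB e_gt0 ee1 geo ht (ltW erho) (zarho _ zt) (w1 _ (zabs _ zt)))).
  by rewrite ler_wpM2r ?exprn_ge0 ?(ltW (scaling_gt0 _ hw e_gt0)).
- move=> t ht zt vt.
  have [dN bN] := angular_square_rate hkappa hw hIopen hD hg C0 HB e_gt0 ee1 geo ht (ltW erho) (zarho _ zt) (w1 _ (zabs _ zt)) vt.
  split => //; apply: (le_trans bN); rewrite ler_wpM2r//.
  rewrite mulr_ge0// addr_ge0// ?(angular_square_ge0 hD hg e_gt0 ee1 geo)//.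
  by rewrite mulr_ge0 ?sqrtr_ge0// exprn_ge0 ?(ltW (scaling_gt0 _ hw e_gt0)).
- move=> t ht zt; split; first exact: sqrtr_ge0.
  apply: (le_trans (angular_speed_bound hw hD hg C0 HB e_gt0 ee1 geo ht (ltW erho) (zarho _ zt))).
  by rewrite ler_wpM2r// (le_trans _ KM)// -/M; lra.
- apply: (impact_angular_square hw hD hg e_gt0 ee1 geo) imp => //.
  by apply/andP; split; lra.
- exact: ltW.
Qed.

(** * The constant at small angles of impact *)

(** Taylor's formula by induction on the order: the mean value theorem bounds the
    remainder of [g] by that of its derivative. *)
Lemma vanishing_expansion (R : realType) (r : R) (n : nat) (g : R -> R) :
  0 < r ->
  (forall (j : nat) (x : R), `|x| < r -> derivable (derive1n j g) x 1) ->
  (forall j, (j < n)%N -> derive1n j g 0 = 0) ->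
  forall eta : R, 0 < eta -> exists2 del : R, 0 < del &
    forall x : R, 0 <= x < del ->
      `|g x - derive1n n g 0 / n`!%:R * x ^+ n| <= eta * x ^+ n.
Proof.
move=> r0; elim: n g => [|n IHn] g dg vg eta eta0.
  have cg : {for 0, continuous g}.
    apply: differentiable_continuous; apply/derivable1_diffP.
    by have := dg 0%N 0; rewrite normr0; exact.
  have /cvgrPdist_le/(_ _ eta0)/nbhs_ballP[del /= del0 H] := cg.
  exists del => // x /andP[x0 xd]; rewrite /= fact0 divr1 !mulr1 distrC.
  by apply: H; rewrite /ball/= sub0r normrN ger0_norm.
have dg' j (x : R) : `|x| < r -> derivable (derive1n j (derive1 g)) x 1.
  by rewrite -derive1Sn; exact: (dg j.+1).
have vg' j : (j < n)%N -> derive1n j (derive1 g) 0 = 0.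
  by move=> jn; rewrite -derive1Sn; exact: vg.
have [del del0 H] := IHn _ dg' vg' eta eta0.
exists (Num.min del r); first by rewrite lt_min del0.
move=> x; rewrite lt_min => /and3P[]; rewrite le_eqVlt => /predU1P[<- _ _|x0 xd xr].
  have := vg 0%N isT; rewrite /= => ->.
  by rewrite expr0n/= !mulr0 subrr normr0.
rewrite derive1Sn; set b := derive1n n (derive1 g) 0 in H *.
pose B := b / n.+1`!%:R.
pose p (t : R) := g t - B * t ^+ n.+1.
have dp (t : R) : `|t| < r -> is_derive t 1 p (derive1 g t - b / n`!%:R * t ^+ n).
  move=> tr; have h1 : is_derive t 1 g (derive1 g t).
    by rewrite derive1E; apply: derivableP; exact: (dg 0%N t tr).
  have h2 : is_derive t 1 (fun t : R => t ^+ n.+1) (n.+1%:R * t ^+ n).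
    have -> : (fun t : R => t ^+ n.+1) = (id : R -> R) ^+ n.+1.
      by apply/funext => s; rewrite exprfctE.
    by apply: (is_derive_eq (is_deriveX n.+1 (is_derive_id t (1 : R)))); rewrite -[_ *: _]/(_ * _) mulr1.
  apply: (is_derive_eq (is_deriveB h1 (is_deriveZ B h2))).
  congr (_ - _); rewrite -[_ *: _]/(_ * _) mulrA; congr (_ * _).
  by rewrite /B factS natrM invfM; field; rewrite !gt_eqF ?ltr0n ?fact_gt0// -[_ + _]/(n.+1%:R) ltr0n.
have tr (t : R) : 0 <= t <= x -> `|t| < r.
  by move=> /andP[t0 tx]; rewrite ger0_norm// (le_lt_trans tx).
have cp : {within `[0, x], continuous p}.
  by apply: derivable_within_continuous => t /[!in_itv]/= /tr/dp[].
have [|c] := @MVT R p (fun t => derive1 g t - b / n`!%:R * t ^+ n) 0 x x0 _ cp.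
  by move=> t /[!in_itv]/= /andP[t0 tx]; apply/dp/tr; rewrite !ltW.
rewrite in_itv/= => /andP[c0 cx]; rewrite {1 2}/p expr0n/= mulr0 !subr0.
have := vg 0%N isT; rewrite /= => ->; rewrite subr0 => ->.
rewrite normrM (gtr0_norm x0) exprSr mulrA ler_wpM2r ?(ltW x0)//.
apply: (le_trans (H _ _)); first by rewrite (ltW c0) (lt_trans cx).
by rewrite ler_wpM2l ?(ltW eta0)// lerXn2r ?nnegrE ?ltW// (lt_trans c0).
Qed.

(** The mean value theorem gives [sin x = x cos c]. *)
Lemma sin_sqr_mvt (R : realType) (x : R) : 0 <= x ->
  exists c : R, 0 <= c <= x /\ sin x ^+ 2 = x ^+ 2 - sin c ^+ 2 * x ^+ 2.
Proof.
rewrite le_eqVlt => /predU1P[<-|x0].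
  by exists 0; rewrite lexx sin0 expr0n/= mul0r subr0.
have cs : {within `[0, x], continuous (@sin R)}.
  by apply: continuous_subspaceT; exact: continuous_sin.
have [c] := @MVT R (@sin R) (@cos R) 0 x x0 (fun y _ => is_derive_sin y) cs.
rewrite in_itv/= => /andP[c0 cx]; rewrite sin0 !subr0 => sE.
exists c; rewrite !ltW//; split => //.
by rewrite sE exprMn cos2sin2 mulrBl mul1r.
Qed.

Lemma sin_sqr_expansion (R : realType) (x eta : R) : 0 <= x -> x ^+ 2 <= eta ->
  `|sin x ^+ 2 - x ^+ 2| <= eta * x ^+ 2.
Proof.
move=> x0 xe; have [c [/andP[c0 cx] ->]] := sin_sqr_mvt x0.
rewrite addrAC subrr sub0r normrN ger0_norm; last by apply: mulr_ge0; exact: sqr_ge0.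
rewrite ler_wpM2r ?sqr_ge0// (le_trans _ xe)//.
have [c' [_ ->]] := sin_sqr_mvt c0.
have h : 0 <= sin c' ^+ 2 * c ^+ 2 by apply: mulr_ge0; exact: sqr_ge0.
have : c ^+ 2 <= x ^+ 2 by rewrite lerXn2r ?nnegrE.
by move: h; lra.
Qed.

Section asymptotics.
Context {R : realType}.
Variables (w : R -> R -> R) (k l : nat).
Hypotheses (hw : scaling_function w) (hk : (2 <= k)%N).
Let f := w 1.
Hypothesis van : vanishes_to_order (2 * l) (fun Z => f Z - 1) 0.

(** The leading coefficient is positive because [f > 1] off the waist. *)
Lemma profile_expansion : exists2 a : R, 0 < a &
  forall eta : R, 0 < eta -> exists2 del : R, 0 < del &
    forall Z : R, 0 <= Z < del -> `|f Z - 1 - a * Z ^+ (2 * l)| <= eta * Z ^+ (2 * l).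
Proof.
have [r r0 dr'] := scaling_smooth 0 hw ltr01.
have dr (j : nat) (x : R) : `|x| < r -> derivable (derive1n j f) x 1.
  by move=> xr; apply: dr'; rewrite sub0r normrN.
pose g Z : R := f Z - 1.
have gE : derive1 g = derive1 f.
  apply/funext => x; rewrite !derive1E deriveB; last 2 first.
  - exact: profile_derivable.
  - exact: derivable_cst.
  by rewrite derive_cst subr0.
have dg (j : nat) (x : R) : `|x| < r -> derivable (derive1n j g) x 1.
  case: j => [|j] xr; last by rewrite derive1Sn gE -derive1Sn; exact: dr.
  by apply: derivableB; [exact: profile_derivable|exact: derivable_cst].
have [v0 vn] : vanishes_to_order (2 * l) g 0 := van.
have H := vanishing_expansion r0 dg v0.
set a := _ / _ in H.
exists a; last exact: H.
have an : a != 0 by rewrite mulf_neq0 ?invr_eq0 ?pnatr_eq0 -?lt0n ?fact_gt0//; exact/eqP.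
rewrite lt_neqAle eq_sym an leNgt; apply/negP => a_neg.
have [|del del0 /(_ (del / 2)) h] := H (- a); first by rewrite oppr_gt0.
have Z0 : 0 < del / 2 by rewrite divr_gt0.
have {}h := h (_ : 0 <= del / 2 < del); have {}h := h ltac:(apply/andP; split; lra).
have := profile_gt1 hw Z0; rewrite -/f => f1.
have := le_trans (ler_norm _) h; rewrite /g; lra.
Qed.

(** [f^(2k) - 1] is [f - 1] times a sum of [2k] powers of [f], each of which tends
    to 1. *)
Lemma radicand_expansion : exists2 b : R, 0 < b &
  forall eta : R, 0 < eta -> exists2 del : R, 0 < del &
    forall Z : R, 0 <= Z < del ->
      `|f Z ^+ (2 * k) - 1 - b * Z ^+ (2 * l)| <= eta * (b * Z ^+ (2 * l)).
Proof.
have [a a0 H] := profile_expansion.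
have k0 : 0 < (2 * k)%:R :> R by rewrite ltr0n muln_gt0 (leq_trans _ hk).
exists ((2 * k)%:R * a); first exact: mulr_gt0.
move=> eta eta0; set K := (2 * k)%:R in k0 *.
pose S (Z : R) : R := \sum_(i < 2 * k) f Z ^+ i.
have S0 : S 0 = K.
  rewrite /S (eq_bigr (fun=> 1)); last by move=> i _; rewrite /f profile0// expr1n.
  by rewrite sumr_const card_ord.
have cS : {for 0, continuous S}.
  apply: cvg_bigsum => i.
  apply: (@continuous_comp _ _ _ f (fun x => x ^+ i)); last exact: exprn_continuous.
  exact: profile_continuous.
(* e1 and e2 each use up half of the admissible error *)
pose e1 := eta * K / 2; have e10 : 0 < e1 by rewrite !mulr_gt0// invr_gt0.
have /cvgrPdist_le/(_ _ e10)/nbhs_ballP[d1 /= d10 H1] := cS.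
pose e2 := eta * (K * a) / 2 / (K + e1).
have e20 : 0 < e2 by rewrite !mulr_gt0 ?invr_gt0// addr_gt0.
have [d2 d20 H2] := H _ e20.
exists (Num.min d1 d2); first by rewrite lt_min d10.
move=> Z /andP[Z0]; rewrite lt_min => /andP[Z1 Z2].
have {}H2 := H2 Z (introT andP (conj Z0 Z2)).
have {}H1 : `|K - S Z| <= e1 by rewrite -S0; apply: H1; rewrite /ball/= sub0r normrN ger0_norm.
rewrite subrX1 -/(S Z).
set X := Z ^+ (2 * l) in H2 *; have X0 : 0 <= X by rewrite exprn_ge0.
have -> : (f Z - 1) * S Z - K * a * X = (f Z - 1 - a * X) * S Z + a * X * (S Z - K) by ring.
rewrite (le_trans (ler_normD _ _))// !normrM (gtr0_norm a0) (ger0_norm X0) [`|S Z - K|]distrC.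
have SK : `|S Z| <= K + e1.
  by have := ler_norm (K - S Z); move: H1; rewrite ler_norml => /andP[h1 h2] _; rewrite ler_norml; apply/andP; split; lra.
apply: (@le_trans _ _ (e2 * X * (K + e1) + a * X * e1)).
  apply: lerD; first exact: ler_pM.
  by apply: ler_wpM2l => //; apply: mulr_ge0 => //; exact: ltW.
have -> : e2 * X * (K + e1) = eta * (K * a) / 2 * X.
  by rewrite mulrAC /e2 divfK// gt_eqF// addr_gt0.
by rewrite /e1; lra.
Qed.

End asymptotics.

Lemma inv_close (R : realType) (eta s y : R) : 0 <= eta <= 4^-1 -> 0 < s ->
  (1 - eta) * s <= y <= (1 + eta) ^+ 2 * s -> `|y^-1 - s^-1| <= 3 * eta * s^-1.
Proof.
move=> /andP[t0 t1] s0 /andP[y1 y2].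
have e1 : 0 < 1 - eta by lra.
have y0 : 0 < y by rewrite (lt_le_trans _ y1)// mulr_gt0.
have -> : y^-1 - s^-1 = (s - y) / y * s^-1 by field; rewrite !gt_eqF.
rewrite normrM [`|s^-1|]gtr0_norm ?invr_gt0// ler_wpM2r ?invr_ge0 ?(ltW s0)//.
rewrite normrM normfV (gtr0_norm y0) ler_pdivrMr// ler_norml; apply/andP; split.
- have h1 : y * (1 - 3 * eta) <= (1 + eta) ^+ 2 * s * (1 - 3 * eta).
    by rewrite ler_wpM2r//; lra.
  have h2 : (1 + eta) ^+ 2 * (1 - 3 * eta) <= 1 by nra.
  have := ler_wpM2r (ltW s0) h2; lra.
- have h1 : (1 - eta) * s * (1 + 3 * eta) <= y * (1 + 3 * eta).
    by rewrite ler_wpM2r//; lra.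
  have h2 : 1 <= (1 - eta) * (1 + 3 * eta) by nra.
  have := ler_wpM2r (ltW s0) h2; lra.
Qed.

Section comparison.
Context {R : realType}.
Variables (w : R -> R -> R) (k l : nat) (m b : R).
Hypotheses (hw : scaling_function w) (hk : (2 <= k)%N) (m0 : 0 < m).
Hypothesis hm : forall e z : R, 0 < e -> 0 <= z -> m * (e + z) <= w e z.
Hypothesis b0 : 0 < b.
Let f := w 1.
Hypothesis rad : forall eta : R, 0 < eta -> exists2 del : R, 0 < del &
    forall Z : R, 0 <= Z < del ->
      `|f Z ^+ (2 * k) - 1 - b * Z ^+ (2 * l)| <= eta * (b * Z ^+ (2 * l)).

(** The leading part of the integrand near [Z = 0], since
    [f^(2k) - cos^2 phi = sin^2 phi + (f^(2k) - 1)]. *)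
Definition model (phi Z : R) : R := (Num.sqrt (phi ^+ 2 + b * Z ^+ (2 * l)))^-1.

Lemma kernel_model (eta : R) : 0 < eta <= 4^-1 -> exists del phi0 : R,
  [/\ 0 < del, 0 < phi0 & forall phi Z : R, 0 < phi < phi0 -> 0 <= Z <= del ->
    `|kernel w k (cos phi) Z - model phi Z| <= 3 * eta * model phi Z].
Proof.
move=> /andP[t0 t1]; have [d1 d10 H] := rad t0.
have cfk : {for (0 : R), continuous (fun Z : R => f Z ^+ k)}.
  apply: (@continuous_comp _ _ _ f (fun x => x ^+ k)); last exact: exprn_continuous.
  exact: profile_continuous.
have /cvgrPdist_le/(_ _ t0)/nbhs_ballP[d2 /= d20 H2] := cfk.
have md : 0 < Num.min d1 d2 by rewrite lt_min d10.
exists (Num.min d1 d2 / 2), eta; split => //; first by rewrite divr_gt0.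
move=> phi Z /andP[p0 p1] /andP[Z0 Zd].
have Zm : Z < Num.min d1 d2 by rewrite (le_lt_trans Zd)//; lra.
move: Zm; rewrite lt_min => /andP[Z1 Z2].
have {}H := H Z (introT andP (conj Z0 Z1)).
have {}H2 : `|1 - f Z ^+ k| <= eta.
  have := H2 Z; rewrite /f profile0// expr1n; apply.
  by rewrite /ball/= sub0r normrN ger0_norm.
rewrite /kernel (ger0_norm Z0) -/f.
have F1 : 1 <= f Z ^+ k by rewrite exprn_ege1// profile_ge1.
have F2 : f Z ^+ k <= 1 + eta by have := ler_norm (f Z ^+ k - 1); rewrite distrC; lra.
have pe : phi ^+ 2 <= eta by rewrite expr2 (le_trans (ler_wpM2l (ltW p0) (ltW p1)))// ler_piMl; lra.
have sphi := sin_sqr_expansion (ltW p0) pe.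
rewrite /model; set q := phi ^+ 2 + b * Z ^+ (2 * l).
have Zl : 0 <= b * Z ^+ (2 * l) by rewrite mulr_ge0 ?exprn_ge0 ?(ltW b0).
have q0 : 0 < q by rewrite ltr_wpDr// exprn_gt0.
set Dd := f Z ^+ (2 * k) - cos phi ^+ 2.
have Dq : `|Dd - q| <= eta * q.
  have -> : Dd - q = (sin phi ^+ 2 - phi ^+ 2) + (f Z ^+ (2 * k) - 1 - b * Z ^+ (2 * l)).
    by rewrite /Dd /q cos2sin2; ring.
  by rewrite /q mulrDr (le_trans (ler_normD _ _))// lerD.
move: Dq; rewrite ler_norml => /andP[Dq1 Dq2].
have sq0 : 0 < Num.sqrt q by rewrite sqrtr_gt0.
have sc (x : R) : 0 <= x -> x * Num.sqrt q = Num.sqrt (x ^+ 2 * q).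
  by move=> x0; rewrite sqrtrM ?sqr_ge0// sqrtr_sqr ger0_norm.
apply: inv_close => //; first by rewrite (ltW t0).
apply/andP; split.
  apply: (@le_trans _ _ (Num.sqrt Dd)); last by rewrite ler_peMl ?sqrtr_ge0.
  rewrite sc; last lra.
  rewrite ler_wsqrtr// (le_trans (_ : _ <= (1 - eta) * q))//; last lra.
  by rewrite ler_wpM2r ?(ltW q0)// expr2 ler_piMl; lra.
rewrite expr2 -mulrA ler_pM ?sqrtr_ge0//; first by rewrite (le_trans _ F1).
rewrite sc; last lra.
rewrite ler_wsqrtr// (le_trans (_ : _ <= (1 + eta) * q))//; first lra.
by rewrite ler_wpM2r ?(ltW q0)// expr2 ler_peMl; lra.
Qed.

(** Beyond [del] the radicand is at least the fraction [s^2] of [f^(2k)], for every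
    angle, so that part of the integral is bounded.  The part below [del] is
    squeezed with a primitive [J] of the model. *)
Lemma Cconst_model (eta : R) : 0 < eta <= 4^-1 -> exists del phi0 B : R,
  [/\ 0 < del, 0 < phi0, 0 <= B & forall (phi : R) (J : R -> R), 0 < phi < phi0 ->
    (forall Z : R, 0 <= Z <= del -> is_derive Z 1 J (model phi Z)) ->
    `|Cconst k f phi - (J del - J 0)| <= 3 * eta * (J del - J 0) + B].
Proof.
move=> teta; have [del [phi0 [d0 p00 H]]] := kernel_model teta.
pose s := Num.sqrt (1 - f del ^- (2 * k)).
have fd : 1 < f del by exact: profile_gt1.
have fd0 : 0 < f del by exact: lt_trans fd.
have fdk : f del ^- (2 * k) < 1.
  by rewrite invf_lt1 ?exprn_gt0// exprn_egt1// muln_eq0 negb_or/= -lt0n (leq_trans _ hk).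
have s0 : 0 < s by rewrite sqrtr_gt0 subr_gt0.
have B0 : 0 < (m ^+ (2 * k) * s)^-1 by rewrite invr_gt0 mulr_gt0 ?exprn_gt0.
have p2 : 0 < pi / 2 :> R by rewrite divr_gt0// pi_gt0.
exists del, (Num.min phi0 (pi / 2)), ((m ^+ (2 * k) * s)^-1 / (1 + del)); split => //.
- by rewrite lt_min p00.
- by apply: divr_ge0; [exact: ltW|apply: addr_ge0 => //; exact: ltW].
move=> phi J /andP[f0]; rewrite lt_min => /andP[f1 f2] dJ.
have c0 : 0 <= cos phi by rewrite cos_ge0_pihalf// (ltW f2) andbT; lra.
have c1 : cos phi < 1.
  by rewrite -[ltRHS]cos0 ltr_cos// in_itv/= ?lexx ?(ltW f0) ?pi_ge0//=; lra.
have dlt0 : 0 < 1 - cos phi by rewrite subr_gt0.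
have cdlt : cos phi <= 1 - (1 - cos phi) by rewrite subKr.
have kc := kernel_continuous hw c0 dlt0 cdlt (k := k).
have iK := quadratic_decay_integrable kc (kernel_decay hw hk m0 hm c0 dlt0 cdlt).
have tail : forall Z, del <= Z ->
    0 <= kernel w k (cos phi) Z <= (m ^+ (2 * k) * s)^-1 * (1 + Z) ^- 2.
  move=> Z Zd; have Z0 : 0 <= Z by rewrite (le_trans (ltW d0)).
  apply: (kernel_decay_at hw hk m0 hm c0 dlt0 cdlt) => //.
  have fZ : f del <= f Z by apply: profile_nondecreasing => //; exact: ltW.
  have cc : cos phi ^+ 2 <= 1 by rewrite expr_le1// ltW.
  rewrite sqr_sqrtr ?subr_ge0 ?(ltW fdk)// mulrBl mul1r lerB//.
  rewrite (le_trans cc)// mulrC ler_pdivlMr ?exprn_gt0// mul1r.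
  by rewrite lerXn2r ?nnegrE ?(ltW fd0)// (le_trans (ltW fd0)).
have := quadratic_decay_tail iK (ltW d0) tail; rewrite -(Cconst_kernel _ _ (erefl (cos phi))) -/f.
have q0 (Z : R) : 0 <= Z -> 0 < phi ^+ 2 + b * Z ^+ (2 * l).
  by move=> Z0; rewrite ltr_wpDr ?exprn_gt0// mulr_ge0 ?exprn_ge0 ?(ltW b0).
have inD (Z : R) : Z \in `[0, del]%classic -> 0 <= Z <= del by rewrite inE/= in_itv.
have cJ : {within `[0, del], continuous J}.
  by apply: derivable_within_continuous => Z; rewrite in_itv/= => /dJ[].
have cM : {within `[0, del], continuous (model phi)}.
  apply: continuous_in_subspaceT => Z /inD/andP[Z0 _].
  apply: cvgV; first by rewrite gt_eqF// sqrtr_gt0 q0.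
  apply: (@continuous_comp _ _ _ (fun Z : R => phi ^+ 2 + b * Z ^+ (2 * l)) Num.sqrt); last exact: sqrt_continuous.
  by apply: cvgD; [exact: cvg_cst|apply: cvgM; [exact: cvg_cst|exact: exprn_continuous]].
have cE : {within `[0, del], continuous (3 * eta \*: J)}.
  by apply: derivable_within_continuous => Z; rewrite in_itv/= => /dJ[dJZ _]; exact: derivableZ.
have cdE : {within `[0, del], continuous (3 * eta \*: model phi)}.
  by move=> Z; apply: cvgM; [exact: cvg_cst|exact: cM].
have oc (x : R) : 0 < x < del -> 0 <= x <= del by move=> /andP[x0 xT]; rewrite !ltW.
have dE (x : R) : 0 < x < del -> is_derive x 1 (3 * eta \*: J) (3 * eta * model phi x).
  by move=> /oc/dJ dJx; exact: is_deriveZ.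
have hG (Z : R) : 0 <= Z <= del -> 0 <= kernel w k (cos phi) Z /\
    `|kernel w k (cos phi) Z - model phi Z| <= 3 * eta * model phi Z.
  move=> hZ; split; last by apply: H; rewrite ?f0.
  by have /andP[Z0 _] := hZ; have /andP[] := kernel_decay hw hk m0 hm c0 dlt0 cdlt Z0.
have := @integral_sandwich R (kernel w k (cos phi)) J (3 * eta \*: J) (model phi) (3 * eta \*: model phi) del d0
  cM cJ (fun x hx => dJ x (oc x hx)) cdE cE dE hG.
rewrite /= -![_ *: _]/(_ * _) => /ler_normlP[h1 h2] /andP[h3 h4].
by rewrite ler_norml; apply/andP; split; lra.
Qed.

End comparison.

Lemma ratio_cvg1 (R : realType) (X A : R -> R) :
  (forall eps : R, 0 < eps -> exists2 phi1 : R, 0 < phi1 &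
     forall phi : R, 0 < phi < phi1 -> 0 < A phi /\ `|X phi - A phi| <= eps * A phi) ->
  X phi / A phi @[phi --> 0^'+] --> (1 : R).
Proof.
move=> H; apply/cvgrPdist_le => eps e0; have [p1 p10 Hp] := H eps e0.
near=> phi; have [|A0 XA] := Hp phi.
  by apply/andP; split; near: phi; [exact: nbhs_right_gt|exact: nbhs_right_lt].
have -> : 1 - X phi / A phi = (A phi - X phi) / A phi by field; rewrite gt_eqF.
by rewrite normrM normfV (gtr0_norm A0) ler_pdivrMr// distrC.
Unshelve. all: by end_near. Qed.

Section laws.
Context {R : realType}.
Variables (l : nat) (b : R).
Hypothesis b0 : 0 < b.

(** The model at angle 1, to which every angle is reduced by [model_scaling]. *)
Definition shape (x : R) : R := model l b 1 x.

Lemma shape_radicand (x : R) : 0 < 1 + b * x ^+ (2 * l).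
Proof. by rewrite ltr_wpDr// mulr_ge0 ?(ltW b0)// exprM exprn_ge0// sqr_ge0. Qed.

Lemma shapeE (x : R) : shape x = (Num.sqrt (1 + b * x ^+ (2 * l)))^-1.
Proof. by rewrite /shape /model expr1n. Qed.

Lemma shape_gt0 (x : R) : 0 < shape x.
Proof. by rewrite shapeE invr_gt0 sqrtr_gt0 shape_radicand. Qed.

Lemma shape_continuous : continuous shape.
Proof.
move=> x; rewrite (_ : shape = fun x => (Num.sqrt (1 + b * x ^+ (2 * l)))^-1); last first.
  by apply/funext => y; exact: shapeE.
apply: cvgV; first by rewrite gt_eqF// sqrtr_gt0 shape_radicand.
apply: (@continuous_comp _ _ _ (fun Z : R => 1 + b * Z ^+ (2 * l)) Num.sqrt); last exact: sqrt_continuous.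
by apply: cvgD; [exact: cvg_cst|apply: cvgM; [exact: cvg_cst|exact: exprn_continuous]].
Qed.

Lemma model_scaling (s Z : R) : (0 < l)%N -> 0 < s ->
  model l b (s ^+ l) Z = (s ^+ l)^-1 * shape (Z / s).
Proof.
move=> l0 s0; rewrite shapeE /model -invfM; congr (_^-1).
have sl : 0 < s ^+ l by rewrite exprn_gt0.
rewrite -[X in X * Num.sqrt _](ger0_norm (ltW sl)) -sqrtr_sqr -sqrtrM ?sqr_ge0//; congr Num.sqrt.
rewrite expr_div_n mulrDr mulr1; congr (_ + _).
have -> : (s ^+ l) ^+ 2 = s ^+ (2 * l) by rewrite -exprM mulnC.
by rewrite mulrCA [X in _ = _ * X]mulrC divfK// gt_eqF// exprn_gt0.
Qed.

Lemma model_primitive (Psi : R -> R) (s : R) : (0 < l)%N -> 0 < s ->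
  (forall x : R, 0 <= x -> is_derive x 1 Psi (shape x)) ->
  forall Z : R, 0 <= Z ->
    is_derive Z 1 (fun Z => s / s ^+ l * Psi (Z / s)) (model l b (s ^+ l) Z).
Proof.
move=> l0 s0 dP Z Z0.
have h1 : is_derive Z 1 (fun Z => Z / s) s^-1.
  rewrite (_ : (fun Z => Z / s) = s^-1 \*: (id : R -> R)); last by apply/funext => x; rewrite /= mulrC.
  by apply: (is_derive_eq (is_deriveZ s^-1 (is_derive_id Z (1 : R)))); rewrite -[_ *: _]/(_ * _) mulr1.
have Zs : 0 <= Z / s by rewrite divr_ge0// ltW.
have h2 := @is_derive1_comp R Psi (fun Z => Z / s) Z _ _ (dP _ Zs) h1.
apply: (is_derive_eq (is_deriveZ (s / s ^+ l) h2)).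
rewrite model_scaling// -![_ *: _]/(_ * _); field.
by rewrite !gt_eqF ?exprn_gt0.
Qed.

Lemma shape_decay (x : R) : (1 < l)%N -> 0 <= x ->
  0 <= shape x <= (4 + 4 / Num.sqrt b) * (1 + x) ^- 2.
Proof.
move=> l1 x0; rewrite (ltW (shape_gt0 x))/= shapeE.
have sb : 0 < Num.sqrt b by rewrite sqrtr_gt0.
have X0 : 0 < Num.sqrt (1 + b * x ^+ (2 * l)) by rewrite sqrtr_gt0 shape_radicand.
have bx : 0 <= b * x ^+ (2 * l) by rewrite mulr_ge0 ?exprn_ge0// ltW.
have x1 : 0 < (1 + x) ^+ 2 by rewrite exprn_gt0// ltr_wpDr.
rewrite ler_pdivlMr// mulrC ler_pdivrMr//.
have [xs|xl] := leP x 1.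
- have h : 1 <= Num.sqrt (1 + b * x ^+ (2 * l)).
    by rewrite -[leLHS]sqrtr1 ler_wsqrtr// lerDl.
  have h2 : (1 + x) ^+ 2 <= 4 by nra.
  have h3 : 0 <= 4 / Num.sqrt b by rewrite divr_ge0// ltW.
  rewrite (le_trans h2)// -[leLHS]mulr1 ler_pM//; lra.
- have h : Num.sqrt b * x ^+ 2 <= Num.sqrt (1 + b * x ^+ (2 * l)).
    apply: (@le_trans _ _ (Num.sqrt b * x ^+ l)).
      by rewrite ler_wpM2l ?(ltW sb)// ler_weXn2l// ltW.
    rewrite -[x ^+ l]ger0_norm ?exprn_ge0// -sqrtr_sqr -sqrtrM ?(ltW b0)// ler_wsqrtr//.
    by rewrite -exprM mulnC lerDr.
  have h2 : (1 + x) ^+ 2 <= 4 * x ^+ 2 by nra.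
  rewrite (le_trans h2)// [leRHS]mulrDl.
  have -> : 4 * x ^+ 2 = 4 / Num.sqrt b * (Num.sqrt b * x ^+ 2) by field; rewrite gt_eqF.
  rewrite (le_trans (ler_wpM2l _ h))// ?lerDr ?mulr_ge0 ?ltW//.
Qed.

Lemma shape_integral : (1 < l)%N -> exists (Psi : R -> R) (Kinf K0 : R),
  [/\ 0 < Kinf, 0 < K0, forall x : R, 0 <= x -> is_derive x 1 Psi (shape x) &
   forall x : R, 0 <= x -> Psi x - Psi 0 <= Kinf <= Psi x - Psi 0 + K0 / (1 + x)].
Proof.
move=> l1; have [Psi dPsi] := primitive_exists shape_continuous.
have dP (x : R) : 0 <= x -> is_derive x 1 Psi (shape x).
  by move=> x0; apply: dPsi; rewrite (lt_le_trans _ x0).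
pose K0 := 4 + 4 / Num.sqrt b.
have K00 : 0 < K0 by rewrite addr_gt0// divr_gt0// sqrtr_gt0.
pose Kinf := \int[mu]_(x in `[0, +oo[) shape x.
have dec (x : R) := @shape_decay x l1.
have iS := quadratic_decay_integrable shape_continuous dec.
have cP (x : R) : {within `[0, x], continuous Psi}.
  by apply: derivable_within_continuous => y /[!in_itv]/= /andP[/dP[]].
have B (x : R) : 0 <= x -> Psi x - Psi 0 <= Kinf <= Psi x - Psi 0 + K0 / (1 + x).
  rewrite le_eqVlt => /predU1P[<-|x0].
    rewrite subrr add0r; have := quadratic_decay_tail iS (lexx 0) dec.
    by rewrite set_itv1 Rintegral_set1 add0r.
  have := quadratic_decay_tail iS (ltW x0) (fun Z hZ => dec Z (le_trans (ltW x0) hZ)).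
  have dPo (y : R) : 0 < y < x -> is_derive y 1 Psi (shape y) by move=> /andP[/ltW/dP].
  have -> // : \int[mu]_(t in `[0, x]) shape t = Psi x - Psi 0.
  by rewrite /Rintegral (FTC2_within x0 (continuous_subspaceT shape_continuous) (cP x) dPo).
exists Psi, Kinf, K0; split => //.
have /andP[h _] := B 1 ler01; rewrite (lt_le_trans _ h)// subr_gt0.
have dPo (y : R) : y \in `]0, 1[ -> is_derive y 1 Psi (shape y).
  by rewrite in_itv/= => /andP[/ltW/dP].
have [c _ E] := @MVT R Psi shape 0 1 ltr01 dPo (cP 1).
by rewrite -subr_gt0 E subr0 mulr1 shape_gt0.
Qed.

End laws.

Lemma log_primitive (R : realType) (b phi Z : R) : 0 < b -> 0 < phi ->
  is_derive Z 1 (fun Z => (Num.sqrt b)^-1 *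
    ln (Num.sqrt b * Z + Num.sqrt (phi ^+ 2 + b * Z ^+ 2))) (model 1 b phi Z).
Proof.
move=> b0 p0; set s := Num.sqrt b.
have s0 : 0 < s by rewrite sqrtr_gt0.
have bE : b = s ^+ 2 by rewrite sqr_sqrtr// ltW.
pose q (Z : R) := phi ^+ 2 + b * Z ^+ 2.
have q0 : 0 < q Z by rewrite ltr_wpDr ?exprn_gt0// mulr_ge0 ?sqr_ge0// ltW.
have sq0 : 0 < Num.sqrt (q Z) by rewrite sqrtr_gt0.
have dq : is_derive Z 1 q (2 * b * Z).
  have h2 : is_derive Z 1 (fun t : R => t ^+ 2) (2 * Z).
    have -> : (fun t : R => t ^+ 2) = (id : R -> R) ^+ 2.
      by apply/funext => t; rewrite exprfctE.
    by apply: (is_derive_eq (is_deriveX 2 (is_derive_id Z (1 : R)))); rewrite -[_ *: _]/(_ * _) mulr1.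
  apply: (is_derive_eq (is_deriveD (is_derive_cst (phi ^+ 2) Z (1 : R)) (is_deriveZ b h2))).
  by rewrite -[_ *: _]/(_ * _); ring.
have dsq : is_derive Z 1 (fun Z => Num.sqrt (q Z)) (b * Z / Num.sqrt (q Z)).
  have h := @is_derive1_comp R Num.sqrt q Z _ _ (is_derive1_sqrt q0) dq.
  by apply: (is_derive_eq h); field; rewrite gt_eqF.
have dl : is_derive Z 1 (fun Z : R => s * Z) s.
  by apply: (is_derive_eq (is_deriveZ s (is_derive_id Z (1 : R)))); rewrite -[_ *: _]/(_ * _) mulr1.
pose h (Z : R) := s * Z + Num.sqrt (q Z).
have dh : is_derive Z 1 h (s + b * Z / Num.sqrt (q Z)) by exact: is_deriveD.
have h0 : 0 < h Z.
  have : `|s * Z| < Num.sqrt (q Z).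
    by rewrite -sqrtr_sqr ltr_sqrt// exprMn -bE /q ltrDr exprn_gt0.
  by rewrite /h ltr_norml => /andP[h1 _]; move: h1; lra.
have H := is_deriveZ s^-1 (@is_derive1_comp R (@ln R) h Z _ _ (is_derive1_ln h0) dh).
apply: (is_derive_eq H); rewrite -[_ *: _]/(_ * _) /model muln1 -/(q Z).
have -> : s + b * Z / Num.sqrt (q Z) = s * h Z / Num.sqrt (q Z).
  by rewrite /h bE; field; rewrite gt_eqF.
by field; rewrite !gt_eqF.
Qed.

Section laws.
Context {R : realType}.
Variables (w : R -> R -> R) (k l : nat).
Hypotheses (hw : scaling_function w) (hk : (2 <= k)%N).
Hypothesis van : vanishes_to_order (2 * l) (fun Z => w 1 Z - 1) 0.

(** With [s^l = phi], the integral of the model over [[0, del]] is [s / phi] times a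
    factor that tends to [Kinf] at the rate [O (s)].  As [s / phi >= 1 / s], the
    bounded error is also small compared with [s / phi]. *)
Lemma Cconst_power_law : (1 < l)%N -> exists2 C : R, 0 < C &
  Cconst k (w 1) phi / (C * phi `^ (- ((l%:R - 1) / l%:R))) @[phi --> 0^'+] --> (1 : R).
Proof.
move=> l1; have l0 := ltnW l1; have [m m0 hm] := scaling_lower hw.
have [b b0 rad] := radicand_expansion hw hk van.
have [Psi [Kinf [K0 [Kinf0 K00 dP PB]]]] := shape_integral b0 l1.
exists Kinf => //; apply: ratio_cvg1 => eps e0.
(* 3 eta <= 3 eps / 8 leaves half of eps to the bounded error *)
pose eta := Num.min 4^-1 (eps / 8).
have eta4 : 0 < eta <= 4^-1.
  by rewrite lt_min invr_gt0 divr_gt0// ge_min lexx/= ltr0n.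
have eta8 : eta <= eps / 8 by rewrite ge_min lexx orbT.
have [del [phi0 [B [d0 p00 B0 HC]]]] := Cconst_model hw hk m0 hm b0 rad eta4.
pose N := B + K0 / del; have N0 : 0 < N by rewrite ltr_wpDl// divr_gt0.
(* s <= tau makes the error N s at most the fraction eps / 2 of Kinf *)
pose tau := Num.min 1 (eps * Kinf / (2 * N)).
have t0 : 0 < tau by rewrite lt_min ltr01 divr_gt0// mulr_gt0.
exists (Num.min phi0 (tau ^+ l)); first by rewrite lt_min p00 exprn_gt0.
move=> phi /andP[f0]; rewrite lt_min => /andP[f1 f2].
pose s := phi `^ l%:R^-1.
have s0 : 0 < s by exact: powR_gt0.
have lR : l%:R != 0 :> R by rewrite pnatr_eq0 -lt0n.
have sl : s ^+ l = phi.
  by rewrite -powR_mulrn ?(ltW s0)// /s -powRrM mulVf// powRr1// ltW.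
have st : s < tau.
  by move: f2; rewrite -sl ltr_pXn2r// nnegrE ltW.
have s1 : s <= 1 by rewrite (le_trans (ltW st))// ge_min lexx.
have As : phi `^ (- ((l%:R - 1) / l%:R)) = s / phi.
  have <- : phi `^ (l%:R^-1 - 1) = s / phi.
    by rewrite powRB ?powRr1 ?(ltW f0)// (gt_eqF f0) implybT.
  by congr (_ `^ _); field.
rewrite As; have sp0 : 0 < s / phi by rewrite divr_gt0.
split; first exact: mulr_gt0.
pose J (Z : R) := s / s ^+ l * Psi (Z / s).
have dJ (Z : R) : 0 <= Z <= del -> is_derive Z 1 J (model l b phi Z).
  by move=> /andP[Z0 _]; rewrite -sl; exact: model_primitive.
have := HC phi J (introT andP (conj f0 f1)) dJ.
rewrite /J sl mul0r -mulrBr; set X := Cconst _ _ _.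
have ds0 : 0 <= del / s by rewrite divr_ge0// ltW.
have /andP[] := PB _ ds0; set P := Psi (del / s) - Psi 0 => P1 P2 HX.
set A := s / phi in sp0 HX *.
have e1 : 0 <= A * (Kinf - P) <= A * (K0 / del * s).
  rewrite mulr_ge0 ?(ltW sp0) ?subr_ge0//= ler_wpM2l ?(ltW sp0)// lerBlDl.
  rewrite (le_trans P2)// lerD2l -mulrA ler_wpM2l ?(ltW K00)//.
  rewrite -[leRHS]invrK lef_pV2 ?posrE ?invr_gt0 ?mulr_gt0 ?invr_gt0//; last by rewrite ltr_wpDr.
  by rewrite invfM invrK lerDr.
have e2 : B <= A * (B * s).
  have -> : A * (B * s) = B * (s ^+ 2 / phi) by rewrite /A; ring.
  rewrite ler_peMr// ler_pdivlMr// mul1r -sl ler_wiXn2l ?(ltW s0)//.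
have e3 : A * (N * s) <= eps / 2 * (Kinf * A).
  have : s <= eps * Kinf / (2 * N) by rewrite (le_trans (ltW st))// ge_min lexx orbT.
  rewrite ler_pdivlMr ?mulr_gt0// => h.
  have := ler_wpM2l (ltW sp0) h; lra.
have e4 : 3 * eta * (A * P) <= 3 / 8 * eps * (Kinf * A).
  have h1 : A * P <= Kinf * A by rewrite mulrC ler_wpM2r// ltW.
  have h2 : 0 <= Kinf * A by apply: mulr_ge0; exact: ltW.
  apply: (@le_trans _ _ (3 * eta * (Kinf * A))).
    by rewrite ler_wpM2l// mulr_ge0//; have /andP[/ltW] := eta4.
  by rewrite ler_wpM2r//; lra.
have e5 : 0 <= eps * (Kinf * A) by apply: mulr_ge0; [exact: ltW|apply: mulr_ge0; exact: ltW].
move: HX e3 e1; rewrite /N !ler_norml => /andP[h1 h2] h3 /andP[h4 h5].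
by apply/andP; split; lra.
Qed.

(** The primitive of [log_primitive] is bounded at [del] and equals
    [ln phi / sqrt b] at 0, so [1 / sqrt b] is the constant. *)
Lemma Cconst_log_law : l = 1%N -> exists2 C : R, 0 < C &
  Cconst k (w 1) phi / (C * ln phi^-1) @[phi --> 0^'+] --> (1 : R).
Proof.
move=> l1; have [m m0 hm] := scaling_lower hw.
have [b b0 rad] := radicand_expansion hw hk van.
set s := Num.sqrt b; have s0 : 0 < s by rewrite sqrtr_gt0.
have si0 : 0 < s^-1 by rewrite invr_gt0.
exists s^-1 => //; apply: ratio_cvg1 => eps e0.
(* 3 eta <= 3 eps / 8 leaves half of eps to the bounded error *)
pose eta := Num.min 4^-1 (eps / 8).
have eta4 : 0 < eta <= 4^-1.
  by rewrite lt_min invr_gt0 divr_gt0// ge_min lexx/= ltr0n.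
have eta8 : eta <= eps / 8 by rewrite ge_min lexx orbT.
have [del [phi0 [B [d0 p00 B0 HC]]]] := Cconst_model hw hk m0 hm b0 rad eta4.
have sd0 : 0 < s * del by rewrite mulr_gt0.
pose L := `|ln (s * del)| + `|ln (2 * (s * del) + 1)|.
pose N := B + 2 * (s^-1 * L).
have L0 : 0 <= L by rewrite addr_ge0.
have N0 : 0 <= N by rewrite addr_ge0// mulr_ge0// mulr_ge0// ltW.
(* for smaller phi, the bounded error N is at most eps / 2 times - ln phi / s *)
exists (Num.min phi0 (expR (- (1 + 2 * s * N / eps)))); first by rewrite lt_min p00 expR_gt0.
move=> phi /andP[f0]; rewrite lt_min => /andP[f1 f2].
have lphi : 1 + 2 * s * N / eps <= - ln phi.
  by move: f2; rewrite -ltr_ln ?posrE ?expR_gt0// expRK ltrNr => /ltW.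
have q0 : 0 <= 2 * s * N / eps by rewrite !mulr_ge0 ?invr_ge0 ?(ltW s0) ?(ltW e0).
have lp0 : 0 < - ln phi by rewrite (lt_le_trans _ lphi)// ltr_wpDr.
have phi1 : phi <= 1.
  by rewrite leNgt; apply/negP => /ln_gt0; lra.
rewrite lnV ?posrE//; split; first by rewrite mulr_gt0.
pose J (Z : R) := s^-1 * ln (s * Z + Num.sqrt (phi ^+ 2 + b * Z ^+ 2)).
have dJ (Z : R) : 0 <= Z <= del -> is_derive Z 1 J (model l b phi Z).
  by move=> _; rewrite l1; exact: log_primitive.
have := HC phi J (introT andP (conj f0 f1)) dJ.
rewrite /J mulr0 add0r expr0n/= mulr0 addr0 sqrtr_sqr (gtr0_norm f0) -mulrBr.
set X := Cconst _ _ _; set a := s * del + _ => HX.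
have a1 : s * del <= a by rewrite lerDl sqrtr_ge0.
have a2 : a <= 2 * (s * del) + 1.
  have : Num.sqrt (phi ^+ 2 + b * del ^+ 2) <= s * del + 1.
    rewrite -[leRHS]ger0_norm; last by rewrite addr_ge0// ltW.
    rewrite -sqrtr_sqr ler_wsqrtr//.
    have -> : b * del ^+ 2 = (s * del) ^+ 2 by rewrite exprMn sqr_sqrtr// ltW.
    have : phi ^+ 2 <= 1 by rewrite expr_le1// ltW.
    by rewrite sqrrD expr1n mulr1; move: sd0; lra.
  by rewrite /a; lra.
have a0 : 0 < a by exact: lt_le_trans a1.
have aL : `|ln a| <= L.
  have l1a : ln (s * del) <= ln a by rewrite ler_ln ?posrE.
  have l2a : ln a <= ln (2 * (s * del) + 1) by rewrite ler_ln ?posrE// (lt_le_trans a0).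
  have := ler_norm (- ln (s * del)); have := ler_norm (ln (2 * (s * del) + 1)).
  have := normr_ge0 (ln (s * del)); have := normr_ge0 (ln (2 * (s * del) + 1)).
  rewrite normrN /L => h1 h2 h3 h4; rewrite ler_norml; apply/andP; split; lra.
pose A := s^-1 * - ln phi; have A0 : 0 < A by rewrite mulr_gt0.
have e1 : `|s^-1 * ln a| <= s^-1 * L by rewrite normrM (gtr0_norm si0) ler_wpM2l// ltW.
have e2 : N <= eps / 2 * A.
  have h : 2 * s * N / eps <= - ln phi by lra.
  rewrite ler_pdivrMr// in h.
  have h2 := ler_wpM2l (ltW si0) h.
  have E : s^-1 * (2 * s * N) = 2 * N by field; rewrite gt_eqF.
  by rewrite E in h2; rewrite /A; lra.
have /andP[eta0 eta1] := eta4.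
have e3 : 3 * eta * (s^-1 * (ln a - ln phi)) <= 3 / 8 * eps * A + s^-1 * L.
  have -> : s^-1 * (ln a - ln phi) = s^-1 * ln a + A by rewrite /A; ring.
  have h1 : 3 * eta * A <= 3 / 8 * eps * A by rewrite ler_wpM2r ?(ltW A0)//; lra.
  have h2 : 3 * eta * (s^-1 * ln a) <= s^-1 * L.
    apply: (le_trans (ler_norm _)); rewrite normrM (gtr0_norm (_ : 0 < 3 * eta)) ?mulr_gt0//.
    apply: (le_trans _ e1); rewrite ler_piMl//; lra.
  lra.
have e5 : 0 <= eps * A by apply: mulr_ge0; exact: ltW.
have e6 : s^-1 * (ln a - ln phi) = s^-1 * ln a + A by rewrite /A; ring.
rewrite -/A; rewrite e6 in HX e3; rewrite /N in e2.
move: HX e1; rewrite !ler_norml => /andP[h1 h2] /andP[h3 h4].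
by apply/andP; split; lra.
Qed.

End laws.

Theorem theorem18 (R : realType) (d : nat) (Y : closedManifold R d)
    (k kappa : nat) (hk : (2 <= k)%N) (hkappa : (k <= kappa)%N)
    (w : R -> R -> R) (hw : scaling_function w)
    (I : set R) (hIopen : open I) (hIitv : is_interval I) (hI0 : I 0)
    (e1 : R) (he1 : 0 < e1 <= 1)
    (D : coeffs Y) (hD : regular_coeffs e1 I D)
    (hg : forall e z, param_domain e1 I (e, z) ->
       forall (i : chart_index Y) (y : Y), cdom (atlas i) y ->
         posdef (gmat k kappa w D e i z y)) :
  (exists2 zeta : R, 0 < zeta &
    forall z0 : R, I z0 -> 0 < z0 < zeta ->
    forall K : set R, compact K -> K `<=` `]0, pi / 2] ->
    exists (C : R) (e0 : R), 0 < e0 /\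
    forall e : R, 0 < e < e0 -> e < e1 ->
    forall (phi T : R) (z : R -> R) (y : R -> Y),
      K phi -> 0 < phi < pi / 2 -> 0 < T ->
      unit_speed_geodesic k kappa w D I e T z y ->
      z 0 = 0 -> 0 <= derive1 z 0 ->
      impact_angle k kappa w D e z y phi ->
      z T = z0 -> (forall t, 0 <= t <= T -> z t <= z0) ->
      exists Rem : R,
        length_Y D e T z y =
          1 / e ^+ (k - 1) * (Cconst k (w 1) phi * cos phi + Rem) /\
        `|Rem| <= C * (if (2 < k)%N then e else e * `|ln e|)) /\
  (forall l : nat, (0 < l)%N ->
    vanishes_to_order (2 * l) (fun Z => w 1 Z - 1) 0 ->
    exists2 C : R, 0 < C &
      if (1 < l)%N then
        Cconst k (w 1) phi / (C * phi `^ (- ((l%:R - 1) / l%:R)))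
          @[phi --> 0^'+] --> (1 : R)
      else
        Cconst k (w 1) phi / (C * ln phi^-1) @[phi --> 0^'+] --> (1 : R)).
Proof.
split.
  have [zeta zeta0 H] := geodesic_length hk hkappa hw hIopen hIitv hI0 he1 hD hg.
  exists zeta => // z0 _ hz K cK sK; have [C [e0 [e00 HC]]] := H z0 hz K cK sK.
  exists C, e0; split => // e he ee1 phi T z y Kphi _.
  exact: HC.
move=> l l0 van; have [l1|l1] := ltnP 1 l; first exact: Cconst_power_law.
by apply: (Cconst_log_law hw hk van); apply/eqP; rewrite eqn_leq l1 l0.
Qed.
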